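(* There is an absolute constant $c$ (independent of $n$ and of the distribution of $X$) such that for every integer $n \ge 2$ and every random vector $X$ in $\mathbb{R}^n$ with $\mathbb{E}|X|^2 = n$, $$ \mathbb{E}_\theta\, \rho(F_\theta,\Phi) \, \leq \, c\,\big(M_3^3 + \sigma_3^{3/2}\big)\,\frac{1}{\sqrt{n}} . $$
   Context: $|\cdot|$ and $\langle\cdot,\cdot\rangle$ are the Euclidean norm and inner product on $\mathbb{R}^n$. $S^{n-1}=\{\theta\in\mathbb{R}^n: |\theta|=1\}$, $\mu_{n-1}$ is the uniform (rotation-invariant) probability measure on $S^{n-1}$, and $\mathbb{E}_\theta$ denotes integration over $\theta\in S^{n-1}$ with respect to $\mu_{n-1}$. For $\theta\in S^{n-1}$, $S_\theta=\langle X,\theta\rangle=\theta_1X_1+\dots+\theta_nX_n$ and $F_\theta(x)=\mathbb{P}\{S_\theta\le x\}$, $x\in\mathbb{R}$. $\Phi(x)=\frac{1}{\sqrt{2\pi}}\int_{-\infty}^x e^{-y^2/2}\,dy$ is the standard normal distribution function. For distribution functions $U,V$ on $\mathbb{R}$, $\rho(U,V)=\sup_{x\in\mathbb{R}}|U(x)-V(x)|$ (Kolmogorov distance). For $p\ge1$, with values in $[0,\infty]$, $$M_p=\sup_{\theta\in S^{n-1}}\big(\mathbb{E}|\langle X,\theta\rangle|^p\big)^{1/p},\qquad \sigma_{2p}=\sqrt{n}\,\Big(\mathbb{E}\,\Big|\frac{|X|^2}{n}-1\Big|^p\Big)^{1/p},$$ so that $\sigma_3=\sqrt{n}\,\big(\mathbb{E}\,\big|\frac{|X|^2}{n}-1\big|^{3/2}\big)^{2/3}$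 (the case $p=3/2$). If the right-hand side is infinite the inequality is trivially true. *)

(* Defs.v *)
From HB Require Import structures.
From mathcomp Require Import all_boot all_order all_algebra.
From mathcomp Require Import all_classical all_reals all_analysis.

Set Implicit Arguments.
Unset Strict Implicit.
Unset Printing Implicit Defensive.

Import Order.TTheory GRing.Theory Num.Theory.
Import numFieldNormedType.Exports.

Local Open Scope classical_set_scope.
Local Open Scope ring_scope.

(* R^n is [n.-tuple R], which the library equips with the product (Borel)
   sigma-algebra.  The norm has to be defined: the library's norm on
   ['rV[R]_n] is the sup norm and tuples carry none. *)
Section euclidean.
Variables (R : realType) (n : nat).
Implicit Types (x y : n.-tuple R) (U : 'M[R]_n).

Definition dotp x y : R := \sum_(i < n) tnth x i * tnth y i.

Definition enorm x : R := Num.sqrt (dotp x x).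

Definition sphere : set (n.-tuple R) := [set theta | enorm theta = 1].

Definition mxact U x : n.-tuple R :=
  [tuple \sum_(j < n) U i j * tnth x j | i < n].

(* Orthogonal group invariance, rather than SO(n) invariance, so that the
   measure is unique also for n = 1; for n >= 2 the two are equivalent. *)
Definition uniform_on_sphere (mu : probability (n.-tuple R) R) : Prop :=
  mu sphere = 1%E /\
  forall U, U *m U^T = 1%:M ->
  forall A : set (n.-tuple R), measurable A -> mu (mxact U @^-1` A) = mu A.

End euclidean.
Arguments sphere {R n}.

Section distances.
Variable R : realType.
Local Open Scope ereal_scope.

Definition Phi (x : R) : \bar R := normal_prob 0 1 `]-oo, x].

(* Distribution functions take values in \bar R, as measures do. *)
Definition kolmogorov (U V : R -> \bar R) : \bar R :=
  ereal_sup [set `|U x - V x| | x in [set: R]].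

End distances.

Section random_vector.
Variables (R : realType) (n : nat) (d : measure_display) (T : measurableType d).
Variables (P : probability T R) (X : {RV P >-> n.-tuple R}).
Local Open Scope ereal_scope.

Definition weighted_sum (theta : n.-tuple R) (w : T) : R := dotp (X w) theta.

Definition Fdist (theta : n.-tuple R) (x : R) : \bar R :=
  P [set w | (weighted_sum theta w <= x)%R].

(* ['N[P]_p[f]] is (E |f|^p)^(1/p), possibly +oo. *)
Definition moment_sup (p : R) : \bar R :=
  ereal_sup [set 'N[P]_(p%:E)[EFin \o weighted_sum theta] | theta in sphere].

(* Indexed as sigma_{2p} is: the exponent is p = q / 2. *)
Definition sigma_moment (q : R) : \bar R :=
  (Num.sqrt n%:R)%:E *
  'N[P]_((q / 2)%:E)[EFin \o (fun w => enorm (X w) ^+ 2 / n%:R - 1)%R].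

End random_vector.

(* Main.v *)
(** Let [g] be a standard Gaussian vector independent of [X] and [theta], and put
    [r = |g| / sqrt n], so that [Z = r theta] has law N(0, I / n).  Replacing
    [<X, theta>] by [<X, Z>] changes the Kolmogorov distance to [Phi] by at most
    [3 |r^2 - 1|], whose mean is O(1 / sqrt n).  Smoothing by N(0, 1/n) bounds
    the distance for [<X, Z>] by O(1 / sqrt n) plus an integral over [t], with
    weight [exp(-t^2 / 2n) / |t|], of [|phi_Z(t) - exp(-t^2 / 2)|], where [phi_Z] is
    the characteristic function of [<X, Z>] given [Z].  Since [Z] is Gaussian,
    with [a = t^2 / 2], an independent copy [Y] of [X], [U = |X|^2 / n],
    [W = |Y|^2 / n] and [p = <X, Y> / n], the mean square of this difference is
    [E exp(-a (U + W - 2p)) - 2 exp(-a) E exp(-a U) + exp(-2a)].  Expand in [p]: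
    the linear and quadratic terms are exponentially small in [a] and have mean
    O(M_3^3 / n), by second moments of [<X, v>]; the cubic remainder is controlled
    by conditioning on [X] and [E |<X, v>|^3 <= M_3^3 |v|^3]; the fluctuations of [U]
    around 1 contribute the square of [E |U - 1|^(3/2)].  The lower bound
    [M_3^3 >= 1/4] absorbs the terms without moments. *)
Require Import Defs.
From HB Require Import structures.
From mathcomp Require Import all_boot all_order all_algebra.
From mathcomp Require Import all_classical all_reals all_analysis.
From mathcomp Require Import measurable_realfun ring lra.

Set Implicit Arguments.
Unset Strict Implicit.
Unset Printing Implicit Defensive.

Import Order.TTheory GRing.Theory Num.Theory.
Import numFieldNormedType.Exports.

Local Open Scope classical_set_scope.
Local Open Scope ring_scope.

(** * Exponential inequalities *)

(** Write [r = sqrt n], [K = M_3^3] and [s = E |U - 1|^(3/2)]; the target is then a multiple of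
    [K / r + s sqrt r]. The obstacle is that two parts of the mean square, of order
    [K (1 + s) / r^3] and [s^2], do not decay in [t]: their square roots, integrated against
    [dt / |t|] up to [|t| ~ r], would cost a logarithm of [n]. Both are smaller than the squared
    target by a factor of order [r], and [min1_growth] spends this factor: [min(1, t^2 / 2)] is at
    most [8 r t^2 exp(t^2 / r^2) (1 + t)^(-3)] for [t >= 0]. The square root of this bound has the
    integrable decay [(1 + t)^(-3/2)], and its factor [exp(t^2 / (2 r^2))] is cancelled exactly by
    the Gaussian weight of the smoothing. The remainders therefore have to keep the factor
    [min(1, t^2 / 2)], which also makes the integral converge at [t = 0]. The Gaussian radius is
    introduced because averaging [cos(t <x, Z>)] then gives an exponential of [|x|^2], where the
    uniform direction alone would give a Bessel function. *)

Lemma expR_taylor2_ge0 (R : realType) (x : R) : 0 <= expR x - 1 - x.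
Proof. by have := expR_ge1Dx x; lra. Qed.

(** For [x >= 0], multiply [exp(-x) (1 + x) >= 1 - x^2] by [exp(x)]; for [x < 0], use
    [(1 - x) exp(x) <= 1]. After multiplication by a further exponential the maximum becomes the
    larger of the exponentials at the two ends of the increment. *)
Lemma expR_taylor2_le (R : realType) (x : R) :
  expR x - 1 - x <= x ^+ 2 * Num.max 1 (expR x).
Proof.
have hN := expR_ge1Dx (- x); have hx := expR_gt0 x.
have hinv : expR x * expR (- x) = 1 by rewrite -expRD subrr expR0.
have [x0|x0] := lerP 0 x.
  apply: (@le_trans _ _ (x ^+ 2 * expR x)); last first.
    by rewrite ler_wpM2l ?sqr_ge0// le_max lexx orbT.
  suff : 0 <= expR x * (expR (- x) * (1 + x) - (1 - x ^+ 2)).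
    rewrite mulrBr mulrA hinv; nra.
  apply: mulr_ge0; first exact: ltW.
  nra.
apply: (@le_trans _ _ (x ^+ 2)); last first.
  by rewrite ler_peMr ?sqr_ge0// le_max lexx.
suff : 0 <= (1 - x) * (x ^+ 2 - (expR x - 1 - x)) by rewrite pmulr_rge0; lra.
have : 0 <= - x * x ^+ 2 by rewrite mulr_ge0 ?sqr_ge0//; lra.
nra.
Qed.

Lemma expR_lip (R : realType) (a b t : R) : 0 <= t -> 0 <= a -> 0 <= b ->
  `|expR (- (t * a)) - expR (- (t * b))| <= t * `|a - b|.
Proof.
move=> t0.
suff H c d : c <= d -> 0 <= c ->
    `|expR (- (t * c)) - expR (- (t * d))| <= t * `|c - d|.
  move=> a0 b0; have [/H->//|/ltW ba] := leP a b.
  by rewrite distrC (distrC a b) H.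
move: c d => {}a {}b ab a0.
rewrite ger0_norm; last by rewrite subr_ge0 ler_expR; nra.
rewrite distrC ger0_norm ?subr_ge0//.
have e1 : expR (- (t * a)) <= 1 by rewrite expR_le1; nra.
have e0 := expR_gt0 (- (t * a)).
have -> : - (t * b) = - (t * a) + - (t * (b - a)) by ring.
rewrite expRD.
have := expR_ge1Dx (- (t * (b - a))).
have : 0 <= t * (b - a) by nra.
nra.
Qed.

Lemma min1_le (R : realType) (t : R) : Num.min 1 t <= t.
Proof. by rewrite ge_min lexx orbT. Qed.

Lemma xexpRN_le1 (R : realType) (x : R) : x * expR (- x) <= 1.
Proof.
have := expR_ge1Dx x; have h := expR_gt0 (- x).
have : expR x * expR (- x) = 1 by rewrite -expRD subrr expR0.
nra.
Qed.

(** The left side is the square of [y = t exp(-t / 4)], and [y] is at most both 4 and [t]. *)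
Lemma sqr_expRN_le (R : realType) (t : R) : 0 <= t ->
  t ^+ 2 * expR (- (t / 2)) <= 16 * Num.min 1 t.
Proof.
move=> t0.
have h := xexpRN_le1 (t / 4).
have e : expR (- (t / 2)) = expR (- (t / 4)) * expR (- (t / 4)).
  by rewrite -expRD; congr expR; lra.
have h0 := expR_gt0 (- (t / 4)).
have h1 : expR (- (t / 4)) <= 1 by rewrite expR_le1; lra.
have hh : t * expR (- (t / 4)) <= 4 by lra.
have h2 : 0 <= t * expR (- (t / 4)) by nra.
have -> : t ^+ 2 * expR (- (t / 2)) = (t * expR (- (t / 4))) ^+ 2.
  by rewrite e; ring.
have h3 : t * expR (- (t / 4)) <= t by nra.
set y := t * expR _ in hh h2 h3 *.
have [t1|t1] := leP 1 t; nra.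
Qed.

(* The pair (U, W) = (|X|^2, |Y|^2) / n and p = <X, Y> / n. *)
Lemma expR_cross_le (R : realType) (t U W p : R) :
  0 <= t -> 0 <= U -> 0 <= W -> 2 * `|p| <= U + W -> 1 / 2 <= U + W ->
  expR (- (t * (U + W - 2 * p))) - expR (- (t * (U + W))) * (1 + 2 * t * p)
  <= 4 * t ^+ 2 * expR (- (t / 4)) * p ^+ 2 + 1024 * Num.min 1 t * `|p| ^+ 3.
Proof.
move=> t0 U0 W0 hp hUW.
set a := U + W.
have eD : expR (- (t * (a - 2 * p))) = expR (- (t * a)) * expR (2 * t * p).
  by rewrite -expRD; congr expR; ring.
have T := expR_taylor2_le (2 * t * p).
have ea := expR_gt0 (- (t * a)).
have ea1 : expR (- (t * a)) <= 1 by rewrite expR_le1; rewrite /a; nra.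
have pl : p <= `|p| by exact: ler_norm.
have pl' : - p <= `|p| by rewrite -normrN ler_norm.
have p0 : 0 <= `|p| by [].
have pp : p ^+ 2 = `|p| ^+ 2 by rewrite real_normK ?num_real.
have m0 : 0 <= Num.min 1 t by rewrite le_min ler01.
set q := `|p| in hp pl pl' p0 pp *.
have q3 : 0 <= q ^+ 3 by rewrite exprn_ge0.
have e40 := expR_gt0 (- (t / 4)).
have mq0 : 0 <= Num.min 1 t * q ^+ 3 by exact: mulr_ge0.
have D1 : expR (- (t * (a - 2 * p))) - expR (- (t * a)) * (1 + 2 * t * p) <=
    4 * t ^+ 2 * p ^+ 2 * Num.max (expR (- (t * a))) (expR (- (t * (a - 2 * p)))).
  rewrite eD.
  have -> : Num.max (expR (- (t * a))) (expR (- (t * a)) * expR (2 * t * p)) =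
     expR (- (t * a)) * Num.max 1 (expR (2 * t * p)).
    by rewrite maxr_pMr ?mulr1 ?ltW.
  have := ler_wpM2l (ltW ea) T; nra.
have tp0 : 0 <= 4 * t ^+ 2 * p ^+ 2.
  by rewrite mulr_ge0 ?sqr_ge0// mulr_ge0 ?sqr_ge0.
(* If [2 |p| <= a / 2], the exponent [a - 2 p] stays above [a / 2 >= 1 / 4], which gives the
   quadratic term its decay. Otherwise [|p| > 1 / 8], so [1 <= 512 |p|^3] and [p^2 <= 8 |p|^3]:
   everything goes into the cubic term. The constant 1024 is twice 512, the left side being at most
   2. *)
have [small|big] := lerP (2 * q) (a / 2).
  apply: (@le_trans _ _ (4 * t ^+ 2 * p ^+ 2 * expR (- (t / 4)))).
    apply: (le_trans D1); rewrite ler_wpM2l// ge_max !ler_expR.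
    by apply/andP; split; rewrite lerN2; rewrite /a in small *; nra.
  by lra.
have q8 : 1 / 8 < q by rewrite /a in big; lra.
suff D2 : expR (- (t * (a - 2 * p))) - expR (- (t * a)) * (1 + 2 * t * p) <=
    1024 * Num.min 1 t * q ^+ 3.
  apply: (le_trans D2); rewrite lerDr.
  by have := mulr_ge0 tp0 (ltW e40); lra.
have eap1 : expR (- (t * (a - 2 * p))) <= 1.
  by rewrite expR_le1; rewrite /a; nra.
have [t1|t1] := lerP 1 t.
  rewrite mulr1.
  have : - (expR (- (t * a)) * (1 + 2 * t * p)) <= 1.
    have := xexpRN_le1 (t * a).
    have : - (2 * t * p) <= t * a by rewrite /a; nra.
    nra.
  have : 1 / 512 <= q ^+ 3.
    by rewrite exprSr; nra.
  lra.
apply: (@le_trans _ _ (4 * t ^+ 2 * p ^+ 2)).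
  apply: (le_trans D1); rewrite ler_piMr// ge_max ea1//.
rewrite pp.
have : 0 <= t * q ^+ 2 by rewrite mulr_ge0 ?sqr_ge0.
have -> : q ^+ 3 = q ^+ 2 * q by ring.
have -> : 4 * t ^+ 2 * q ^+ 2 = 4 * t * (t * q ^+ 2) by ring.
have -> : 1024 * t * (q ^+ 2 * q) = 1024 * q * (t * q ^+ 2) by ring.
move=> h; apply: ler_wpM2r => //; nra.
Qed.

(** The power [|x|^(3/2)], written with a square root so that estimates become polynomial in
    [w = sqrt |x|]. *)
Definition pow32 {R : realType} (x : R) : R := `|x| * Num.sqrt `|x|.

Lemma pow32_ge0 (R : realType) (x : R) : 0 <= pow32 x.
Proof. by rewrite mulr_ge0// sqrtr_ge0. Qed.

(** Linearisation at [U = 1], chosen because the linear term will have mean zero. For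
    [|U - 1| <= 1 / 2] the quadratic remainder suffices, as [v^2 <= |v|^(3/2)] there; for larger
    deviations the left side grows at most linearly and [|v| <= 2 |v|^(3/2)]. *)
Lemma expR_centered_le (R : realType) (t U : R) : 0 <= t -> 0 <= U ->
  `|expR (- (t * U)) - expR (- t) + t * expR (- t) * (U - 1)|
  <= 16 * Num.min 1 t * pow32 (U - 1).
Proof.
move=> t0 U0.
set v := U - 1.
have T := expR_taylor2_le (- (t * v)).
have T0 := expR_taylor2_ge0 (- (t * v)).
have eD : expR (- (t * U)) = expR (- t) * expR (- (t * v)).
  by rewrite -expRD; congr expR; rewrite /v; ring.
have et := expR_gt0 (- t).
have et1 : expR (- t) <= 1 by rewrite expR_le1; lra.
have eU1 : expR (- (t * U)) <= 1 by rewrite expR_le1; nra.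
have E : expR (- (t * U)) - expR (- t) + t * expR (- t) * v =
    expR (- t) * (expR (- (t * v)) - 1 - - (t * v)) by rewrite eD; ring.
have vN : v <= `|v| by exact: ler_norm.
have vN' : - v <= `|v| by rewrite -normrN ler_norm.
rewrite /pow32.
set w := Num.sqrt `|v|.
have w0 : 0 <= w by exact: sqrtr_ge0.
have wE : `|v| = w ^+ 2 by rewrite sqr_sqrtr.
have vv : v ^+ 2 = w ^+ 2 * w ^+ 2.
  by rewrite -wE -expr2 real_normK ?num_real.
rewrite {1}E ger0_norm; last by rewrite mulr_ge0// ltW.
have [small|big] := lerP `|v| (1 / 2).
  have D : expR (- t) * (expR (- (t * v)) - 1 - - (t * v)) <=
      t ^+ 2 * v ^+ 2 * expR (- (t / 2)).
    apply: (@le_trans _ _ (t ^+ 2 * v ^+ 2 *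
        Num.max (expR (- t)) (expR (- t) * expR (- (t * v))))).
      have -> : Num.max (expR (- t)) (expR (- t) * expR (- (t * v))) =
         expR (- t) * Num.max 1 (expR (- (t * v))).
        by rewrite maxr_pMr ?mulr1 ?ltW.
      have := ler_wpM2l (ltW et) T; nra.
    apply: ler_wpM2l; first by rewrite mulr_ge0 ?sqr_ge0.
    rewrite -eD ge_max !ler_expR.
    by apply/andP; split; rewrite /v in vN' vN small; nra.
  apply: (le_trans D).
  have := sqr_expRN_le t0 => h.
  rewrite wE in small.
  have -> : t ^+ 2 * v ^+ 2 * expR (- (t / 2)) =
     t ^+ 2 * expR (- (t / 2)) * v ^+ 2 by ring.
  have vw : v ^+ 2 <= `|v| * w.
    by rewrite vv wE; have : 0 <= w ^+ 2 by [exact: sqr_ge0]; nra.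
  apply: ler_pM (sqr_ge0 v) h vw.
  by apply: mulr_ge0; [exact: sqr_ge0|exact: expR_ge0].
rewrite -E.
have big' := big; rewrite wE in big'.
rewrite wE.
have w4 : 4 * w ^+ 2 <= 8 * (w ^+ 2 * w) by nra.
have [t1|t1] := lerP 1 t.
  have := xexpRN_le1 t => h.
  have : t * expR (- t) * v <= w ^+ 2.
    have : t * expR (- t) * v <= t * expR (- t) * `|v|.
      by apply: ler_wpM2l => //; nra.
    rewrite wE; nra.
  by nra.
have L := expR_lip t0 U0 ler01.
rewrite mulr1 in L.
have {}L : expR (- (t * U)) - expR (- t) <= t * `|v| by apply: le_trans L; exact: ler_norm.
have : t * expR (- t) * v <= t * `|v|.
  apply: (@le_trans _ _ (t * expR (- t) * `|v|)).
    by apply: ler_wpM2l => //; nra.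
  by apply: ler_wpM2r => //; nra.
rewrite wE in L *; nra.
Qed.

(** * Gaussian integrals *)

Lemma Rintegral_prob_cst d (T : measurableType d) (R : realType)
    (P : probability T R) (c : R) : \int[P]_x c = c.
Proof.
by rewrite Rintegral_cst// -[RHS]mulr1; have /= -> := probability_setT P.
Qed.

Lemma le_integrableR d (T : measurableType d) (R : realType)
    (mu : {measure set T -> \bar R}) (f g : T -> R) :
  measurable_fun setT f -> (forall x, `|f x| <= g x) ->
  mu.-integrable setT (EFin \o g) -> mu.-integrable setT (EFin \o f).
Proof.
move=> mf fg; apply: le_integrable => //; first exact/measurable_EFinP.
by move=> x _ /=; rewrite lee_fin (le_trans (fg x))// ler_norm.
Qed.

Lemma integrableBR d (T : measurableType d) (R : realType)
    (mu : {measure set T -> \bar R}) (f g : T -> R) :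
  mu.-integrable setT (EFin \o f) -> mu.-integrable setT (EFin \o g) ->
  mu.-integrable setT (EFin \o (fun x => f x - g x)).
Proof. by move=> fi gi; have := integrableB measurableT fi gi. Qed.

Lemma integrableDR d (T : measurableType d) (R : realType)
    (mu : {measure set T -> \bar R}) (f g : T -> R) :
  mu.-integrable setT (EFin \o f) -> mu.-integrable setT (EFin \o g) ->
  mu.-integrable setT (EFin \o (fun x => f x + g x)).
Proof. by move=> fi gi; have := integrableD measurableT fi gi. Qed.

Lemma integrableZR d (T : measurableType d) (R : realType)
    (mu : {measure set T -> \bar R}) (c : R) (f : T -> R) :
  mu.-integrable setT (EFin \o f) ->
  mu.-integrable setT (EFin \o (fun x => c * f x)).
Proof. by move=> fi; have := integrableZl measurableT c fi. Qed.

Lemma bounded_integrable d (T : measurableType d) (R : realType)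
    (P : probability T R) (f : T -> R) (M : R) :
  measurable_fun setT f -> (forall x, `|f x| <= M) ->
  P.-integrable setT (EFin \o f).
Proof.
move=> mf fM; apply: (@le_integrableR _ _ _ _ _ (cst M)) => //.
exact: finite_measure_integrable_cst.
Qed.

(** The change of variables produces the Radon-Nikodym derivative, which agrees almost everywhere
    with [normal_pdf] because both have the same integral over every measurable set. *)
Lemma ge0_integral_normal_prob (R : realType) (m s : R) (f : R -> \bar R) :
  s != 0 -> measurable_fun setT f -> (forall x, 0 <= f x)%E ->
  (\int[normal_prob m s]_x f x =
   \int[lebesgue_measure]_x (f x * (normal_pdf m s x)%:E))%E.
Proof.
move=> s0 mf f0.
have dom := normal_prob_dominates m s.
rewrite -(Radon_Nikodym_SigmaFinite.change_of_variables dom f0 measurableT mf).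
have mpdf : measurable_fun setT (fun x => (normal_pdf m s x)%:E).
  by apply/measurable_EFinP; exact: measurable_normal_pdf.
have mRN : measurable_fun setT
    (Radon_Nikodym_SigmaFinite.f (normal_prob m s) lebesgue_measure).
  exact: measurable_int (Radon_Nikodym_SigmaFinite.f_integrable dom).
apply: ae_eq_integral => //; [exact: emeasurable_funM|exact: emeasurable_funM|].
apply: ae_eqe_mul2l; apply: integral_ae_eq => //.
  exact: Radon_Nikodym_SigmaFinite.f_integrable.
by move=> E _ mE; rewrite -Radon_Nikodym_SigmaFinite.f_integral.
Qed.

Lemma integrable_normal_prob (R : realType) (m s : R) (f : R -> R) :
  s != 0 -> measurable_fun setT f ->
  (normal_prob m s).-integrable setT (EFin \o f) ->
  lebesgue_measure.-integrable setT (EFin \o (fun x => f x * normal_pdf m s x)).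
Proof.
move=> s0 mf /integrableP[_ fi]; apply/integrableP; split.
  apply/measurable_EFinP/measurable_funM => //; exact: measurable_normal_pdf.
move: fi; rewrite ge0_integral_normal_prob//; last first.
  by apply/measurableT_comp => //; exact/measurable_EFinP.
congr (_ < _)%E; apply: eq_integral => x _ /=.
by rewrite -EFinM normrM (ger0_norm (normal_pdf_ge0 _ _ _)).
Qed.

Lemma integral_normal_prob (R : realType) (m s : R) (f : R -> R) :
  s != 0 -> measurable_fun setT f ->
  (normal_prob m s).-integrable setT (EFin \o f) ->
  (\int[normal_prob m s]_x (f x)%:E =
   \int[lebesgue_measure]_x (f x * normal_pdf m s x)%:E)%E.
Proof.
move=> s0 mf fi; rewrite integralE [RHS]integralE.
have mfE : measurable_fun setT (EFin \o f) by exact/measurable_EFinP.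
rewrite !ge0_integral_normal_prob//; last 2 first.
  exact: measurable_funeneg.
  exact: measurable_funepos.
congr (_ - _)%E; apply: eq_integral => x _.
- rewrite !funeposE /= -!EFin_max -EFinM; congr EFin.
  by rewrite maxr_pMl ?mul0r// normal_pdf_ge0.
- rewrite !funenegE /= -!EFin_max -EFinM; congr EFin.
  by rewrite maxr_pMl ?mul0r ?mulNr// normal_pdf_ge0.
Qed.

Lemma normal_peakE (R : realType) (s : R) : 0 < s ->
  normal_peak s = normal_peak 1 / s.
Proof.
have H r : 0 < r -> (normal_peak r)^-1 = r * Num.sqrt (pi *+ 2).
  move=> r0; rewrite /normal_peak invrK -mulrnAr sqrtrM ?sqr_ge0//.
  by rewrite sqrtr_sqr gtr0_norm.
move=> s0; apply: invr_inj; by rewrite H// invfM H// mul1r invrK mulrC.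
Qed.

Lemma normal_pdf_tilt (R : realType) (s r x : R) : 0 < s -> 0 < r ->
  expR ((s ^- 2 - r ^- 2) / 2 * x ^+ 2) * normal_pdf 0 s x =
  r / s * normal_pdf 0 r x.
Proof.
move=> s0 r0; rewrite !normal_pdfE ?gt_eqF//.
rewrite (normal_peakE s0) (normal_peakE r0) /normal_fun !subr0.
rewrite mulrCA -expRD.
have -> : (s ^- 2 - r ^- 2) / 2 * x ^+ 2 + - x ^+ 2 / (s ^+ 2 *+ 2) =
    - x ^+ 2 / (r ^+ 2 *+ 2) by field; rewrite !gt_eqF.
by field; rewrite !gt_eqF.
Qed.

(** Tilting N(0, s^2) by this exponential gives N(0, r^2) up to the ratio of normalising constants.
    Indexing the rate by [r] makes the moment finite for every [r > 0]. *)
Lemma normal_exp_moment (R : realType) (s r : R) : 0 < s -> 0 < r ->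
  (\int[normal_prob 0 s]_x (expR ((s ^- 2 - r ^- 2) / 2 * x ^+ 2))%:E =
   (r / s)%:E)%E.
Proof.
move=> s0 r0.
rewrite ge0_integral_normal_prob ?gt_eqF//; last first.
  apply/measurable_EFinP; apply: measurableT_comp => //.
  by apply: measurable_funM => //; exact: measurable_funX.
under eq_integral do rewrite -EFinM normal_pdf_tilt// EFinM.
rewrite ge0_integralZl//; last 3 first.
- by apply/measurable_EFinP; exact: measurable_normal_pdf.
- by move=> x _; rewrite lee_fin normal_pdf_ge0.
- by rewrite lee_fin divr_ge0 ?ltW.
by rewrite integral_normal_pdf mule1.
Qed.

Lemma normr_le_expR_sqr (R : realType) (s x : R) : 0 < s ->
  `|x| <= 2 * s * expR ((s ^- 2 - (2 * s) ^- 2) / 2 * x ^+ 2).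
Proof.
move=> s0.
set y := `|x| / s.
have -> : (s ^- 2 - (2 * s) ^- 2) / 2 * x ^+ 2 = 3 / 8 * y ^+ 2.
  have -> : y ^+ 2 = x ^+ 2 / s ^+ 2.
    by rewrite /y exprMn exprVn real_normK ?num_real.
  by field; rewrite gt_eqF.
have -> : `|x| = s * y by rewrite /y mulrCA divff ?mulr1// gt_eqF.
have := expR_ge1Dx (3 / 8 * y ^+ 2); set e := expR _ => he.
have : y <= 2 * e by nra.
nra.
Qed.

Lemma integrable_norm_normal (R : realType) (s : R) : 0 < s ->
  (normal_prob 0 s).-integrable setT (EFin \o (fun x : R => `|x|)).
Proof.
move=> s0; apply: (@le_integrableR _ _ R (normal_prob 0 s) _ (fun x =>
    2 * s * expR ((s ^- 2 - (2 * s) ^- 2) / 2 * x ^+ 2))) => //.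
- exact: normr_measurable.
- by move=> x; rewrite /= normr_id normr_le_expR_sqr.
- have mE : measurable_fun setT (fun x : R =>
      expR ((s ^- 2 - (2 * s) ^- 2) / 2 * x ^+ 2)).
    apply: measurableT_comp => //.
    by apply: measurable_funM => //; exact: measurable_funX.
  apply/integrableP; split.
    by apply/measurable_EFinP; exact: measurable_funM.
  under eq_integral do rewrite /= ger0_norm ?mulr_ge0 ?expR_ge0 ?ltW// EFinM.
  rewrite ge0_integralZl//; last 2 first.
  + by apply/measurable_EFinP.
  + by rewrite lee_fin mulr_ge0// ltW.
  by rewrite normal_exp_moment ?mulr_gt0// -EFinM ltry.
Qed.

(** The boundary-free form of integration by parts on the line: the fundamental theorem on
    [[-n-1, n+1]], then dominated convergence. *)
Lemma integral_derive_cvg0 (R : realType) (f F : R -> R) :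
  continuous f -> (forall x : R, is_derive x (1:R) F (f x)) ->
  lebesgue_measure.-integrable setT (EFin \o f) ->
  F n.+1%:R @[n --> \oo] --> (0:R) -> F (- n.+1%:R) @[n --> \oo] --> (0:R) ->
  (\int[lebesgue_measure]_x (f x)%:E = 0)%E.
Proof.
move=> cf dF intf Fp Fn.
have mf : measurable_fun setT f by exact: continuous_measurable_fun.
have cF x : {for x, continuous F}.
  by apply: differentiable_continuous; apply/derivable1_diffP; case: (dF x).
pose I n := `[- (n.+1%:R : R), n.+1%:R]%classic.
pose f_ n := (EFin \o f) \_ (I n).
have E n : (\int[lebesgue_measure]_x f_ n x = (F n.+1%:R - F (- n.+1%:R))%:E)%E.
  rewrite /f_ -integral_mkcond.
  rewrite (@continuous_FTC2 _ f F)//.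
  - by rewrite (@lt_trans _ _ 0)// ?oppr_lt0 ltr0n.
  - exact: continuous_subspaceT.
  - split; first by move=> x _; case: (dF x).
      exact: cvg_at_right_filter (cF _).
    exact: cvg_at_left_filter (cF _).
  - by move=> x _; rewrite derive1E; apply: derive_val.
have mfE : measurable_fun setT (EFin \o f) by exact/measurable_EFinP.
have mf_ n : measurable_fun setT (f_ n).
  apply/(measurable_restrictT _ _).1; first exact: measurable_itv.
  exact: measurable_funTS.
have cvf : {ae lebesgue_measure, forall x : R, setT x ->
    f_ ^~ x @ \oo --> (EFin \o f) x}.
  apply/aeW => x _; apply: cvg_near_cst.
  exists (Num.bound `|x|) => // n /= xn.
  rewrite /f_ patchE mem_set// /I /= in_itv/= -ler_norml ltW//.
  by rewrite (lt_le_trans (archi_boundP _))// ler_nat leqW.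
have bf : {ae lebesgue_measure, forall (x : R) n, setT x ->
    (`|f_ n x| <= (abse \o (EFin \o f)) x)%E}.
  by apply/aeW => x n _; rewrite /f_ patchE; case: ifPn => //=; rewrite normr0 lee_fin.
have [_ _ h1] := @dominated_convergence _ _ _ lebesgue_measure _
  measurableT _ _ _ mf_ mfE cvf (integrable_abse intf) bf.
move: h1; under eq_fun do rewrite E.
have : (F n.+1%:R - F (- n.+1%:R))%:E @[n --> \oo] --> (0 - 0 : R)%:E.
  by apply: cvg_EFin; [exact: nearW|exact: cvgB].
rewrite subr0 => h2 h1.
by apply: cvg_unique h1 h2.
Qed.

Lemma is_derive_continuous (R : realType) (f : R -> R) (x df : R) :
  is_derive x (1 : R) f df -> {for x, continuous f}.
Proof.
by case=> df' _; apply: differentiable_continuous; apply/derivable1_diffP.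
Qed.

Lemma is_derive_normal_pdf (R : realType) (s x : R) : 0 < s ->
  is_derive x (1 : R) (normal_pdf 0 s) (- (x / s ^+ 2) * normal_pdf 0 s x).
Proof.
move=> s0; rewrite normal_pdfE ?gt_eqF// /normal_fun.
have -> : (fun y : R => normal_peak s * expR (- (y - 0) ^+ 2 / (s ^+ 2 *+ 2))) =
    normal_peak s \*: (expR \o (fun y : R => (- (s ^+ 2 *+ 2)^-1) * (y * y))).
  apply/funext => y /=; rewrite subr0 /GRing.scale/=.
  by congr (_ * expR _); rewrite -expr2; field; rewrite gt_eqF.
have H : is_derive x (1 : R) (fun y : R => (- (s ^+ 2 *+ 2)^-1) * (y * y)) (- (x / s ^+ 2)).
  apply: is_derive_eq; rewrite /GRing.scale/=.
  by field; rewrite gt_eqF.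
apply: is_derive_eq; rewrite /GRing.scale/= subr0.
have -> : (- (s ^+ 2 *+ 2)^-1) * (x * x) = - x ^+ 2 / (s ^+ 2 *+ 2).
  by field; rewrite gt_eqF.
ring.
Qed.

Lemma is_derive_cos_affine (R : realType) (u a x : R) :
  is_derive x (1 : R) (fun y => cos (u * y + a)) (- (u * sin (u * x + a))).
Proof.
have H : is_derive x (1 : R) (fun y : R => u * y + a) u.
  by apply: is_derive_eq; rewrite /GRing.scale/=; ring.
have := @is_derive1_comp _ cos _ _ _ _ (is_derive_cos _) H.
by move=> /is_derive_eq; apply; ring.
Qed.

Lemma is_derive_sin_affine (R : realType) (u a x : R) :
  is_derive x (1 : R) (fun y => sin (u * y + a)) (u * cos (u * x + a)).
Proof.
have H : is_derive x (1 : R) (fun y : R => u * y + a) u.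
  by apply: is_derive_eq; rewrite /GRing.scale/=; ring.
have := @is_derive1_comp _ sin _ _ _ _ (is_derive_sin _) H.
by move=> /is_derive_eq; apply; ring.
Qed.

Lemma normr_cos_le1 (R : realType) (x : R) : `|cos x| <= 1.
Proof. by rewrite ler_norml cos_geN1 cos_le1. Qed.

Lemma normr_sin_le1 (R : realType) (x : R) : `|sin x| <= 1.
Proof. by rewrite ler_norml sin_geN1 sin_le1. Qed.

Lemma measurable_cos_comp d (T : measurableType d) (R : realType) (f : T -> R) :
  measurable_fun setT f -> measurable_fun setT (fun x => cos (f x)).
Proof.
move=> mf; apply: (measurableT_comp _ mf).
by apply: continuous_measurable_fun; exact: continuous_cos.
Qed.

Lemma measurable_sin_comp d (T : measurableType d) (R : realType) (f : T -> R) :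
  measurable_fun setT f -> measurable_fun setT (fun x => sin (f x)).
Proof.
move=> mf; apply: (measurableT_comp _ mf).
by apply: continuous_measurable_fun; exact: continuous_sin.
Qed.

Lemma measurable_expR_comp d (T : measurableType d) (R : realType) (f : T -> R) :
  measurable_fun setT f -> measurable_fun setT (fun x => expR (f x)).
Proof. by move=> mf; apply: (measurableT_comp _ mf); exact: measurable_expR. Qed.

(** Stein's identity [E[x f(x)] = s^2 E[f'(x)]] for [f(x) = sin(u x + a)]: the difference of the two
    sides is the integral of the derivative of [s^2 f] times the density. *)
Lemma normal_cos_by_parts (R : realType) (s u a : R) : 0 < s ->
  \int[normal_prob 0 s]_x (- (x * sin (u * x + a))) =
  - (s ^+ 2 * u) * \int[normal_prob 0 s]_x cos (u * x + a).
Proof.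
move=> s0.
have maff : measurable_fun setT (fun x : R => u * x + a).
  by apply: measurable_funD => //; exact: measurable_funM.
have mxs : measurable_fun setT (fun x : R => - (x * sin (u * x + a))).
  apply: measurableT_comp => //; apply: measurable_funM => //.
  exact: measurable_sin_comp.
have mc : measurable_fun setT (fun x : R => cos (u * x + a)).
  exact: measurable_cos_comp.
have i1 : (normal_prob 0 s).-integrable setT
    (EFin \o (fun x : R => - (x * sin (u * x + a)))).
  apply: (@le_integrableR _ _ R (normal_prob 0 s) _ (fun x => `|x|)) => //.
    by move=> x; rewrite normrN normrM ler_piMr// normr_sin_le1.
  exact: integrable_norm_normal.
have i2 : (normal_prob 0 s).-integrable setT
    (EFin \o (fun x : R => cos (u * x + a))).
  apply: (@bounded_integrable _ _ R (normal_prob 0 s) _ 1) => // x.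
  exact: normr_cos_le1.
have i3 : (normal_prob 0 s).-integrable setT
    (EFin \o (fun x : R => s ^+ 2 * u * cos (u * x + a))).
  by have := integrableZl measurableT (s ^+ 2 * u) i2.
apply/eqP; rewrite -subr_eq0 mulNr opprK -RintegralZl// -RintegralD//; apply/eqP.
rewrite /Rintegral integral_normal_prob ?(lt0r_neq0 s0)//; last 2 first.
  by apply: measurable_funD => //; exact: measurable_funM.
  by have := integrableD measurableT i1 i3.
have df (x : R) : is_derive x (1 : R)
    (fun x => s ^+ 2 * (sin (u * x + a) * normal_pdf 0 s x))
    ((- (x * sin (u * x + a)) + s ^+ 2 * u * cos (u * x + a)) *
        normal_pdf 0 s x).
  have H2 := is_derive_normal_pdf x s0.
  apply: is_derive_eq; rewrite /GRing.scale/=.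
  by field; rewrite gt_eqF.
have npb n : `|normal_pdf 0 s n.+1%:R| <= (2 * s ^+ 2 * normal_peak s) * n.+1%:R^-1.
  rewrite ger0_norm ?normal_pdf_ge0// normal_pdfE ?gt_eqF//.
  rewrite [leRHS]mulrAC [leRHS]mulrC ler_wpM2l ?normal_peak_ge0//.
  rewrite /normal_fun subr0.
  have x1 : 1 <= n.+1%:R :> R by rewrite ler1n.
  set x : R := n.+1%:R in x1 *.
  have := xexpRN_le1 (x ^+ 2 / (s ^+ 2 *+ 2)).
  rewrite mulNr; set e := expR _ => h.
  rewrite ler_pdivlMr; last by lra.
  have : x ^+ 2 * e <= 2 * s ^+ 2.
    have -> : x ^+ 2 * e = x ^+ 2 / (s ^+ 2 *+ 2) * e * (2 * s ^+ 2).
      by field; rewrite gt_eqF.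
    by nra.
  nra.
have cv0 (sg : R -> R) : (forall n,
    `|sg n.+1%:R| <= (s ^+ 2 * (2 * s ^+ 2 * normal_peak s)) * n.+1%:R^-1) ->
   sg n.+1%:R @[n --> \oo] --> (0:R).
  move=> h; apply: norm_cvg0.
  apply: (@squeeze_cvgr _ _ _ _ (cst 0) (fun n =>
    (s ^+ 2 * (2 * s ^+ 2 * normal_peak s)) * n.+1%:R^-1)).
  - by apply: nearW => n; rewrite normr_ge0 h.
  - exact: cvg_cst.
  - rewrite -[X in _ --> X](mulr0 (s ^+ 2 * (2 * s ^+ 2 * normal_peak s))).
    by apply: cvgMr; exact: cvg_harmonic.
rewrite [X in fine X](_ : _ = 0%E)//.
apply: (integral_derive_cvg0 _ df).
- move=> x; apply: cvgM; last by apply: continuous_normal_pdf; rewrite gt_eqF.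
  apply: (@cvgD _ R^o).
    apply: (@cvgN _ R^o); apply: cvgM; first exact: cvg_id.
    exact: is_derive_continuous (is_derive_sin_affine u a x).
  apply: cvgM; first exact: cvg_cst.
  exact: is_derive_continuous (is_derive_cos_affine u a x).
- apply: integrable_normal_prob; rewrite ?gt_eqF//.
    by apply: measurable_funD => //; exact: measurable_funM.
  by have := integrableD measurableT i1 i3.
- apply: (cv0 (fun x => s ^+ 2 * (sin (u * x + a) * normal_pdf 0 s x))) => n.
  rewrite normrM -[leRHS]mulrA ger0_norm ?sqr_ge0//.
  rewrite ler_wpM2l ?sqr_ge0// (le_trans _ (npb n))// normrM ler_piMl//.
  exact: normr_sin_le1.
- apply: (cv0 (fun x => s ^+ 2 * (sin (u * (- x) + a) * normal_pdf 0 s (- x)))) => n.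
  rewrite normrM -[leRHS]mulrA ger0_norm ?sqr_ge0//.
  rewrite ler_wpM2l ?sqr_ge0// (le_trans _ (npb n))// normrM.
  have -> : normal_pdf 0 s (- n.+1%:R) = normal_pdf 0 s n.+1%:R.
    by rewrite normal_pdfE ?gt_eqF// /normal_fun !subr0 sqrrN.
  by rewrite ler_piMl// normr_sin_le1.
Qed.

(** As a function of [u] the integral solves [J' = - s^2 u J], by differentiation under the integral
    and Stein's identity; hence [J] times [exp(s^2 u^2 / 2)] is constant. The phase [a] covers
    cosine and sine together. *)
Lemma normal_cf (R : realType) (s u a : R) : 0 < s ->
  \int[normal_prob 0 s]_x cos (u * x + a) =
  cos a * expR (- (s ^+ 2 * u ^+ 2 / 2)).
Proof.
move=> s0.
pose J v := \int[normal_prob 0 s]_x cos (v * x + a).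
have maff v : measurable_fun setT (fun x : R => v * x + a).
  by apply: measurable_funD => //; exact: measurable_funM.
have dJ v : is_derive v (1 : R) J (- (s ^+ 2 * v) * J v).
  have vI : `]v - 1, v + 1[%classic v by rewrite /= in_itv/=; lra.
  have ic x : (normal_prob 0 s).-integrable setT
      (EFin \o (fun y : R => cos (x * y + a))).
    apply: (@bounded_integrable _ _ R (normal_prob 0 s) _ 1) => [|y].
      exact: (measurable_cos_comp (maff x)).
    exact: normr_cos_le1.
  have dc (x y : R) : is_derive x (1 : R) (fun z => cos (z * y + a)) (- (y * sin (x * y + a))).
    have := is_derive_cos_affine y a x.
    by rewrite (mulrC y x); under eq_fun do rewrite (mulrC y).
  have d1 x y : partial1of2 (fun x y : R => cos (x * y + a)) x y = - (y * sin (x * y + a)).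
    by rewrite partial1of2E; apply: derive_val; exact: dc.
  have D1 : derivable J v 1.
    apply: (@derivable_under_integral _ _ _ (normal_prob 0 s)
      (fun x y => cos (x * y + a)) setT measurableT v _ _ vI _ _ (fun y => `|y|)) => //.
    exact: integrable_norm_normal.
    by move=> x y _ _; rewrite d1 normrN normrM ler_piMr// normr_sin_le1.
  have D2 : derive1 J v = \int[normal_prob 0 s]_y (- (y * sin (v * y + a))).
    etransitivity.
      apply: (@differentiation_under_integral _ _ _ (normal_prob 0 s)
        (fun x y => cos (x * y + a)) setT measurableT v _ _ vI _ _ (fun y => `|y|)) => //.
        exact: integrable_norm_normal.
      by move=> x y _ _; rewrite d1 normrN normrM ler_piMr// normr_sin_le1.
    by apply: eq_Rintegral => y _; rewrite d1.
  apply: DeriveDef => //; rewrite -derive1E D2.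
  exact: normal_cos_by_parts.
pose H v := J v * expR (s ^+ 2 * v ^+ 2 / 2).
have dH v : is_derive v (1 : R) H 0.
  have dq : is_derive v (1 : R) (fun v : R => s ^+ 2 * v ^+ 2 / 2) (s ^+ 2 * v).
    have -> : (fun v : R => s ^+ 2 * v ^+ 2 / 2) = (fun v : R => (s ^+ 2 / 2) * (v * v)).
      by apply/funext => x; rewrite -expr2; ring.
    apply: is_derive_eq; rewrite /GRing.scale/=; by field.
  have de := @is_derive1_comp _ expR _ _ _ _ (is_derive_expR _) dq.
  have := @is_deriveM _ _ J _ _ _ _ _ (dJ v) de.
  by move=> /is_derive_eq; apply; rewrite /GRing.scale/=; ring.
have HE : H u = H 0 by exact: is_derive_0_is_cst.
have J0 : J 0 = cos a.
  rewrite /J; under eq_Rintegral do rewrite mul0r add0r.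
  by rewrite Rintegral_prob_cst.
move: HE; rewrite /H J0 expr0n/= mulr0 mul0r expR0 mulr1 => <-.
by rewrite -[RHS]mulrA -expRD subrr expR0 mulr1.
Qed.

Definition normal_cdf {R : realType} (s v : R) : R :=
  fine (normal_prob 0 s `]-oo, v]%classic).

Lemma is_derive_normal_cdf (R : realType) (s v : R) : 0 < s ->
  is_derive v (1 : R) (normal_cdf s) (normal_pdf 0 s v).
Proof.
move=> s0.
have v1 : v < v + 1 by lra.
have ipdf : lebesgue_measure.-integrable `]-oo, (v + 1)]%classic
    (EFin \o normal_pdf 0 s).
  by apply: integrableS (integrable_normal_pdf 0 s).
have cpdf : {for v, continuous (normal_pdf 0 s)}.
  by apply: continuous_normal_pdf; rewrite gt_eqF.
have [D1 D2] := continuous_FTC1 v1 ipdf (ltNyr v) cpdf.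
apply: DeriveDef; last by rewrite -derive1E.
exact: D1.
Qed.

Lemma normal_cdf_lip (R : realType) (s M a b : R) : 0 < s -> a <= b ->
  (forall x, a <= x <= b -> normal_pdf 0 s x <= M) ->
  normal_cdf s b - normal_cdf s a <= M * (b - a).
Proof.
move=> s0; rewrite le_eqVlt => /predU1P[->|ab hM]; first by rewrite !subrr mulr0.
have [||c cab ->] := @MVT _ (normal_cdf s) (normal_pdf 0 s) a b ab.
- by move=> x _; exact: is_derive_normal_cdf.
- apply: continuous_subspaceT => x.
  exact: is_derive_continuous (is_derive_normal_cdf x s0).
rewrite ler_wpM2r ?subr_ge0 ?(ltW ab)//; apply: hM.
by move: cab; rewrite in_itv/= => /andP[/ltW -> /ltW ->].
Qed.

Lemma normal_peak1_le (R : realType) : normal_peak 1 <= 1 :> R.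
Proof.
rewrite /normal_peak invf_le1; last first.
  by rewrite sqrtr_gt0 expr1n mul1r pmulrn_lgt0// pi_gt0.
rewrite -[X in X <= _]sqrtr1 ler_wsqrtr// expr1n mul1r.
by have := pi_ge2 R; rewrite mulr2n; lra.
Qed.

Lemma normal_cdf_homo (R : realType) (s a b : R) : 0 < s -> a <= b ->
  normal_cdf s a <= normal_cdf s b.
Proof.
move=> s0 ab; apply: fine_le; [exact: fin_num_measure|exact: fin_num_measure|].
by apply: le_measure; rewrite ?inE//; exact: subitvPr.
Qed.

Lemma normal_cdf_le1 (R : realType) (s v : R) : 0 <= normal_cdf s v <= 1.
Proof.
rewrite fine_ge0//= -lee_fin fineK ?fin_num_measure//.
exact: probability_le1.
Qed.

Lemma normal_cdf1_lip (R : realType) (a b : R) : a <= b ->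
  normal_cdf 1 b - normal_cdf 1 a <= b - a.
Proof.
move=> ab; rewrite -[leRHS]mul1r; apply: normal_cdf_lip => // x _.
by rewrite (le_trans (normal_pdf_ub _ _ _))// normal_peak1_le.
Qed.

(** For [|r - 1| <= 1 / 2], all points between [x] and [r x] have modulus at least [|x| / 2], so the
    density there is at most [exp(-x^2 / 8)], and [|x| exp(-x^2 / 8) <= 3] makes the bound uniform
    in [x]. For larger [|r - 1|] the difference is at most 1 anyway. Passing to [r^2] matches the
    variable [|g|^2 / n], whose mean deviation is computable. *)
Lemma normal_cdf_scale (R : realType) (r x : R) : 0 <= r ->
  `|normal_cdf 1 (r * x) - normal_cdf 1 x| <= 3 * `|r ^+ 2 - 1|.
Proof.
move=> r0.
have r2 : `|r - 1| <= `|r ^+ 2 - 1|.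
  have -> : r ^+ 2 - 1 = (r - 1) * (r + 1) by ring.
  by rewrite normrM ler_peMr// ger0_norm; lra.
apply: (@le_trans _ _ (3 * `|r - 1|)); last by lra.
have [big|small] := leP (1 / 2) `|r - 1|.
  have := normal_cdf_le1 1 (r * x); have := normal_cdf_le1 1 x.
  by rewrite ler_norml; lra.
have pdf_le y : `|x| / 2 <= `|y| ->
    normal_pdf 0 1 y <= expR (- (x ^+ 2 / 8)).
  move=> xy; rewrite normal_pdfE ?oner_eq0// /normal_fun subr0 expr1n.
  rewrite -[leRHS]mul1r ler_pM ?normal_peak_ge0 ?expR_ge0 ?normal_peak1_le//.
  rewrite ler_expR mulNr lerN2.
  have : `|x| ^+ 2 / 4 <= `|y| ^+ 2.
    have x0 : 0 <= `|x| by []. nra.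
  by rewrite !real_normK ?num_real// => ?; lra.
have key a b : a <= b -> b - a = `|r - 1| * `|x| ->
    (forall y, a <= y <= b -> `|x| / 2 <= `|y|) ->
    normal_cdf 1 b - normal_cdf 1 a <= 3 * `|r - 1|.
  move=> ab ba h.
  apply: (le_trans (@normal_cdf_lip _ 1 _ _ _ ltr01 ab (fun y hy => pdf_le y (h y hy)))).
  rewrite ba mulrC -mulrA mulrC ler_wpM2r//.
  have := expR_ge1Dx (x ^+ 2 / 8); rewrite expRN.
  set e := expR _; have e0 : 0 < e by exact: expR_gt0.
  move=> h1; rewrite ler_pdivrMr//.
  rewrite -[x ^+ 2]real_normK ?num_real// in h1.
  nra.
have [x0|x0] := leP 0 x.
  rewrite (ger0_norm x0) in key.
  have [r1|r1] := leP 1 r.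
    rewrite ger0_norm; last by rewrite subr_ge0 normal_cdf_homo//; nra.
    rewrite ger0_norm ?subr_ge0// in key *.
    apply: key; [nra|ring|].
    by move=> y /andP[y1 y2]; rewrite ger0_norm; nra.
  rewrite distrC ger0_norm; last by rewrite subr_ge0 normal_cdf_homo//; nra.
  rewrite ltr0_norm ?subr_lt0// in small key *.
  apply: key; [nra|ring|].
  by move=> y /andP[y1 y2]; rewrite ger0_norm; nra.
rewrite (ltr0_norm x0) in key.
have [r1|r1] := leP 1 r.
  rewrite distrC ger0_norm; last by rewrite subr_ge0 normal_cdf_homo//; nra.
  rewrite ger0_norm ?subr_ge0// in key *.
  apply: key; [nra|ring|].
  by move=> y /andP[y1 y2]; rewrite ler0_norm; nra.
rewrite ger0_norm; last by rewrite subr_ge0 normal_cdf_homo//; nra.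
rewrite ltr0_norm ?subr_lt0// in small key *.
apply: key; [nra|ring|].
by move=> y /andP[y1 y2]; rewrite ler0_norm; nra.
Qed.

(** Chernoff bound with the tilt that doubles the standard deviation: the exponent is
    [3 / 8 (y / s)^2 >= 75 / 8] on the event and the exponential moment is 2. *)
Lemma normal_tail (R : realType) (s : R) : 0 < s ->
  (normal_prob 0 s [set y | (5 * s < `|y|)%R] <= (1 / 4)%:E)%E.
Proof.
move=> s0.
pose a : R := (s ^- 2 - (2 * s) ^- 2) / 2.
have mA : measurable [set y : R | 5 * s < `|y|].
  rewrite [X in measurable X](_ : _ = Num.norm @^-1` `]5 * s, +oo[%classic).
    by rewrite -[X in measurable X]setTI; exact: normr_measurable.
  by apply/seteqP; split=> y /=; rewrite in_itv/= andbT.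
have me : measurable_fun setT (fun y : R => expR (a * y ^+ 2)).
  apply: measurable_expR_comp.
  by apply: measurable_funM => //; exact: measurable_funX.
rewrite -[leLHS]mul1e -integral_cst//.
apply: (@le_trans _ _ (\int[normal_prob 0 s]_y
   ((expR (- (75 / 8)))%:E * (expR (a * y ^+ 2))%:E))%E).
  rewrite integral_mkcond; apply: ge0_le_integral => //.
  - by move=> y _; rewrite erestrict_ge0.
  - by apply/(measurable_restrictT _ _).1 => //.
  - by apply: emeasurable_funM => //; exact/measurable_EFinP.
  - move=> y _; rewrite patchE; case: ifPn => [|_]; last first.
      by rewrite -EFinM lee_fin mulr_ge0 ?expR_ge0.
    rewrite inE /= => hy.
    rewrite -EFinM lee_fin -expRD -[leLHS]expR0 ler_expR.
    have -> : a * y ^+ 2 = 3 / 8 * (`|y| / s) ^+ 2.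
      have -> : (`|y| / s) ^+ 2 = y ^+ 2 / s ^+ 2.
        by rewrite exprMn exprVn real_normK ?num_real.
      by rewrite /a; field; rewrite gt_eqF.
    have : 5 <= `|y| / s by rewrite ler_pdivlMr// ltW.
    nra.
rewrite ge0_integralZl//; last by apply/measurable_EFinP.
rewrite /a normal_exp_moment ?mulr_gt0// -EFinM lee_fin.
have -> : 2 * s / s = 2 by field; rewrite gt_eqF.
have := expR_ge1Dx (75 / 8 : R); rewrite expRN.
set e := expR _ => h.
by rewrite mulrC ler_pdivrMr; lra.
Qed.

Lemma normr_sin_le (R : realType) (x : R) : `|sin x| <= `|x|.
Proof.
wlog x0 : x / 0 <= x => [H|].
  have [/H//|/ltW x0] := leP 0 x.
  by have := H (- x); rewrite sinN !normrN oppr_ge0; apply.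
move: x0; rewrite le_eqVlt => /predU1P[<-|x0]; first by rewrite sin0.
have [|c cab] := @MVT _ (@sin R) (@cos R) 0 x x0.
  by apply: continuous_subspaceT => y; exact: continuous_sin.
by rewrite sin0 !subr0 => ->; rewrite normrM ler_piMl// normr_cos_le1.
Qed.

Lemma normr_sin_div_le (R : realType) (x v : R) : `|sin (x * v) / x| <= `|v|.
Proof.
have [->|x0] := eqVneq x 0; first by rewrite invr0 mulr0 normr0.
rewrite normrM normfV ler_pdivrMr ?normr_gt0//.
by rewrite (le_trans (normr_sin_le _))// normrM mulrC.
Qed.

Lemma measurable_invr (R : realType) : measurable_fun setT (fun x : R => x^-1).
Proof.
rewrite (_ : (fun x => x^-1) = (fun x : R => x * (x ^+ 2) `^ (-1))).
  apply: measurable_funM => //.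
  by apply: (measurableT_comp (measurable_powR _)) => //; exact: measurable_funX.
apply/funext => x; rewrite powR_inv1 ?sqr_ge0//.
have [->|x0] := eqVneq x 0; first by rewrite mul0r invr0.
by rewrite expr2 invfM mulrA divff// mul1r.
Qed.

Lemma measurable_sin_div d (T : measurableType d) (R : realType) (f g : T -> R) :
  measurable_fun setT f -> measurable_fun setT g ->
  measurable_fun setT (fun x => sin (f x) / g x).
Proof.
move=> mf mg; apply: measurable_funM; first exact: measurable_sin_comp.
exact: (measurableT_comp (@measurable_invr R)).
Qed.

Lemma normal_prob_set1 (R : realType) (s a : R) :
  normal_prob 0 s [set a] = 0%E.
Proof.
have := normal_prob_dominates 0 s => /null_content_dominatesP; apply => //.
exact: lebesgue_measure_set1.
Qed.

(* The integrand is 0 at x = 0, instead of its limit v. *)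
Lemma normal_cdf_fourier (R : realType) (r v : R) : 0 < r ->
  normal_cdf r^-1 v = normal_cdf r^-1 0 +
    r * normal_peak 1 * \int[normal_prob 0 r]_x (sin (x * v) / x).
Proof.
move=> r0.
have ri0 : 0 < r^-1 by rewrite invr_gt0.
(* The derivative of [S] is the characteristic function of N(0, r^2), which up to a constant is the
   density of N(0, r^-2). Both sides of the formula thus have the same derivative in [v] and agree
   at 0. *)
pose S w := \int[normal_prob 0 r]_x (sin (x * w) / x).
have ms w : measurable_fun setT (fun x : R => sin (x * w) / x).
  by apply: measurable_sin_div => //; exact: measurable_funM.
have dS w : is_derive w (1 : R) S (expR (- (r ^+ 2 * w ^+ 2 / 2))).
  have wI : `]w - 1, w + 1[%classic w by rewrite /= in_itv/=; lra.
  have is_ z : `]w - 1, w + 1[%classic z -> (normal_prob 0 r).-integrable setT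
      (EFin \o (fun x : R => sin (x * z) / x)).
    move=> _.
    exact: (@bounded_integrable _ _ R (normal_prob 0 r) _ `|z| (ms z)
      (fun x => normr_sin_div_le x z)).
  have ds (z x : R) : is_derive z (1 : R) (fun y => sin (x * y) / x) (x * cos (x * z) / x).
    have h := is_derive_sin_affine x 0 z.
    have -> : (fun y => sin (x * y) / x) = x^-1 \*: (fun y => sin (x * y + 0)).
      by apply/funext => y /=; rewrite addr0 /GRing.scale/= mulrC.
    apply: (is_derive_eq (is_deriveZ x^-1 h)).
    by rewrite /GRing.scale/= addr0; ring.
  have d1 z x : partial1of2 (fun z x : R => sin (x * z) / x) z x = x * cos (x * z) / x.
    by rewrite partial1of2E; apply: derive_val.
  have dom z (x : R) : `]w - 1, w + 1[%classic z -> setT x ->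
      `|partial1of2 (fun z x : R => sin (x * z) / x) z x| <= (cst 1 : R -> R) x.
    move=> _ _; rewrite d1.
    have [->|x0] := eqVneq x 0; first by rewrite !mul0r normr0.
    by rewrite mulrAC divff// mul1r normr_cos_le1.
  have der z (x : R) : `]w - 1, w + 1[%classic z -> setT x ->
      derivable (fun z => sin (x * z) / x) z 1.
    by move=> _ _; case: (ds z x).
  have i1 : (normal_prob 0 r).-integrable setT (EFin \o (cst 1 : R -> R)).
    exact: finite_measure_integrable_cst.
  have g0 (x : R) : 0 <= (cst 1 : R -> R) x by [].
  have D1 : derivable S w 1 :=
    @derivable_under_integral _ _ _ (normal_prob 0 r)
      (fun z x => sin (x * z) / x) _ measurableT w _ _ wI is_ der _ g0 i1 dom.
  have D2 := @differentiation_under_integral _ _ _ (normal_prob 0 r)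
      (fun z x => sin (x * z) / x) _ measurableT w _ _ wI is_ der _ g0 i1 dom.
  have cf : \int[normal_prob 0 r]_x cos (w * x + 0) = expR (- (r ^+ 2 * w ^+ 2 / 2)).
    by rewrite normal_cf// cos0 mul1r.
  apply: DeriveDef; first exact: D1.
  rewrite -derive1E; apply: (etrans D2); rewrite -cf.
  rewrite /Rintegral; congr fine.
  apply: ae_eq_integral => //.
  - apply/measurable_EFinP; rewrite [X in measurable_fun _ X](_ : _ =
        (fun x : R => x * cos (x * w) / x)).
      apply: measurable_funM; last exact: measurable_invr.
      apply: measurable_funM => //; apply: measurable_cos_comp.
      exact: measurable_funM.
    by apply/funext => x; rewrite d1.
  - apply/measurable_EFinP; apply: measurable_cos_comp.
    by apply: measurable_funD => //; exact: measurable_funM.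
  (* At [x = 0] the differentiated integrand is 0 because of the division convention, while the
     cosine is 1; the point has measure zero. *)
  - exists [set 0]; split => //; first exact: normal_prob_set1.
    move=> x /= h; apply: contrapT => x0; apply: h => _; rewrite d1 addr0.
    by rewrite mulrAC divff ?mul1r 1?mulrC//; apply/eqP.
pose H w := normal_cdf r^-1 w - r * normal_peak 1 * S w.
have dH w : is_derive w (1 : R) H 0.
  have h1 := is_derive_normal_cdf w ri0.
  have -> : H = normal_cdf r^-1 \- (r * normal_peak 1) \*: S by [].
  apply: is_derive_eq; rewrite /GRing.scale/= normal_pdfE ?gt_eqF//.
  rewrite normal_peakE// invrK /normal_fun subr0.
  have -> : - w ^+ 2 / (r^-1 ^+ 2 *+ 2) = - (r ^+ 2 * w ^+ 2 / 2).
    by field; rewrite gt_eqF.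
  ring.
have : H v = H 0 by exact: is_derive_0_is_cst.
rewrite /H; have -> : S 0 = 0.
  rewrite /S; under eq_Rintegral do rewrite mulr0 sin0 mul0r.
  by rewrite Rintegral_cst// mul0r.
by rewrite mulr0 subr0 => <-; rewrite subrK.
Qed.

(** * Smoothing inequality *)

Lemma measurable_uncurry1 d1 d2 (T1 : measurableType d1) (T2 : measurableType d2)
    (R : realType) (f : T1 * T2 -> R) (x : T1) :
  measurable_fun setT f -> measurable_fun setT (fun y => f (x, y)).
Proof. by move=> mf; exact: measurableT_comp. Qed.

Lemma measurable_uncurry2 d1 d2 (T1 : measurableType d1) (T2 : measurableType d2)
    (R : realType) (f : T1 * T2 -> R) (y : T2) :
  measurable_fun setT f -> measurable_fun setT (fun x => f (x, y)).
Proof. by move=> mf; exact: measurableT_comp. Qed.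

(** Adding [M] makes the integrand nonnegative, and Tonelli's theorem then gives measurability of
    the partial integral. *)
Lemma measurable_Rintegral_param d1 d2 (T1 : measurableType d1)
    (T2 : measurableType d2) (R : realType) (P : probability T2 R)
    (f : T1 * T2 -> R) (M : R) :
  measurable_fun setT f -> (forall z, `|f z| <= M) ->
  measurable_fun setT (fun x => \int[P]_y f (x, y)).
Proof.
move=> mf fM.
have fM0 z : 0 <= f z + M by have := fM z; rewrite ler_norml; lra.
have E x : \int[P]_y f (x, y) = fine (\int[P]_y (f (x, y) + M)%:E)%E - M.
  have mfx := measurable_uncurry1 x mf.
  have ifx : P.-integrable setT (EFin \o (fun y => f (x, y))).
    exact: (@bounded_integrable _ _ _ P _ M mfx (fun y => fM (x, y))).
  have iM : P.-integrable setT (EFin \o (fun y : T2 => M)).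
    exact: finite_measure_integrable_cst.
  have := RintegralD measurableT ifx iM.
  rewrite Rintegral_prob_cst => e.
  by apply/eqP; rewrite eq_sym subr_eq; apply/eqP.
under eq_fun do rewrite E.
apply: measurable_funB => //.
apply: (@measurableT_comp _ _ _ _ _ _ fine) => //.
apply: (@measurable_fun_fubini_tonelli_F _ _ _ _ _ P (fun z => (f z + M)%:E)).
  by apply/measurable_EFinP; apply: measurable_funD.
by move=> z; rewrite lee_fin.
Qed.

Lemma Rintegral_Fubini d1 d2 (T1 : measurableType d1)
    (T2 : measurableType d2) (R : realType) (P1 : probability T1 R)
    (P2 : probability T2 R) (f : T1 * T2 -> R) :
  (forall x, P2.-integrable setT (EFin \o (fun y => f (x, y)))) ->
  (forall y, P1.-integrable setT (EFin \o (fun x => f (x, y)))) ->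
  (P1 \x P2)%E.-integrable setT (EFin \o f) ->
  \int[P1]_x \int[P2]_y f (x, y) = \int[P2]_y \int[P1]_x f (x, y).
Proof.
move=> i2 i1 i12; rewrite /Rintegral; congr fine.
transitivity (\int[P1]_x \int[P2]_y (f (x, y))%:E)%E.
  apply: eq_integral => x _; rewrite fineK//.
  exact: (integrable_fin_num measurableT (i2 x)).
rewrite (Fubini i12).
apply: eq_integral => y _; rewrite fineK//.
exact: (integrable_fin_num measurableT (i1 y)).
Qed.

Lemma Rintegral_prod d1 d2 (T1 : measurableType d1)
    (T2 : measurableType d2) (R : realType) (P1 : probability T1 R)
    (P2 : probability T2 R) (f : T1 * T2 -> R) :
  (forall x, P2.-integrable setT (EFin \o (fun y => f (x, y)))) ->
  (P1 \x P2)%E.-integrable setT (EFin \o f) ->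
  \int[(P1 \x P2)%E]_z f z = \int[P1]_x \int[P2]_y f (x, y).
Proof.
move=> i2 i12; rewrite /Rintegral; congr fine.
rewrite -(integral12_prod_meas1 i12).
apply: eq_integral => x _; rewrite fineK//.
exact: (integrable_fin_num measurableT (i2 x)).
Qed.

Lemma Rintegral_prod_mul d1 d2 (T1 : measurableType d1)
    (T2 : measurableType d2) (R : realType) (P1 : probability T1 R)
    (P2 : probability T2 R) (f : T1 -> R) (g : T2 -> R) :
  measurable_fun setT f -> measurable_fun setT g ->
  (forall x, `|f x| <= 1) -> (forall y, `|g y| <= 1) ->
  (P1 \x P2)%E.-integrable setT (EFin \o (fun z => f z.1 * g z.2)) /\
  \int[(P1 \x P2)%E]_z (f z.1 * g z.2) = \int[P1]_x f x * \int[P2]_y g y.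
Proof.
move=> mf mg fb gb.
have i1 : P1.-integrable setT (EFin \o f) by exact: (@bounded_integrable _ _ _ P1 _ 1).
have i2 : P2.-integrable setT (EFin \o g) by exact: (@bounded_integrable _ _ _ P2 _ 1).
have mfg : measurable_fun setT (fun z : T1 * T2 => f z.1 * g z.2).
  by apply: measurable_funM; exact: measurableT_comp.
have i12 : (P1 \x P2)%E.-integrable setT (EFin \o (fun z => f z.1 * g z.2)).
  apply: (@bounded_integrable _ _ _ (P1 \x P2)%E _ 1) => // z.
  by rewrite normrM mulr_ile1.
split => //.
rewrite (@Rintegral_prod _ _ _ _ _ P1 P2 (fun z => f z.1 * g z.2))//; last first.
  by move=> w; exact: (integrableZR (f w) i2).
under eq_Rintegral do rewrite /= RintegralZl//.
by rewrite RintegralZr.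
Qed.

Section smoothing.
Context d (T : measurableType d) (R : realType) (P : probability T R).
Implicit Types (S : T -> R) (r t x y : R).

Definition cf_re S t : R := \int[P]_w cos (t * S w).
Definition cf_im S t : R := \int[P]_w sin (t * S w).

(** Distance of the characteristic function of [S] from that of N(0, 1), with the sum of the moduli
    of real and imaginary parts in place of the complex modulus. *)
Definition cf_dist S t : R :=
  `|cf_re S t - expR (- (t ^+ 2 / 2))| + `|cf_im S t|.

Lemma cf_dist_ge0 S t : 0 <= cf_dist S t.
Proof. exact: addr_ge0. Qed.

Lemma measurable_cf_re S : measurable_fun setT S -> measurable_fun setT (cf_re S).
Proof.
move=> mS; apply: (@measurable_Rintegral_param _ _ _ _ _ P
    (fun z : R * T => cos (z.1 * S z.2)) 1) => [|z].
  apply: measurable_cos_comp; apply: measurable_funM => //.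
  exact: measurableT_comp.
exact: normr_cos_le1.
Qed.

Lemma measurable_cf_im S : measurable_fun setT S -> measurable_fun setT (cf_im S).
Proof.
move=> mS; apply: (@measurable_Rintegral_param _ _ _ _ _ P
    (fun z : R * T => sin (z.1 * S z.2)) 1) => [|z].
  apply: measurable_sin_comp; apply: measurable_funM => //.
  exact: measurableT_comp.
exact: normr_sin_le1.
Qed.

Lemma cf_sin_shift S t x : measurable_fun setT S ->
  \int[P]_w sin (t * (x - S w)) = sin (t * x) * cf_re S t - cos (t * x) * cf_im S t.
Proof.
move=> mS.
have mtS : measurable_fun setT (fun w => t * S w) by exact: measurable_funM.
have ic : P.-integrable setT (EFin \o (fun w => cos (t * S w))).
  apply: (@bounded_integrable _ _ _ P _ 1) => [|w]; last exact: normr_cos_le1.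
  exact: measurable_cos_comp.
have is_ : P.-integrable setT (EFin \o (fun w => sin (t * S w))).
  apply: (@bounded_integrable _ _ _ P _ 1) => [|w]; last exact: normr_sin_le1.
  exact: measurable_sin_comp.
rewrite /cf_re /cf_im -!RintegralZl// -RintegralB//.
- by apply: eq_Rintegral => w _; rewrite mulrBr sinB.
- by have := integrableZl measurableT (sin (t * x)) ic.
- by have := integrableZl measurableT (cos (t * x)) is_.
Qed.

(** The left side is the distribution function of [S] plus independent N(0, r^-2) noise. Fubini
    applies to [normal_cdf_fourier] because [|sin(t (x - S)) / t| <= |x| + |S|], which is where
    integrability of [S] enters. *)
Lemma smoothed_cdf_fourier S r x : 0 < r -> measurable_fun setT S ->
  P.-integrable setT (EFin \o S) ->
  \int[P]_w normal_cdf r^-1 (x - S w) = normal_cdf r^-1 0 +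
  r * normal_peak 1 * \int[normal_prob 0 r]_t
     ((sin (t * x) * cf_re S t - cos (t * x) * cf_im S t) / t).
Proof.
move=> r0 mS iS.
pose f (z : T * R) := sin (z.2 * (x - S z.1)) / z.2.
have mf : measurable_fun setT f.
  apply: measurable_sin_div => //; apply: measurable_funM => //.
  by apply: measurable_funB => //; exact: measurableT_comp.
have fb z : `|f z| <= `|x| + `|S z.1|.
  by rewrite (le_trans (normr_sin_div_le _ _))// ler_normB.
have iN : P.-integrable setT (EFin \o (fun w => `|S w|)).
  by have := integrable_norm iS.
have ixS : P.-integrable setT (EFin \o (fun w => `|x| + `|S w|)).
  have ix : P.-integrable setT (EFin \o (fun w : T => `|x|)).
    exact: finite_measure_integrable_cst.
  by have := integrableD measurableT ix iN.
have i2 w : (normal_prob 0 r).-integrable setT (EFin \o (fun y => f (w, y))).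
  apply: (@bounded_integrable _ _ _ (normal_prob 0 r) _ (`|x| + `|S w|)).
    exact: (measurable_uncurry1 w mf).
  by move=> y; exact: (fb (w, y)).
have i1 y : P.-integrable setT (EFin \o (fun w => f (w, y))).
  apply: (@le_integrableR _ _ _ P _ (fun w => `|x| + `|S w|)) => [|w|//].
    exact: (measurable_uncurry2 y mf).
  exact: (fb (w, y)).
have i12 : (P \x (normal_prob 0 r : probability _ _))%E.-integrable setT (EFin \o f).
  apply/integrable12ltyP; first exact/measurable_EFinP.
  apply: (@le_lt_trans _ _ (\int[P]_w (`|x| + `|S w|)%:E)%E); last first.
    by case/integrableP : ixS => _; under eq_integral do
      rewrite /= ger0_norm ?addr_ge0//.
  apply: ge0_le_integral => //.
  - by move=> w _; apply: integral_ge0 => y _.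
  - apply: (@measurable_fun_fubini_tonelli_F _ _ _ _ _ (normal_prob 0 r)
      (abse \o (EFin \o f))) => //=.
    by apply: measurableT_comp => //; exact/measurable_EFinP.
  - by apply: measurable_int ixS.
  - move=> w _.
    apply: (@le_trans _ _ (\int[normal_prob 0 r]_y (`|x| + `|S w|)%:E)%E).
      apply: ge0_le_integral => //.
      + apply: measurableT_comp => //; apply/measurable_EFinP.
        exact: (measurable_uncurry1 w mf).
      + by move=> y _; rewrite lee_fin; exact: (fb (w, y)).
    rewrite integral_cst//.
    by have /= -> := @probability_setT _ _ R (normal_prob 0 r); rewrite mule1.
have F := @Rintegral_Fubini _ _ _ _ _ P (normal_prob 0 r) f i2 i1 i12.
transitivity (\int[P]_w (normal_cdf r^-1 0 +
   r * normal_peak 1 * \int[normal_prob 0 r]_y f (w, y))).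
  by apply: eq_Rintegral => w _; rewrite normal_cdf_fourier.
have iF : P.-integrable setT (EFin \o (fun w => \int[normal_prob 0 r]_y f (w, y))).
  apply: eq_integrable (integrable_fubini_F i12) => // w _.
  by rewrite /fubini_F /= fineK// (integrable_fin_num measurableT (i2 w)).
rewrite RintegralD//; last 2 first.
- exact: finite_measure_integrable_cst.
- by have := integrableZl measurableT (r * normal_peak 1) iF.
rewrite Rintegral_prob_cst RintegralZl// F; congr (_ + _ * _).
apply: eq_Rintegral => t _; rewrite /f /= -cf_sin_shift// -RintegralZr//.
apply: (@bounded_integrable _ _ _ P _ 1) => [|w]; last exact: normr_sin_le1.
apply: measurable_sin_comp; apply: measurable_funM => //.
exact: measurable_funB.
Qed.

Lemma integrable_cf_sin S r x : 0 < r -> measurable_fun setT S ->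
  P.-integrable setT (EFin \o S) ->
  (normal_prob 0 r).-integrable setT (EFin \o (fun t : R =>
     (sin (t * x) * cf_re S t - cos (t * x) * cf_im S t) / t)).
Proof.
move=> r0 mS iS.
have mtx : measurable_fun setT (fun t : R => t * x) by exact: measurable_funM.
have iN : P.-integrable setT (EFin \o (fun w => `|S w|)).
  by have := integrable_norm iS.
have ixS : P.-integrable setT (EFin \o (fun w => `|x| + `|S w|)).
  have ix : P.-integrable setT (EFin \o (fun w : T => `|x|)).
    exact: finite_measure_integrable_cst.
  by have := integrableD measurableT ix iN.
apply: (@bounded_integrable _ _ _ (normal_prob 0 r) _
    (\int[P]_w (`|x| + `|S w|))) => [|t].
  apply: measurable_funM; last exact: measurable_invr.
  apply: measurable_funB; apply: measurable_funM.
  - exact: measurable_sin_comp.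
  - exact: measurable_cf_re.
  - exact: measurable_cos_comp.
  - exact: measurable_cf_im.
have ms : measurable_fun setT (fun w => sin (t * (x - S w))).
  apply: measurable_sin_comp; apply: measurable_funM => //.
  exact: measurable_funB.
have is_ : P.-integrable setT (EFin \o (fun w => sin (t * (x - S w)))).
  by apply: (@bounded_integrable _ _ _ P _ 1) => // w; exact: normr_sin_le1.
have isd : P.-integrable setT (EFin \o (fun w => sin (t * (x - S w)) / t)).
  by have := integrableZr measurableT t^-1 is_.
rewrite -cf_sin_shift// -RintegralZr//.
apply: (le_trans (le_normr_Rintegral _ _)) => //.
apply: le_Rintegral => //; first by have := integrable_norm isd.
by move=> w _; rewrite (le_trans (normr_sin_div_le _ _))// ler_normB.
Qed.

(** Both sides are the probability that [S] plus independent noise is at most [x], computed by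
    conditioning on [S] or on the noise. *)
Lemma smoothed_cdf_cdf S s x : 0 < s -> measurable_fun setT S ->
  \int[P]_w normal_cdf s (x - S w) =
  \int[normal_prob 0 s]_y fine (P [set w | S w <= x - y]).
Proof.
move=> s0 mS.
pose A : set (T * R) := [set z | S z.1 + z.2 <= x].
have mA : measurable A.
  have mf : measurable_fun setT (fun z : T * R => S z.1 + z.2).
    by apply: measurable_funD => //; exact: measurableT_comp.
  rewrite (_ : A = (fun z : T * R => S z.1 + z.2) @^-1` `]-oo, x]%classic).
    by rewrite -[X in measurable X]setTI; exact: mf.
  by apply/seteqP; split=> z /=; rewrite in_itv.
have mI : measurable_fun setT (fun z => (\1_A z)%:E : \bar R).
  by apply/measurable_EFinP; exact: measurable_indic.
have I0 z : (0 <= (\1_A z)%:E :> \bar R)%E by rewrite lee_fin.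
rewrite /Rintegral; congr fine.
have e1 w : ((normal_cdf s (x - S w))%:E = \int[normal_prob 0 s]_y (\1_A (w, y))%:E)%E.
  rewrite fineK ?fin_num_measure//.
  have -> : (fun y => (\1_A (w, y))%:E : \bar R) =
      (fun y => (\1_(`]-oo, x - S w]%classic) y)%:E).
    apply/funext => y; rewrite !indicE; congr ((_ : bool)%:R%:E).
    by apply/idP/idP; rewrite !inE /A /= in_itv/= lerBrDl.
  by rewrite integral_indic// setIT.
have e2 y : ((fine (P [set w | S w <= x - y]))%:E = \int[P]_w (\1_A (w, y))%:E)%E.
  have mB : measurable [set w | S w <= x - y].
    rewrite (_ : [set _ | _] = S @^-1` `]-oo, x - y]%classic).
      by rewrite -[X in measurable X]setTI; exact: mS.
    by apply/seteqP; split=> z /=; rewrite in_itv.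
  rewrite fineK ?fin_num_measure//.
  have -> : (fun w => (\1_A (w, y))%:E : \bar R) =
      (fun w => (\1_[set w | S w <= x - y] w)%:E).
    apply/funext => w; rewrite !indicE; congr ((_ : bool)%:R%:E).
    by apply/idP/idP; rewrite !inE /A /= lerBrDr.
  by rewrite integral_indic// setIT.
under eq_integral do rewrite e1.
under [RHS]eq_integral do rewrite e2.
exact: (@fubini_tonelli _ _ _ _ _ P (normal_prob 0 s) _ mI I0).
Qed.

End smoothing.

Lemma measurable_le_set d (T : measurableType d) (R : realType) (S : T -> R) (y : R) :
  measurable_fun setT S -> measurable [set w | S w <= y].
Proof.
move=> mS; rewrite (_ : [set _ | _] = S @^-1` `]-oo, y]%classic).
  by rewrite -[X in measurable X]setTI; exact: mS.
by apply/seteqP; split=> z /=; rewrite in_itv.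
Qed.

Lemma cf_re_normal (R : realType) (t : R) :
  cf_re (normal_prob 0 1) (fun x : R => x) t = expR (- (t ^+ 2 / 2)).
Proof.
rewrite /cf_re; under eq_Rintegral do rewrite -[t * _]addr0.
by rewrite normal_cf// cos0 mul1r expr1n mul1r.
Qed.

Lemma cf_im_normal (R : realType) (t : R) :
  cf_im (normal_prob 0 1) (fun x : R => x) t = 0.
Proof.
rewrite /cf_im.
have -> : (fun x : R => sin (t * x)) = (fun x => cos (t * x + - (pi / 2))).
  by apply/funext => x; rewrite cosB cos_pihalf sin_pihalf mulr0 add0r mulr1.
by rewrite normal_cf// cosN cos_pihalf mul0r.
Qed.

Lemma measurable_normal_cdf (R : realType) (s : R) : 0 < s ->
  measurable_fun setT (normal_cdf s).
Proof.
move=> s0; apply: nondecreasing_measurable => // x y xy.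
exact: normal_cdf_homo.
Qed.

Section kolmogorov_smoothing.
Context d (T : measurableType d) (R : realType) (P : probability T R).
Variable S : T -> R.
Hypothesis mS : measurable_fun setT S.
Hypothesis iS : P.-integrable setT (EFin \o S).

Let F (y : R) : R := fine (P [set w | S w <= y]).

Let F_homo x y : x <= y -> F x <= F y.
Proof.
move=> xy; have mx z := measurable_le_set z mS.
apply: fine_le; [exact: fin_num_measure|exact: fin_num_measure|].
by apply: le_measure; rewrite ?inE// => w /= /le_trans; apply.
Qed.

Let F_01 y : 0 <= F y <= 1.
Proof.
have mx z := measurable_le_set z mS.
rewrite fine_ge0//= -lee_fin fineK ?fin_num_measure//.
exact: probability_le1.
Qed.

Let D y := F y - normal_cdf 1 y.

Let mD : measurable_fun setT D.
Proof.
apply: measurable_funB; last exact: measurable_normal_cdf.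
by apply: nondecreasing_measurable => // x y; exact: F_homo.
Qed.

Let D1 y : `|D y| <= 1.
Proof.
by have := F_01 y; have := normal_cdf_le1 1 y; rewrite /D ler_norml; lra.
Qed.

(** Subtract the Fourier formulas for [S] and for a standard normal variable: the constants
    [normal_cdf r^-1 0] cancel, and only the difference of the characteristic functions is left. *)
Lemma smoothed_discrepancy_le r x : 0 < r ->
  (`| \int[normal_prob 0 r^-1]_y D (x - y) |%:E <=
   r%:E * \int[normal_prob 0 r]_t (cf_dist P S t / `|t|)%:E)%E.
Proof.
move=> r0; have ri0 : 0 < r^-1 by rewrite invr_gt0.
have mid : measurable_fun setT (fun x : R => x) by [].
have iid : (normal_prob 0 1).-integrable setT (EFin \o (fun x : R => x)).
  apply: (@le_integrableR _ _ _ (normal_prob 0 1) _ (fun x => `|x|)) => //.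
  exact: integrable_norm_normal.
have e1 := smoothed_cdf_fourier x r0 mS iS.
have e2 := @smoothed_cdf_fourier _ _ _ (normal_prob 0 1) _ _ x r0 mid iid.
rewrite smoothed_cdf_cdf// in e1; rewrite smoothed_cdf_cdf// in e2.
have mxy : measurable_fun setT (fun y : R => x - y) by exact: measurable_funB.
have mF : measurable_fun setT F.
  by apply: nondecreasing_measurable => // ? ?; exact: F_homo.
have -> : \int[normal_prob 0 r^-1]_y D (x - y) =
    \int[normal_prob 0 r^-1]_y F (x - y) -
    \int[normal_prob 0 r^-1]_y normal_cdf 1 (x - y).
  rewrite RintegralB//.
  - apply: (@bounded_integrable _ _ _ (normal_prob 0 r^-1) _ 1) => [|y].
      exact: (measurableT_comp mF mxy).
    by have /andP[? ?] := F_01 (x - y); rewrite ger0_norm.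
  - apply: (@bounded_integrable _ _ _ (normal_prob 0 r^-1) _ 1) => [|y].
      exact: (measurableT_comp (measurable_normal_cdf ltr01) mxy).
    by have /andP[? ?] := normal_cdf_le1 1 (x - y); rewrite ger0_norm.
rewrite e1.
have -> : \int[normal_prob 0 r^-1]_y normal_cdf 1 (x - y) =
  \int[normal_prob 0 r^-1]_y fine ((normal_prob 0 1) [set w : R | w <= x - y]).
  by apply: eq_Rintegral => y _; rewrite /normal_cdf set_itvNyc.
rewrite e2 opprD addrACA subrr add0r -mulrBr.
have mre := measurable_cf_re P mS; have mim := measurable_cf_im P mS.
have ig1 := integrable_cf_sin x r0 mS iS.
have ig2 := @integrable_cf_sin _ _ _ (normal_prob 0 1) _ _ x r0 mid iid.
rewrite -RintegralB//.
have ig := integrableBR ig1 ig2.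
move: ig; set g := fun t : R => _ - _ => ig.
rewrite normrM EFinM.
apply: lee_pmul => //.
  rewrite lee_fin normrM (ger0_norm (normal_peak_ge0 _)) gtr0_norm//.
  by apply: ler_piMr; [exact: ltW|exact: normal_peak1_le].
apply: (@le_trans _ _ (\int[normal_prob 0 r]_t (`|g t|)%:E)%E).
  rewrite EFin_normr_Rintegral//.
  by apply: le_abse_integral => //; case/integrableP : ig.
have mcd : measurable_fun setT (fun t : R => cf_dist P S t / `|t|).
  apply: measurable_funM.
    apply: measurable_funD; apply: measurableT_comp => //.
    apply: measurable_funB => //; apply: measurable_expR_comp.
    by apply: measurable_funN; apply: measurable_funM.
  by apply: (measurableT_comp (@measurable_invr R)); exact: normr_measurable.
apply: ge0_le_integral => //.
- by apply/measurable_EFinP; apply: measurableT_comp => //;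
     apply/measurable_EFinP; case/integrableP : ig.
- exact/measurable_EFinP.
move=> t _; rewrite lee_fin /g cf_re_normal cf_im_normal mulr0 subr0.
rewrite -mulrBl normrM normfV ler_wpM2r ?invr_ge0//.
rewrite addrAC -mulrBr (le_trans (ler_normB _ _))// !normrM /cf_dist.
by rewrite lerD// ler_piMl ?normr_sin_le1 ?normr_cos_le1.
Qed.

(** The smoothed [E] sees at least [dl - 2 h] when the noise is at most [5 s <= h], and at least
    [- Dl] on the tail, of mass at most [1 / 4]. Hence [3 / 4 (dl - 2 h) - Dl / 4 <= B], which is
    the conclusion after division by [3 / 4]. *)
Let discrepancy_step (E : R -> R) (Dl B h dl x s : R) : 0 < s -> 0 <= h ->
  5 * s <= h -> 0 <= Dl -> 0 <= B -> measurable_fun setT E ->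
  (forall y, `|E y| <= Dl) ->
  (forall z, `|z - x| <= h -> dl - 2 * h <= E z) ->
  \int[normal_prob 0 s]_y E (x - y) <= B ->
  dl <= 2 * h + 4 / 3 * B + Dl / 3.
Proof.
move=> s0 h0 sh Dl0 B0 mE EDl Edl EB.
have [small|big] := leP dl (2 * h); first by lra.
pose A := [set y : R | 5 * s < `|y|].
have mA : measurable A.
  rewrite (_ : A = Num.norm @^-1` `]5 * s, +oo[%classic).
    by rewrite -[X in measurable X]setTI; exact: normr_measurable.
  by apply/seteqP; split=> y /=; rewrite in_itv/= andbT.
have mxy : measurable_fun setT (fun y : R => x - y) by exact: measurable_funB.
have iA : (normal_prob 0 s).-integrable setT (EFin \o (\1_A : R -> R)).
  apply: (@bounded_integrable _ _ _ (normal_prob 0 s) _ 1) => // y.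
  by rewrite indicE; case: (_ \in _); rewrite ?normr1 ?normr0.
pose c := dl - 2 * h + Dl.
have ic : (normal_prob 0 s).-integrable setT (EFin \o (fun y : R => c * \1_A y)).
  by have := integrableZl measurableT c iA.
have i0 : (normal_prob 0 s).-integrable setT (EFin \o (fun y : R => dl - 2 * h)).
  exact: finite_measure_integrable_cst.
have : \int[normal_prob 0 s]_y (dl - 2 * h - c * \1_A y) <= B.
  apply: le_trans EB; apply: le_Rintegral => //.
  - by have := integrableB measurableT i0 ic.
  - apply: (@bounded_integrable _ _ _ (normal_prob 0 s) _ Dl) => //.
    exact: (measurableT_comp mE mxy).
  - move=> y _; rewrite indicE; case: (boolP (y \in A)) => yA.
      by rewrite mulr1 /c; have := EDl (x - y); rewrite ler_norml; lra.
    rewrite mulr0 subr0 Edl// addrC addKr normrN.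
    by move: yA; rewrite notin_setE /A /= => /negP; rewrite -leNgt => /le_trans; apply.
rewrite RintegralB// Rintegral_prob_cst RintegralZl//.
have : \int[normal_prob 0 s]_y (\1_A y) <= 1 / 4.
  rewrite /Rintegral integral_indic// setIT -lee_fin fineK ?fin_num_measure//.
  exact: normal_tail.
have : 0 < c by rewrite /c; lra.
rewrite /c; nra.
Qed.

(** Here [discrepancy_step] is used with [Dl] the Kolmogorov distance itself, whose third is then
    absorbed on the left: [3 / 2] times [10 / r + 4 / 3 r I] gives the constants 15 and 2. *)
Lemma kolmogorov_smoothing_le r : 0 < r ->
  (kolmogorov (fun x => P [set w | (S w <= x)%R]) (@Phi R) <=
   (15 / r)%:E + (2 * r)%:E * \int[normal_prob 0 r]_t (cf_dist P S t / `|t|)%:E)%E.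
Proof.
move=> r0; have ri0 : 0 < r^-1 by rewrite invr_gt0.
set I := (\int[normal_prob 0 r]_t _)%E.
have I0 : (0 <= I)%E.
  by apply: integral_ge0 => t _; rewrite lee_fin divr_ge0// cf_dist_ge0.
have step x := @smoothed_discrepancy_le r x r0; rewrite -/I in step.
have KE : kolmogorov (fun x => P [set w | (S w <= x)%R]) (@Phi R) =
    ereal_sup [set (`|D x|)%:E | x in setT].
  congr ereal_sup; congr (_ @` _); apply/funext => x.
  have -> : P [set w | (S w <= x)%R] = (F x)%:E.
    by rewrite fineK ?fin_num_measure//; exact: measurable_le_set.
  have -> : Phi x = (normal_cdf 1 x)%:E.
    by rewrite fineK ?fin_num_measure.
  by [].
rewrite KE; set K := ereal_sup _.
have K1 : (K <= 1)%E by apply: ub_ereal_sup => _ [x _ <-]; rewrite lee_fin.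
have K0 : (0 <= K)%E.
  by apply: (@le_trans _ _ (`|D 0|)%:E); [rewrite lee_fin|apply: ereal_sup_ubound; exists 0].
have Kfin : K \is a fin_num by rewrite ge0_fin_numE// (le_lt_trans K1)// ltry.
have KD y : `|D y| <= fine K.
  by rewrite -lee_fin fineK//; apply: ereal_sup_ubound; exists y.
case: I I0 step => [i| |]//; last first.
  by move=> _ _; rewrite gt0_muley ?lte_fin ?mulr_gt0// addey// leey.
rewrite lee_fin => i0 step.
rewrite -EFinM -EFinD -[K]fineK// lee_fin.
have fK0 : 0 <= fine K by rewrite fine_ge0.
have {}step x : `| \int[normal_prob 0 r^-1]_y D (x - y) | <= r * i.
  by rewrite -lee_fin EFinM.
have h0 : 0 <= 5 * r^-1 by rewrite mulr_ge0// ltW.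
have ri : 0 <= r * i by rewrite mulr_ge0// ltW.
suff : fine K <= 2 * (5 * r^-1) + 4 / 3 * (r * i) + fine K / 3 by lra.
rewrite -lee_fin fineK//; apply: ub_ereal_sup => _ [x _ <-]; rewrite lee_fin.
rewrite ler_norml; apply/andP; split; last first.
  (* The window of radius [5 / r] about [x + 5 / r] lies to the right of [x]: there [F] is at least
     [F x], and the normal distribution function has grown by at most [10 / r]. For [- D] the window
     is mirrored. *)
  apply: (@discrepancy_step D _ _ _ _ (x + 5 * r^-1) r^-1) => //.
    move=> z; rewrite ler_norml => /andP[z1 z2].
    have xz : x <= z by lra.
    have := F_homo xz; have := normal_cdf1_lip xz; rewrite /D; lra.
  by apply: le_trans (step (x + 5 * r^-1)); exact: ler_norm.
rewrite lerNl.
apply: (@discrepancy_step (fun y => - D y) _ _ _ _ (x - 5 * r^-1) r^-1) => //.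
- exact: measurableT_comp.
- by move=> y; rewrite normrN.
- move=> z; rewrite ler_norml => /andP[z1 z2].
  have xz : z <= x by lra.
  have := F_homo xz; have := normal_cdf1_lip xz; rewrite /D; lra.
- have -> : \int[normal_prob 0 r^-1]_y - D (x - 5 * r^-1 - y) =
     - \int[normal_prob 0 r^-1]_y D (x - 5 * r^-1 - y).
    under eq_Rintegral do rewrite -mulN1r.
    rewrite RintegralZl ?mulN1r//.
    apply: (@bounded_integrable _ _ _ (normal_prob 0 r^-1) _ 1) => //.
    by apply: (measurableT_comp mD); exact: measurable_funB.
  by apply: le_trans (step (x - 5 * r^-1)); rewrite -normrN ler_norm.
Qed.

End kolmogorov_smoothing.

(** * Gaussian vectors and the sphere *)

Lemma image_probability d d' (T : measurableType d) (T' : measurableType d')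
    (R : realType) (P : probability T R) (f : T -> T') :
  measurable_fun setT f ->
  exists Q : probability T' R,
    (forall h : T' -> \bar R, measurable_fun setT h -> (forall y, 0 <= h y)%E ->
       (\int[Q]_y h y = \int[P]_x h (f x))%E) /\
    (forall (h : T' -> R) M, measurable_fun setT h -> (forall y, `|h y| <= M) ->
       \int[Q]_y h y = \int[P]_x h (f x)).
Proof.
move=> mf.
pose F : {mfun T >-> T'} := mfun_Sub (mem_set mf : f \in mfun).
exists (distribution P F); split => [h mh h0|h M mh hM].
  by rewrite ge0_integral_distribution.
rewrite /Rintegral integral_distribution//; first exact/measurable_EFinP.
by apply: (@bounded_integrable _ _ _ P _ M) => [|x]; [exact: measurableT_comp|].
Qed.

Lemma measurable_dotp d (T : measurableType d) (R : realType) n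
    (f g : T -> n.-tuple R) :
  measurable_fun setT f -> measurable_fun setT g ->
  measurable_fun setT (fun w => dotp (f w) (g w)).
Proof.
move=> /measurable_fun_tnthP mf /measurable_fun_tnthP mg.
apply: measurable_sum => i; apply: measurable_funM; [exact: mf|exact: mg].
Qed.

Lemma dotp_cons (R : realType) n (x y : R) (s t : n.-tuple R) :
  dotp [tuple of x :: s] [tuple of y :: t] = x * y + dotp s t.
Proof.
rewrite /dotp big_ord_recl !tnth0; congr (_ + _).
by apply: eq_bigr => i _; rewrite !tnthS.
Qed.

(** The standard Gaussian law enters only through its characteristic function and the exponential
    moments of [|g|^2], so both are carried through an induction that adds one independent
    coordinate at a time. Each coordinate contributes a factor [r], the ratio of standard deviations
    under the tilt. *)
Lemma gaussian_vector (R : realType) (n : nat) :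
  exists G : probability (n.-tuple R) R,
   (forall x a, \int[G]_g cos (dotp x g + a) = cos a * expR (- (dotp x x / 2))) /\
   (forall r : R, 0 < r ->
     (\int[G]_g (expR ((1 - r ^- 2) / 2 * dotp g g))%:E = (r ^+ n)%:E)%E).
Proof.
elim: n => [|n [G [IHc IHe]]].
  exists (\d_[tuple]); split => [x a|r r0].
    rewrite /Rintegral integral_dirac// ?diracT ?mul1e/=; last first.
      apply/measurable_EFinP; apply: measurable_cos_comp.
      by apply: measurable_funD => //; apply: measurable_dotp.
    by rewrite /dotp !big_ord0 add0r mul0r oppr0 expR0 mulr1.
  rewrite integral_dirac// ?diracT ?mul1e/=; last first.
    apply/measurable_EFinP; apply: measurable_expR_comp.
    by apply: measurable_funM => //; apply: measurable_dotp.
  by rewrite /dotp !big_ord0 mulr0 expR0.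
have mf : measurable_fun setT (fun z : R * n.-tuple R => [tuple of z.1 :: z.2]).
  exact: measurable_cons.
have [Q [Q0 QM]] := @image_probability _ _ _ _ R
  (normal_prob 0 1 \x G)%E _ mf.
exists Q; split => [x a|r r0].
  have mcx m (v : m.-tuple R) b : measurable_fun setT (fun g : m.-tuple R => cos (dotp v g + b)).
    apply: measurable_cos_comp; apply: measurable_funD => //.
    exact: measurable_dotp.
  rewrite (QM _ 1 (mcx _ x a) (fun y => normr_cos_le1 _)).
  rewrite [x]tuple_eta; set x0 := thead x; set x' := behead_tuple x.
  rewrite dotp_cons.
  under eq_Rintegral do rewrite dotp_cons.
  have mc : measurable_fun setT (fun z : R * n.-tuple R => cos (x0 * z.1 + dotp x' z.2 + a)).
    apply: measurable_cos_comp; apply: measurable_funD => //.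
    apply: measurable_funD; first exact: measurable_funM.
    exact: measurable_dotp.
  rewrite (@Rintegral_prod _ _ _ _ _ (normal_prob 0 1) G
     (fun z => cos (x0 * z.1 + dotp x' z.2 + a))); last 2 first.
  - move=> y; apply: (@bounded_integrable _ _ _ G _ 1) => [|g].
      exact: (measurable_uncurry1 y mc).
    exact: normr_cos_le1.
  - apply: (@bounded_integrable _ _ _ (normal_prob 0 1 \x G)%E _ 1) => // z.
    exact: normr_cos_le1.
  transitivity (\int[normal_prob 0 1]_y
    (expR (- (dotp x' x' / 2)) * cos (x0 * y + a))).
    apply: eq_Rintegral => y _ /=.
    rewrite [RHS]mulrC -IHc; apply: eq_Rintegral => g _; congr cos.
    by rewrite [RHS]addrCA addrA.
  rewrite RintegralZl//; last first.
    apply: (@bounded_integrable _ _ _ (normal_prob 0 1) _ 1) => [|y]; last exact: normr_cos_le1.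
    by apply: measurable_cos_comp; apply: measurable_funD => //; exact: measurable_funM.
  rewrite normal_cf// mulrCA -expRD; congr (_ * expR _).
  by rewrite expr1n expr2; field.
have me m : measurable_fun setT (fun g : m.-tuple R =>
    (expR ((1 - r ^- 2) / 2 * dotp g g))%:E).
  apply/measurable_EFinP; apply: measurable_expR_comp.
  by apply: measurable_funM => //; exact: measurable_dotp.
have e0 m (g : m.-tuple R) : (0 <= (expR ((1 - r ^- 2) / 2 * dotp g g))%:E)%E.
  by rewrite lee_fin expR_ge0.
rewrite (Q0 _ (me _) (e0 _)).
rewrite (@fubini_tonelli1 _ _ _ _ _ (normal_prob 0 1) G
  (fun z => (expR ((1 - r ^- 2) / 2 *
     dotp [tuple of z.1 :: z.2] [tuple of z.1 :: z.2]))%:E)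
  (measurableT_comp (me _) mf) (fun z => e0 _ _)).
rewrite /fubini_F /=.
transitivity (\int[normal_prob 0 1]_y ((r ^+ n)%:E *
    (expR ((1 ^- 2 - r ^- 2) / 2 * y ^+ 2))%:E))%E.
  apply: eq_integral => y _.
  under eq_integral do rewrite dotp_cons mulrDr expRD EFinM.
  rewrite ge0_integralZl//; last exact: me.
  by rewrite IHe// muleC expr1n invr1 expr2.
rewrite ge0_integralZl//; last 2 first.
- apply/measurable_EFinP; apply: measurable_expR_comp.
  by apply: measurable_funM => //; exact: measurable_funX.
- by rewrite lee_fin exprn_ge0// ltW.
by rewrite normal_exp_moment// -EFinM divr1 exprSr.
Qed.

Lemma invr_onem_le_expR (R : realType) (u : R) : u <= 1 / 2 ->
  (1 - u)^-1 <= expR (u + 2 * u ^+ 2).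
Proof.
move=> u2; have := expR_ge1Dx (u + 2 * u ^+ 2).
set e := expR _ => h.
have u0 : 0 < 1 - u by lra.
rewrite -div1r ler_pdivrMr//.
have : 0 <= u ^+ 2 * (1 - 2 * u) by rewrite mulr_ge0 ?sqr_ge0//; lra.
have : 0 <= (1 - u) * (e - (1 + (u + 2 * u ^+ 2))) by rewrite mulr_ge0; lra.
nra.
Qed.

(** The integral equals [exp(-a n) (1 - 2 a)^(-n/2)], and [(1 - 2 a)^(-1/2) <= exp(a + 4 a^2)]
    cancels the linear part, leaving [exp(4 a^2 n) = exp(1 / 4)]. Both signs of [a] are allowed. *)
Lemma gaussian_exp_dev (R : realType) (n : nat) (G : probability (n.-tuple R) R)
    (a : R) : (0 < n)%N -> a ^+ 2 * n%:R = 1 / 16 ->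
  (forall r : R, 0 < r ->
     (\int[G]_g (expR ((1 - r ^- 2) / 2 * dotp g g))%:E = (r ^+ n)%:E)%E) ->
  (\int[G]_g (expR (a * (dotp g g - n%:R)))%:E <= 2%:E)%E.
Proof.
move=> n0 an IH.
have n1 : 1 <= n%:R :> R by rewrite ler1n.
have a4 : a <= 1 / 4 by nra.
have a0 : 0 < 1 - 2 * a by lra.
pose r := Num.sqrt (1 - 2 * a)^-1.
have r0 : 0 < r by rewrite sqrtr_gt0 invr_gt0.
have r2 : r ^- 2 = 1 - 2 * a by rewrite sqr_sqrtr ?invrK// invr_ge0 ltW.
have E : (\int[G]_g (expR (a * (dotp g g - n%:R)))%:E =
    (expR (- a * n%:R))%:E * (r ^+ n)%:E)%E.
  rewrite -IH// r2 -ge0_integralZl//.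
  - apply: eq_integral => g _; rewrite -EFinM -expRD; congr (expR _)%:E.
    by field.
  - apply/measurable_EFinP; apply: measurable_expR_comp.
    by apply: measurable_funM => //; exact: measurable_dotp.
rewrite E -EFinM lee_fin.
have rle : r <= expR (a + 4 * a ^+ 2).
  rewrite -(ler_pXn2r (n:=2)) ?nnegrE ?expR_ge0 ?(ltW r0)//.
  have -> : r ^+ 2 = (1 - 2 * a)^-1 by rewrite -r2 invrK.
  rewrite -expRM_natr.
  have -> : (a + 4 * a ^+ 2) * 2 = 2 * a + 2 * (2 * a) ^+ 2 by ring.
  have h2 : 2 * a <= 1 / 2 by lra.
  exact: (invr_onem_le_expR h2).
have rn : r ^+ n <= expR ((a + 4 * a ^+ 2) * n%:R).
  by rewrite expRM_natr lerXn2r ?nnegrE ?expR_ge0 ?(ltW r0).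
apply: (@le_trans _ _ (expR (- a * n%:R) * expR ((a + 4 * a ^+ 2) * n%:R))).
  by rewrite ler_wpM2l ?expR_ge0.
rewrite -expRD.
have -> : - a * n%:R + (a + 4 * a ^+ 2) * n%:R = 1 / 4.
  by rewrite -mulrDl addrA addNr add0r -mulrA an; field.
have := expR_ge1Dx (- (1 / 4) : R); have := expRxMexpNx_1 (1 / 4 : R).
have := expR_gt0 (1 / 4 : R); nra.
Qed.

(** With [x = (|g|^2 - n) / (4 sqrt n)], the bound [|x| <= exp(x) + exp(-x)] reduces the first
    absolute moment to two exponential moments, each at most 2. *)
Lemma gaussian_norm_dev (R : realType) (n : nat) (G : probability (n.-tuple R) R) :
  (0 < n)%N ->
  (forall r : R, 0 < r ->
     (\int[G]_g (expR ((1 - r ^- 2) / 2 * dotp g g))%:E = (r ^+ n)%:E)%E) ->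
  (\int[G]_g (`|dotp g g / n%:R - 1|)%:E <= (16 / Num.sqrt n%:R)%:E)%E.
Proof.
move=> n0 IH.
have n0' : 0 < n%:R :> R by rewrite ltr0n.
pose q : R := Num.sqrt n%:R.
have q0 : 0 < q by rewrite sqrtr_gt0.
have qn : n%:R = q ^+ 2 by rewrite sqr_sqrtr// ltW.
pose a := (4 * q)^-1.
have an : a ^+ 2 * n%:R = 1 / 16 by rewrite /a qn; field; rewrite gt_eqF.
have an' : (- a) ^+ 2 * n%:R = 1 / 16 by rewrite sqrrN.
have me b : measurable_fun setT (fun g : n.-tuple R =>
    (expR (b * (dotp g g - n%:R)))%:E).
  apply/measurable_EFinP; apply: measurable_expR_comp; apply: measurable_funM => //.
  by apply: measurable_funB => //; exact: measurable_dotp.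
have c0 : 0 <= 4 / q by rewrite divr_ge0// ltW.
apply: (@le_trans _ _ (\int[G]_g ((4 / q)%:E *
   ((expR (a * (dotp g g - n%:R)))%:E + (expR (- a * (dotp g g - n%:R)))%:E)))%E).
  apply: ge0_le_integral => //.
  - apply/measurable_EFinP; apply: measurableT_comp => //; apply: measurable_funB => //.
    by apply: measurable_funM => //; exact: measurable_dotp.
  - by apply: emeasurable_funM => //; exact: emeasurable_funD.
  - move=> g _; rewrite -EFinD -EFinM lee_fin.
    set x := a * (dotp g g - n%:R).
    have -> : dotp g g / n%:R - 1 = 4 / q * x.
      by rewrite /x /a qn; field; rewrite gt_eqF.
    rewrite normrM ger0_norm// ler_wpM2l// mulNr -/x.
    have := expR_ge1Dx x; have := expR_ge1Dx (- x).
    have := expR_gt0 x; have := expR_gt0 (- x).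
    by rewrite ler_norml; lra.
rewrite ge0_integralZl//; [|by apply: emeasurable_funD; exact: me|]; last first.
  by move=> g _; rewrite adde_ge0 ?lee_fin ?expR_ge0.
rewrite ge0_integralD//.
apply: (@le_trans _ _ ((4 / q)%:E * (2%:E + 2%:E))%E).
  rewrite lee_wpmul2l ?lee_fin// leeD//; exact: gaussian_exp_dev.
by rewrite -EFinD -EFinM lee_fin -/q; have : 0 < q^-1 by [rewrite invr_gt0]; lra.
Qed.

Definition scalev {R : realType} {n} (c : R) (x : n.-tuple R) : n.-tuple R :=
  [tuple c * tnth x i | i < n].

Lemma dotp_scalel (R : realType) n (c : R) (x y : n.-tuple R) :
  dotp (scalev c x) y = c * dotp x y.
Proof.
by rewrite /dotp mulr_sumr; apply: eq_bigr => i _; rewrite tnth_mktuple mulrA.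
Qed.

Lemma dotpC (R : realType) n (x y : n.-tuple R) : dotp x y = dotp y x.
Proof. by apply: eq_bigr => i _; rewrite mulrC. Qed.

Lemma dotp_scaler (R : realType) n (c : R) (x y : n.-tuple R) :
  dotp x (scalev c y) = c * dotp x y.
Proof. by rewrite dotpC dotp_scalel dotpC. Qed.

Lemma dotp_ge0 (R : realType) n (x : n.-tuple R) : 0 <= dotp x x.
Proof. by apply: sumr_ge0 => i _; rewrite -expr2 sqr_ge0. Qed.

Lemma enorm_sqr (R : realType) n (x : n.-tuple R) : enorm x ^+ 2 = dotp x x.
Proof. by rewrite sqr_sqrtr// dotp_ge0. Qed.

Lemma dotp_enorm0 (R : realType) n (x v : n.-tuple R) : enorm v = 0 -> dotp x v = 0.
Proof.
move=> v0; have : dotp v v = 0 by rewrite -enorm_sqr v0 expr0n.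
move/eqP; rewrite /dotp psumr_eq0 => [|j _]; last by rewrite -expr2 sqr_ge0.
move/allP => h; apply: big1 => i _.
by have := h i; rewrite mem_index_enum mulf_eq0 orbb => /(_ isT)/eqP ->; rewrite mulr0.
Qed.

(* The Householder reflection along u - v maps u to v. *)
Lemma orthogonal_transport (R : realType) n (u v : n.-tuple R) :
  dotp u u = dotp v v ->
  exists U : 'M[R]_n, U *m U^T = 1%:M /\
    forall x, dotp u (mxact U x) = dotp v x.
Proof.
move=> uv.
pose W : 'cV[R]_n := \col_i (tnth u i - tnth v i).
pose N : R := \sum_i (tnth u i - tnth v i) ^+ 2.
have NE : N = 2 * \sum_i tnth u i * (tnth u i - tnth v i).
  rewrite mulr_sumr; apply/eqP; rewrite -subr_eq0 -sumrB.
  have -> : \sum_i ((tnth u i - tnth v i) ^+ 2 - 2 * (tnth u i * (tnth u i - tnth v i)))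
      = \sum_i (tnth v i * tnth v i - tnth u i * tnth u i).
    by apply: eq_bigr => i _; ring.
  by rewrite sumrB -/(dotp v v) -/(dotp u u) uv subrr.
have [N0|N0] := eqVneq N 0.
  have uvE : u = v.
    apply: eq_from_tnth => i; apply/eqP; rewrite -subr_eq0 -sqrf_eq0.
    move/eqP: N0; rewrite psumr_eq0 => [|j _]; last exact: sqr_ge0.
    by move/allP => /(_ i); rewrite mem_index_enum => /(_ isT).
  exists 1%:M; rewrite trmx1 mulmx1; split => // x; rewrite uvE.
  apply: eq_bigr => i _; rewrite tnth_mktuple (bigD1 i)//= mxE eqxx mul1r.
  rewrite big1 ?addr0// => j ji; rewrite mxE eq_sym (negbTE ji) mul0r//.
pose U : 'M[R]_n := 1%:M - (2 / N) *: (W *m W^T).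
have WW : W^T *m W = N%:M.
  apply/matrixP => i j; rewrite !ord1 !mxE eqxx mulr1n.
  by apply: eq_bigr => k _; rewrite !mxE expr2.
exists U; split.
  have -> : U^T = U.
    by rewrite /U linearB linearZ /= trmx1 trmx_mul trmxK.
  rewrite /U mulmxBl mul1mx mulmxBr mulmx1 -scalemxAl -scalemxAr.
  rewrite mulmxA -(mulmxA W) WW mul_mx_scalar -scalemxAl scalerA.
  rewrite opprB addrC -addrA; apply/eqP; rewrite addrCA -subr_eq0 addrAC.
  apply/eqP/matrixP => i j; rewrite !mxE; field.
  by [].
move=> x; rewrite /dotp.
under eq_bigr do rewrite tnth_mktuple mulr_sumr.
rewrite exchange_big /=; apply: eq_bigr => j _.
under eq_bigr do rewrite mulrA.
rewrite -mulr_suml; congr (_ * _).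
have -> : \sum_i tnth u i * U i j =
    tnth u j - (2 / N) * (\sum_i tnth u i * (tnth u i - tnth v i)) * (tnth u j - tnth v j).
  rewrite /U; under eq_bigr do rewrite !mxE big_ord1 !mxE mulrBr.
  rewrite sumrB; congr (_ - _).
    rewrite (bigD1 j)//= eqxx mulr1 big1 ?addr0// => i ij.
    by rewrite (negbTE ij) mulr0.
  rewrite mulr_sumr mulr_suml; apply: eq_bigr => i _; ring.
have -> : 2 / N * (\sum_i tnth u i * (tnth u i - tnth v i)) = 1.
  by rewrite mulrAC -NE divff.
by rewrite mul1r subKr.
Qed.

Lemma sphere_rotation (R : realType) n (mu : probability (n.-tuple R) R)
    (u v : n.-tuple R) (h : R -> R) (M : R) :
  uniform_on_sphere mu -> measurable_fun setT h -> (forall x, `|h x| <= M) ->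
  dotp u u = dotp v v ->
  \int[mu]_x h (dotp u x) = \int[mu]_x h (dotp v x).
Proof.
move=> [_ inv] mh hM /orthogonal_transport[U [UU Uv]].
have mU : measurable_fun setT (mxact U).
  apply/measurable_fun_tnthP => i.
  rewrite (_ : _ \o _ = fun x => \sum_(j < n) U i j * tnth x j).
    apply: measurable_sum => j; apply: measurable_funM => //.
    exact: measurable_tnth.
  by apply/funext => x /=; rewrite tnth_mktuple.
have mhu : measurable_fun setT (fun x => h (dotp u x)).
  by apply: (measurableT_comp mh); exact: measurable_dotp.
have -> : \int[mu]_x h (dotp v x) = \int[mu]_x h (dotp u (mxact U x)).
  by apply: eq_Rintegral => x _; rewrite Uv.
rewrite /Rintegral; congr fine.
rewrite -(@integral_pushforward _ _ _ _ _ _ mU mu setT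
   (fun x => (h (dotp u x))%:E))//.
- by apply: eq_measure_integral => A mA _; exact: esym (inv _ UU _ mA).
- exact/measurable_EFinP.
- apply: (@bounded_integrable _ _ _ mu _ M) => [|x]; last exact: hM.
  exact: (measurableT_comp mhu mU).
Qed.

Lemma measurable_sphere (R : realType) n : measurable (@sphere R n).
Proof.
have me : measurable_fun setT (fun x : n.-tuple R => dotp x x).
  exact: measurable_dotp.
rewrite (_ : sphere = (fun x : n.-tuple R => dotp x x) @^-1` [set 1]).
  by rewrite -[X in measurable X]setTI; exact: me.
apply/seteqP; split => x; rewrite /sphere /=.
  by move=> h; rewrite -enorm_sqr h expr1n.
by move=> h; rewrite /enorm h sqrtr1.
Qed.

Lemma sphere_ae (R : realType) n (mu : probability (n.-tuple R) R)
    (f g : n.-tuple R -> R) :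
  mu sphere = 1%E -> measurable_fun setT f -> measurable_fun setT g ->
  (forall x, sphere x -> f x = g x) -> \int[mu]_x f x = \int[mu]_x g x.
Proof.
move=> mu1 mf mg fg; rewrite /Rintegral; congr fine.
apply: ae_eq_integral => //; [exact/measurable_EFinP|exact/measurable_EFinP|].
exists (~` sphere); split.
- by apply: measurableC; exact: measurable_sphere.
- have /= -> := @probability_setC _ _ _ mu _ (@measurable_sphere R n).
  by rewrite [X in (_ - X)%E]mu1 subee.
- by move=> x /= h sx; apply: h => _; rewrite fg.
Qed.

Lemma measurable_enorm d (T : measurableType d) (R : realType) n
    (f : T -> n.-tuple R) :
  measurable_fun setT f -> measurable_fun setT (fun w => enorm (f w)).
Proof.
move=> mf; have -> : (fun w => enorm (f w)) = (fun w => dotp (f w) (f w) `^ (2^-1)).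
  by apply/funext => w; rewrite powR12_sqrt// dotp_ge0.
by apply: (measurableT_comp (measurable_powR _)); exact: measurable_dotp.
Qed.

(* If theta is uniform on the sphere and g is an independent standard Gaussian
   vector, then |g| theta is standard Gaussian: rotating x onto |x| g / |g|
   trades theta for g inside the cosine. *)
Lemma radial_cf (R : realType) n (mu G : probability (n.-tuple R) R)
    (x : n.-tuple R) :
  uniform_on_sphere mu ->
  (forall x a, \int[G]_g cos (dotp x g + a) = cos a * expR (- (dotp x x / 2))) ->
  \int[(mu \x G)%E]_z cos (enorm z.2 / Num.sqrt n%:R * dotp x z.1) =
  expR (- (dotp x x / (2 * n%:R))).
Proof.
move=> unif cfG.
set q := Num.sqrt n%:R.
have qn : q ^+ 2 = n%:R by rewrite sqr_sqrtr.
pose f (z : n.-tuple R * n.-tuple R) := cos (enorm z.2 / q * dotp x z.1).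
have mf : measurable_fun setT f.
  apply: measurable_cos_comp; apply: measurable_funM.
    by apply: measurable_funM => //; exact: measurable_enorm.
  exact: measurable_dotp.
have fb z : `|f z| <= 1 by exact: normr_cos_le1.
pose k (z : n.-tuple R * n.-tuple R) := cos (enorm x / q * dotp z.2 z.1).
have mk : measurable_fun setT k.
  apply: measurable_cos_comp; apply: measurable_funM => //.
  exact: measurable_dotp.
have kb z : `|k z| <= 1 by exact: normr_cos_le1.
have I1 (h : n.-tuple R * n.-tuple R -> R) y : measurable_fun setT h -> (forall z, `|h z| <= 1) ->
    G.-integrable setT (EFin \o (fun g => h (y, g))).
  move=> mh hb; apply: (@bounded_integrable _ _ _ G _ 1) => [|g]; last exact: hb.
  exact: (measurable_uncurry1 y mh).
have I2 (h : n.-tuple R * n.-tuple R -> R) y : measurable_fun setT h -> (forall z, `|h z| <= 1) ->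
    mu.-integrable setT (EFin \o (fun t => h (t, y))).
  move=> mh hb; apply: (@bounded_integrable _ _ _ mu _ 1) => [|g]; last exact: hb.
  exact: (measurable_uncurry2 y mh).
have I12 (h : n.-tuple R * n.-tuple R -> R) : measurable_fun setT h -> (forall z, `|h z| <= 1) ->
    (mu \x G)%E.-integrable setT (EFin \o h).
  by move=> mh hb; exact: (@bounded_integrable _ _ _ (mu \x G)%E _ 1).
rewrite (@Rintegral_prod _ _ _ _ _ mu G f)//; last 2 first.
- by move=> y; exact: I1.
- exact: I12.
rewrite (@Rintegral_Fubini _ _ _ _ _ mu G f)//; last 3 first.
- by move=> y; exact: I1.
- by move=> y; exact: I2.
- exact: I12.
transitivity (\int[G]_g \int[mu]_t k (t, g)).
  apply: eq_Rintegral => g _; rewrite /f /k /=.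
  under eq_Rintegral do rewrite -dotp_scalel.
  under [RHS]eq_Rintegral do rewrite -dotp_scalel.
  apply: (@sphere_rotation _ _ _ _ _ cos 1) => //.
  - by apply: continuous_measurable_fun; exact: continuous_cos.
  - by move=> y; exact: normr_cos_le1.
  - rewrite !dotp_scalel !dotp_scaler -!enorm_sqr; ring.
rewrite -(@Rintegral_Fubini _ _ _ _ _ mu G k)//; last 3 first.
- by move=> y; exact: I1.
- by move=> y; exact: I2.
- exact: I12.
(* For a fixed direction [t] the integral over [g] is a Gaussian characteristic function depending
   only on [|t|], and [|t| = 1] almost everywhere for [mu]. *)
have E t : \int[G]_g k (t, g) = expR (- (enorm x ^+ 2 * dotp t t / (2 * q ^+ 2))).
  rewrite /k /=.
  under eq_Rintegral do rewrite dotpC -dotp_scalel -[dotp _ _]addr0.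
  rewrite cfG cos0 mul1r dotp_scalel dotp_scaler; congr (expR (- _)).
  by rewrite invfM -exprVn; ring.
under eq_Rintegral do rewrite E.
have unit_mass := proj1 unif.
have mE : measurable_fun setT (fun t : n.-tuple R =>
    expR (- (enorm x ^+ 2 * dotp t t / (2 * q ^+ 2)))).
  apply: measurable_expR_comp; apply: measurable_funN.
  apply: measurable_funM => //; apply: measurable_funM => //.
  exact: measurable_dotp.
rewrite (@sphere_ae _ _ mu _ (cst (expR (- (dotp x x / (2 * n%:R)))))) //.
  exact: Rintegral_prob_cst.
by move=> t; rewrite /sphere /= => t1; rewrite -(enorm_sqr t) t1 expr1n mulr1 enorm_sqr qn.
Qed.

(** * Mean square of the conditional characteristic function *)

Lemma ge0_integrable_bound d (T : measurableType d) (R : realType)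
    (mu : {measure set T -> \bar R}) (f : T -> R) (M : R) :
  measurable_fun setT f -> (forall x, 0 <= f x) ->
  (\int[mu]_x (f x)%:E <= M%:E)%E ->
  mu.-integrable setT (EFin \o f) /\ \int[mu]_x f x <= M.
Proof.
move=> mf f0 fM.
have I0 : (0 <= \int[mu]_x (f x)%:E)%E.
  by apply: integral_ge0 => x _; rewrite lee_fin.
have fi : mu.-integrable setT (EFin \o f).
  apply/integrableP; split; first exact/measurable_EFinP.
  under eq_integral do rewrite /= ger0_norm//.
  by rewrite (le_lt_trans fM)// ltry.
split => //; rewrite -lee_fin fineK// ge0_fin_numE//.
by rewrite (le_lt_trans fM)// ltry.
Qed.

Lemma dotp_normB (R : realType) n (x y : n.-tuple R) :
  0 <= dotp x x + dotp y y - 2 * dotp x y.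
Proof.
have -> : dotp x x + dotp y y - 2 * dotp x y =
    \sum_(i < n) (tnth x i - tnth y i) ^+ 2.
  rewrite /dotp mulr_sumr -big_split -sumrB /=.
  by apply: eq_bigr => i _; ring.
by apply: sumr_ge0 => i _; exact: sqr_ge0.
Qed.

Lemma dotp_normD (R : realType) n (x y : n.-tuple R) :
  0 <= dotp x x + dotp y y + 2 * dotp x y.
Proof.
have := dotp_normB x (scalev (-1) y).
by rewrite !dotp_scaler dotp_scalel; lra.
Qed.

Lemma dotp_le_avg (R : realType) n (x y : n.-tuple R) :
  2 * `|dotp x y| <= dotp x x + dotp y y.
Proof.
have := dotp_normB x y; have := dotp_normD x y.
by have [h|h] := leP 0 (dotp x y); [rewrite ger0_norm|rewrite ltr0_norm]; lra.
Qed.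

(** * Second moments and bilinear means, with [K] for [M_3^3] and [s] for [E |U - 1|^(3/2)] *)

Section moments.
Context d (T : measurableType d) (R : realType) (P : probability T R).
Context (n : nat) (X : T -> n.-tuple R) (K s : R).
Hypothesis n_gt0 : (0 < n)%N.
Hypothesis mX : measurable_fun setT X.
Hypothesis K_ge0 : 0 <= K.
Hypothesis third_moment : forall v : n.-tuple R,
  (\int[P]_w (`|dotp (X w) v| ^+ 3)%:E <= (K * enorm v ^+ 3)%:E)%E.

Let U w : R := dotp (X w) (X w) / n%:R.

Hypothesis dev_moment : (\int[P]_w (pow32 (U w - 1))%:E <= s%:E)%E.
Hypothesis iU : P.-integrable setT (EFin \o U).
Hypothesis mean_U : \int[P]_w U w = 1.

Let nR_gt0 : 0 < n%:R :> R. Proof. by rewrite ltr0n. Qed.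

Let U_ge0 w : 0 <= U w.
Proof. by rewrite divr_ge0 ?dotp_ge0// ltW. Qed.

Let mdv v : measurable_fun setT (fun w => dotp (X w) v).
Proof. exact: measurable_dotp. Qed.

(** Pointwise interpolation: with [a = |<X, v>|] and [b = |v|], [a^2 <= b^2 + a^3 / b]. *)
Lemma second_moment v :
  (\int[P]_w (dotp (X w) v ^+ 2)%:E <= ((1 + K) * dotp v v)%:E)%E.
Proof.
have [v0|v0] := eqVneq (enorm v) 0.
  have vv0 : dotp v v = 0 by rewrite -enorm_sqr v0 expr0n.
  have dv0 w : dotp (X w) v = 0 by exact: dotp_enorm0.
  rewrite vv0 mulr0; under eq_integral do rewrite dv0 expr0n/=.
  by rewrite integral0.
have vg0 : 0 < enorm v by rewrite lt0r v0 sqrtr_ge0.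
apply: (@le_trans _ _ (\int[P]_w ((enorm v ^+ 2)%:E +
    (enorm v)^-1%:E * (`|dotp (X w) v| ^+ 3)%:E))%E).
  apply: ge0_le_integral => //.
  - by move=> w _; rewrite lee_fin sqr_ge0.
  - by apply/measurable_EFinP; exact: measurable_funX.
  - apply: emeasurable_funD => //; apply: emeasurable_funM => //.
    apply/measurable_EFinP; apply: measurable_funX.
    by apply: measurableT_comp => //.
  - move=> w _; rewrite -EFinM -EFinD lee_fin.
    rewrite -real_normK ?num_real//.
    have a0 : 0 <= `|dotp (X w) v| by [].
    set a := `|_| in a0 *; set b := enorm v in vg0 *.
    have -> : b ^+ 2 + b^-1 * a ^+ 3 = (b ^+ 3 + a ^+ 3) / b.
      by field; rewrite gt_eqF.
    rewrite ler_pdivlMr//.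
    have [ab|ab] := leP a b.
      have : 0 <= a ^+ 3 by rewrite exprn_ge0.
      have : a ^+ 2 * b <= b ^+ 2 * b by rewrite ler_wpM2r ?(ltW vg0)// lerXn2r ?nnegrE// ltW.
      rewrite -!exprSr; lra.
    have : 0 <= b ^+ 3 by rewrite exprn_ge0// ltW.
    have : a ^+ 2 * b <= a ^+ 2 * a by rewrite ler_wpM2l ?sqr_ge0// ltW.
    rewrite -!exprSr; lra.
rewrite ge0_integralD//; last 3 first.
- by move=> w _; rewrite lee_fin sqr_ge0.
- by move=> w _; rewrite lee_fin mulr_ge0 ?invr_ge0 ?(ltW vg0)// exprn_ge0.
- apply: emeasurable_funM => //; apply/measurable_EFinP; apply: measurable_funX.
  by apply: measurableT_comp => //.
rewrite integral_cst// ge0_integralZl//; last 2 first.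
- apply/measurable_EFinP; apply: measurable_funX.
  by apply: measurableT_comp => //.
- by rewrite lee_fin invr_ge0 ltW.
have /= -> := probability_setT P; rewrite mule1.
apply: (@le_trans _ _ ((enorm v ^+ 2)%:E + (enorm v)^-1%:E * (K * enorm v ^+ 3)%:E)%E).
  by rewrite leeD2l// lee_wpmul2l// lee_fin invr_ge0 ltW.
rewrite -EFinM -EFinD lee_fin -enorm_sqr le_eqVlt; apply/orP; left; apply/eqP.
by field.
Qed.

Let iXX : P.-integrable setT (EFin \o (fun w => dotp (X w) (X w))).
Proof.
have := integrableZR n%:R iU.
rewrite (_ : (fun w => n%:R * U w) = (fun w => dotp (X w) (X w)))//.
by apply/funext => w; rewrite /U mulrCA divff ?mulr1// gt_eqF.
Qed.

Let meanXX : \int[P]_w dotp (X w) (X w) = n%:R.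
Proof.
rewrite (_ : (fun w => dotp (X w) (X w)) = (fun w => n%:R * U w)).
  by rewrite RintegralZl// mean_U mulr1.
by apply/funext => w; rewrite /U mulrCA divff ?mulr1// gt_eqF.
Qed.

Let iXi (c : T -> R) (c0 : R) i : measurable_fun setT c -> (forall w, `|c w| <= c0) ->
  P.-integrable setT (EFin \o (fun w => c w * tnth (X w) i)).
Proof.
move=> mc cb.
have i1 : P.-integrable setT (EFin \o (fun w => 1 + dotp (X w) (X w))).
  apply: integrableDR => //; exact: finite_measure_integrable_cst.
apply: (@le_integrableR _ _ _ P _ (fun w => c0 * (1 + dotp (X w) (X w)))).
- by apply: measurable_funM => //; move/measurable_fun_tnthP: mX; apply.
- move=> w; rewrite normrM ler_pM//.
  have : tnth (X w) i ^+ 2 <= dotp (X w) (X w).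
    rewrite /dotp (bigD1 i)//= -expr2 lerDl sumr_ge0// => j _.
    by rewrite -expr2 sqr_ge0.
  have := sqr_ge0 (`|tnth (X w) i| - 1).
  rewrite -(real_normK (num_real (tnth (X w) i))).
  have : 0 <= `|tnth (X w) i| by [].
  set a := `|_|; nra.
- exact: integrableZR.
Qed.

(** The vector [E[c X]]. For independent copies, the mean of [c(X) e(Y) <X, Y>] is the inner product
    of two such vectors. *)
Let mean_vec (c : T -> R) : n.-tuple R := [tuple \int[P]_w (c w * tnth (X w) i) | i < n].

Let dotp_mean_vec (c : T -> R) (c0 : R) (v : n.-tuple R) :
  measurable_fun setT c -> (forall w, `|c w| <= c0) ->
  P.-integrable setT (EFin \o (fun w => c w * dotp (X w) v)) /\
  \int[P]_w (c w * dotp (X w) v) = dotp (mean_vec c) v.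
Proof.
move=> mc cb.
have E w : c w * dotp (X w) v = \sum_(i < n) tnth v i * (c w * tnth (X w) i).
  by rewrite /dotp mulr_sumr; apply: eq_bigr => i _; ring.
have I i : P.-integrable setT (EFin \o (fun w => tnth v i * (c w * tnth (X w) i))).
  by apply: integrableZR; exact: iXi cb.
under [in X in X /\ _]eq_fun do rewrite E.
under [in X in _ /\ X]eq_Rintegral do rewrite E.
have S m (F : 'I_m -> T -> R) :
    (forall i, P.-integrable setT (EFin \o F i)) ->
    P.-integrable setT (EFin \o (fun w => \sum_(i < m) F i w)) /\
    \int[P]_w (\sum_(i < m) F i w) = \sum_(i < m) \int[P]_w F i w.
  elim: m F => [|m IH] F FI.
    split.
      by under eq_fun do rewrite big_ord0; exact: finite_measure_integrable_cst.
    under eq_Rintegral do rewrite big_ord0.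
    by rewrite Rintegral_prob_cst big_ord0.
  have [I1 I2] := IH (fun i => F (lift ord0 i)) (fun i => FI _).
  split.
    by under eq_fun do rewrite big_ord_recl; exact: integrableDR.
  under eq_Rintegral do rewrite big_ord_recl.
  by rewrite RintegralD// I2 big_ord_recl.
have [S1 S2] := S _ _ I.
split => //; rewrite S2 /dotp; apply: eq_bigr => i _.
rewrite RintegralZl; [|by []|exact: iXi cb].
by rewrite tnth_mktuple mulrC.
Qed.

(** Duality: for [v = E[c X]], [|v|^2] is the mean of [c <X, v>]. With [L = 1 + K], this product is
    at most [L c^2 / 2 + <X, v>^2 / (2 L)], and the second term has mean at most [|v|^2 / 2]. *)
Let mean_vec_le (c : T -> R) (c0 : R) : measurable_fun setT c -> (forall w, `|c w| <= c0) ->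
  dotp (mean_vec c) (mean_vec c) <= (1 + K) * c0 ^+ 2.
Proof.
move=> mc cb; set v := mean_vec c.
have [I E] := dotp_mean_vec v mc cb.
have L0 : 0 < 1 + K by have := K_ge0; lra.
have [i2 e2] := ge0_integrable_bound (measurable_funX 2 (mdv v))
  (fun w => sqr_ge0 _) (second_moment v).
have c2 w : c w ^+ 2 <= c0 ^+ 2.
  by rewrite -real_normK ?num_real// lerXn2r// nnegrE (le_trans _ (cb w)).
have : \int[P]_w (c w * dotp (X w) v) <=
    \int[P]_w (1 / 2 * ((1 + K) * c0 ^+ 2) + 1 / 2 * (1 + K)^-1 * dotp (X w) v ^+ 2).
  apply: le_Rintegral => //.
    apply: integrableDR; first exact: finite_measure_integrable_cst.
    exact: integrableZR.
  move=> w _; set x := dotp _ _.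
  have : 0 <= (1 + K)^-1 * ((1 + K) * c w - x) ^+ 2.
    by rewrite mulr_ge0 ?sqr_ge0// invr_ge0 ltW.
  have -> : (1 + K)^-1 * ((1 + K) * c w - x) ^+ 2 =
     (1 + K) * c w ^+ 2 - 2 * (c w * x) + (1 + K)^-1 * x ^+ 2.
    by field; rewrite gt_eqF.
  have := ler_wpM2l (ltW L0) (c2 w); lra.
rewrite E RintegralD//; last 2 first.
- exact: finite_measure_integrable_cst.
- exact: integrableZR.
rewrite Rintegral_prob_cst RintegralZl// -/v.
have : (1 + K)^-1 * \int[P]_w (dotp (X w) v ^+ 2) <= dotp v v.
  by rewrite mulrC ler_pdivrMr// mulrC.
lra.
Qed.

(** By Fubini the mean is [<v, u>] with [v = E[c X]] and [u = E[e X]]. The weighted inequality [2 c0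
    e0 <v, u> <= e0^2 |v|^2 + c0^2 |u|^2] yields the product [c0 e0], so exponential smallness of
    one factor is enough. *)
Lemma bilinear_mean_le (c e : T -> R) c0 e0 : 0 < c0 -> 0 < e0 ->
  measurable_fun setT c -> measurable_fun setT e ->
  (forall w, `|c w| <= c0) -> (forall w, `|e w| <= e0) ->
  (P \x P)%E.-integrable setT
    (EFin \o (fun z => c z.1 * e z.2 * dotp (X z.1) (X z.2))) /\
  \int[(P \x P)%E]_z (c z.1 * e z.2 * dotp (X z.1) (X z.2)) <= c0 * e0 * (1 + K).
Proof.
move=> c00 e00 mc me cb eb.
pose f (z : T * T) := c z.1 * e z.2 * dotp (X z.1) (X z.2).
have m1 : measurable_fun setT (fun z : T * T => X z.1) by exact: measurableT_comp.
have m2 : measurable_fun setT (fun z : T * T => X z.2) by exact: measurableT_comp.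
have mf : measurable_fun setT f.
  apply: measurable_funM; last exact: measurable_dotp.
  by apply: measurable_funM; exact: measurableT_comp.
have fb z : `|f z| <= c0 * e0 * (dotp (X z.1) (X z.1) + dotp (X z.2) (X z.2)).
  have h1 : `|c z.1| * `|e z.2| <= c0 * e0 by exact: ler_pM.
  have h2 : `|dotp (X z.1) (X z.2)| <= dotp (X z.1) (X z.1) + dotp (X z.2) (X z.2).
    have := dotp_le_avg (X z.1) (X z.2).
    have : 0 <= `|dotp (X z.1) (X z.2)| by []. lra.
  by rewrite /f 2!normrM; apply: ler_pM h1 h2 => //; rewrite mulr_ge0.
have i2 w : P.-integrable setT (EFin \o (fun w' => f (w, w'))).
  have [I _] := dotp_mean_vec (X w) me eb.
  have := integrableZR (c w) I.
  congr (_.-integrable _ (_ \o _)); apply/funext => w'.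
  by rewrite /f /= dotpC; ring.
have iS w : P.-integrable setT (EFin \o (fun w' =>
     c0 * e0 * (dotp (X w) (X w) + dotp (X w') (X w')))).
  apply: integrableZR; apply: integrableDR => //.
  exact: finite_measure_integrable_cst.
have iSS : P.-integrable setT (EFin \o (fun w => c0 * e0 * (dotp (X w) (X w) + n%:R))).
  apply: integrableZR; apply: integrableDR => //.
  exact: finite_measure_integrable_cst.
have i12 : (P \x P)%E.-integrable setT (EFin \o f).
  apply/integrable12ltyP; first exact/measurable_EFinP.
  apply: (@le_lt_trans _ _ (\int[P]_w (c0 * e0 * (dotp (X w) (X w) + n%:R))%:E)%E); last first.
    case/integrableP : iSS => _; under eq_integral do rewrite /= ger0_norm
      ?mulr_ge0 ?(ltW c00) ?(ltW e00) ?addr_ge0 ?dotp_ge0//.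
    by [].
  apply: ge0_le_integral => //.
  - by move=> w _; apply: integral_ge0 => y _.
  - apply: (@measurable_fun_fubini_tonelli_F _ _ _ _ _ P
      (abse \o (EFin \o f))) => //=.
    by apply: measurableT_comp => //; exact/measurable_EFinP.
  - by case/integrableP : iSS.
  - move=> w _.
    apply: (@le_trans _ _ (\int[P]_w' (c0 * e0 * (dotp (X w) (X w) + dotp (X w') (X w')))%:E)%E).
      apply: ge0_le_integral => //.
      + by apply: measurableT_comp => //; case/integrableP : (i2 w).
      + by case/integrableP : (iS w).
      + by move=> y _; rewrite lee_fin; exact: (fb (w, y)).
    have e1 : \int[P]_w' (c0 * e0 * (dotp (X w) (X w) + dotp (X w') (X w'))) =
        c0 * e0 * (dotp (X w) (X w) + n%:R).
      rewrite RintegralZl//; last first.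
        apply: integrableDR => //; exact: finite_measure_integrable_cst.
      rewrite RintegralD//; last exact: finite_measure_integrable_cst.
      by rewrite Rintegral_prob_cst meanXX.
    by rewrite -e1 fineK// (integrable_fin_num measurableT (iS w)).
split => //.
rewrite (@Rintegral_prod _ _ _ _ _ P P f)//.
pose v := mean_vec c; pose u := mean_vec e.
have -> : \int[P]_x \int[P]_y f (x, y) = dotp v u.
  have [_ <-] := dotp_mean_vec u mc cb.
  apply: eq_Rintegral => w _.
  have [_ h] := dotp_mean_vec (X w) me eb.
  rewrite (dotpC (X w)) -h -RintegralZl//; last first.
    by have [] := dotp_mean_vec (X w) me eb.
  by apply: eq_Rintegral => w' _; rewrite /f /= dotpC mulrA.
have := mean_vec_le mc cb; have := mean_vec_le me eb; rewrite -/v -/u.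
have := dotp_normB (scalev e0 v) (scalev c0 u).
rewrite !dotp_scalel !dotp_scaler => h hu hv.
have ce0 : 0 < c0 * e0 by rewrite mulr_gt0.
rewrite -(ler_pM2l ce0).
have h1 := ler_wpM2l (sqr_ge0 e0) hv.
have h2 := ler_wpM2l (sqr_ge0 c0) hu.
lra.
Qed.
End moments.

(** * The mean square at a fixed frequency, with [a = t^2 / 2] *)

Section variance.
Context d (T : measurableType d) (R : realType) (P : probability T R).
Context (n : nat) (X : T -> n.-tuple R) (K s : R).
Hypothesis n_gt0 : (0 < n)%N.
Hypothesis mX : measurable_fun setT X.
Hypothesis K_ge0 : 0 <= K.
Hypothesis third_moment : forall v : n.-tuple R,
  (\int[P]_w (`|dotp (X w) v| ^+ 3)%:E <= (K * enorm v ^+ 3)%:E)%E.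

Let U w : R := dotp (X w) (X w) / n%:R.

Hypothesis dev_moment : (\int[P]_w (pow32 (U w - 1))%:E <= s%:E)%E.
Hypothesis iU : P.-integrable setT (EFin \o U).
Hypothesis mean_U : \int[P]_w U w = 1.

Let p (z : T * T) : R := dotp (X z.1) (X z.2) / n%:R.

Let nR_gt0 : 0 < n%:R :> R. Proof. by rewrite ltr0n. Qed.

Let U_ge0 w : 0 <= U w.
Proof. by rewrite divr_ge0 ?dotp_ge0// ltW. Qed.

Let mU : measurable_fun setT U.
Proof. by apply: measurable_funM => //; exact: measurable_dotp. Qed.

Let m1 (f : T -> R) : measurable_fun setT f -> measurable_fun setT (fun z : T * T => f z.1).
Proof. by move=> mf; exact: measurableT_comp. Qed.

Let m2 (f : T -> R) : measurable_fun setT f -> measurable_fun setT (fun z : T * T => f z.2).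
Proof. by move=> mf; exact: measurableT_comp. Qed.

Let mdot : measurable_fun setT (fun z : T * T => dotp (X z.1) (X z.2)).
Proof. by apply: measurable_dotp; exact: measurableT_comp. Qed.

Let mp : measurable_fun setT p.
Proof. exact: measurable_funM. Qed.

Let p_le z : 2 * `|p z| <= U z.1 + U z.2.
Proof.
rewrite /p /U normrM normfV (gtr0_norm nR_gt0) -mulrDl mulrA.
by rewrite ler_wpM2r ?invr_ge0 ?(ltW nR_gt0)// dotp_le_avg.
Qed.

Lemma measurable_pow32 (R' : realType) : measurable_fun setT (@pow32 R').
Proof.
apply: measurable_funM; first exact: normr_measurable.
rewrite (_ : (fun x : R' => _) = (fun x => `|x| `^ (2^-1))).
  by apply: (measurableT_comp (measurable_powR _)); exact: normr_measurable.
by apply/funext => x; rewrite powR12_sqrt.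
Qed.

Let mdev : measurable_fun setT (fun w => pow32 (U w - 1)).
Proof. by apply: (measurableT_comp (@measurable_pow32 R)); exact: measurable_funB. Qed.

Let dev : P.-integrable setT (EFin \o (fun w => pow32 (U w - 1))) /\
  \int[P]_w pow32 (U w - 1) <= s.
Proof.
by apply: ge0_integrable_bound dev_moment => // w; exact: pow32_ge0.
Qed.

Let s_ge0 : 0 <= s.
Proof. by apply: le_trans dev.2; apply: Rintegral_ge0 => w _; exact: pow32_ge0. Qed.

Lemma cross_square_le : (P \x P)%E.-integrable setT (EFin \o (fun z => p z ^+ 2)) /\
  \int[(P \x P)%E]_z (p z ^+ 2) <= (1 + K) / n%:R.
Proof.
apply: ge0_integrable_bound => [|z|]; [exact: measurable_funX|exact: sqr_ge0|].
have mq : measurable_fun setT (fun z => (p z ^+ 2)%:E).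
  by apply/measurable_EFinP; exact: measurable_funX.
rewrite (fubini_tonelli2 _ mq) => [|z]; last by rewrite lee_fin sqr_ge0.
apply: (@le_trans _ _ (\int[P]_w (((1 + K) / n%:R) * U w)%:E)%E).
  apply: ge0_le_integral => //.
  - by move=> w _; apply: integral_ge0 => y _; rewrite lee_fin sqr_ge0.
  - apply: (measurable_fun_fubini_tonelli_G _ mq) => z.
    by rewrite lee_fin sqr_ge0.
  - by apply/measurable_EFinP; exact: measurable_funM.
  - move=> w _; rewrite /fubini_G /p /=.
    have := second_moment mX third_moment (X w) => h.
    under eq_integral do rewrite exprMn mulrC EFinM.
    rewrite ge0_integralZl//; last 2 first.
    + by apply/measurable_EFinP; apply: measurable_funX; exact: measurable_dotp.
    + by move=> y _; rewrite lee_fin sqr_ge0.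
    have -> : (1 + K) / n%:R * U w = n%:R^-1 ^+ 2 * ((1 + K) * dotp (X w) (X w)).
      by rewrite /U; field; rewrite gt_eqF.
    by rewrite [leRHS]EFinM lee_wpmul2l ?lee_fin ?sqr_ge0.
have iKU : P.-integrable setT (EFin \o (fun w => (1 + K) / n%:R * U w)).
  exact: integrableZR.
rewrite -[leLHS]fineK ?(integrable_fin_num measurableT iKU)// lee_fin.
by rewrite -/(Rintegral P setT _) RintegralZl// mean_U mulr1.
Qed.

Let cube_le (y x : R) : 0 <= y -> 0 <= x -> y ^+ 2 <= 1 + x ^+ 2 ->
  y ^+ 3 <= 4 * (1 + x ^+ 3).
Proof.
move=> y0 x0 h; rewrite exprSr (exprSr x).
have [x1|x1] := leP x 1.
  have y2 : y <= 2 by nra.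
  have : y ^+ 2 * y <= 2 * 2.
    by apply: ler_pM => //; [exact: sqr_ge0|nra].
  have : 0 <= x ^+ 2 * x by rewrite mulr_ge0 ?sqr_ge0.
  lra.
have h2 : y ^+ 2 <= 2 * x ^+ 2 by nra.
have y2 : y <= 2 * x by nra.
have : y ^+ 2 * y <= 2 * x ^+ 2 * (2 * x).
  by apply: ler_pM => //; exact: sqr_ge0.
lra.
Qed.

Let r : R := Num.sqrt n%:R.
Let r_gt0 : 0 < r. Proof. by rewrite sqrtr_gt0. Qed.
Let r2 : r ^+ 2 = n%:R. Proof. by rewrite sqr_sqrtr// ltW. Qed.

(** Since [U <= 1 + |U - 1|], the cube [|X|^3 = r^3 U^(3/2)] is controlled by the deviation moment.
    This is how [1 + s] enters the cubic term once the third moment bound is applied with the other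
    copy as direction. *)
Let enorm_cube w : enorm (X w) ^+ 3 <= 4 * r ^+ 3 * (1 + pow32 (U w - 1)).
Proof.
have -> : enorm (X w) = r * Num.sqrt (U w).
  rewrite /U /enorm sqrtrM ?dotp_ge0// sqrtrV ?(ltW nR_gt0)// -/r.
  by field; rewrite gt_eqF.
rewrite exprMn -mulrA (mulrCA 4) ler_wpM2l ?exprn_ge0 ?(ltW r_gt0)//.
rewrite /pow32; set x := Num.sqrt `|U w - 1|.
have x0 : 0 <= x by exact: sqrtr_ge0.
have x2 : `|U w - 1| = x ^+ 2 by rewrite sqr_sqrtr.
rewrite x2 -exprSr; apply: cube_le => //.
rewrite sqr_sqrtr// -x2.
by have := ler_norm (U w - 1); lra.
Qed.

Lemma cross_cube_le :
  (P \x P)%E.-integrable setT (EFin \o (fun z => `|p z| ^+ 3)) /\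
  \int[(P \x P)%E]_z (`|p z| ^+ 3) <= 4 * K * (1 + s) / r ^+ 3.
Proof.
have mq0 : measurable_fun setT (fun z => `|p z| ^+ 3).
  by apply: measurable_funX; exact: measurableT_comp.
apply: ge0_integrable_bound => [//|z|]; first by rewrite exprn_ge0.
have mq : measurable_fun setT (fun z => (`|p z| ^+ 3)%:E).
  exact/measurable_EFinP.
rewrite (fubini_tonelli2 _ mq) => [|z]; last by rewrite lee_fin exprn_ge0.
pose c := 4 * K / r ^+ 3.
have c0 : 0 <= c by rewrite divr_ge0 ?exprn_ge0 ?(ltW r_gt0)// mulr_ge0.
have ic1 : P.-integrable setT (EFin \o (fun w => 1 + pow32 (U w - 1))).
  by apply: integrableDR dev.1; exact: finite_measure_integrable_cst.
have ic : P.-integrable setT (EFin \o (fun w => c * (1 + pow32 (U w - 1)))).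
  exact: integrableZR.
apply: (@le_trans _ _ (\int[P]_w (c * (1 + pow32 (U w - 1)))%:E)%E).
  apply: ge0_le_integral => //.
  - by move=> w _; apply: integral_ge0 => y _; rewrite lee_fin exprn_ge0.
  - apply: (measurable_fun_fubini_tonelli_G _ mq) => z.
    by rewrite lee_fin exprn_ge0.
  - by case/integrableP : ic.
  - move=> w _; rewrite /fubini_G /p /=.
    under eq_integral do rewrite normrM exprMn mulrC EFinM.
    rewrite ge0_integralZl//; last first.
      apply/measurable_EFinP; apply: measurable_funX; apply: measurableT_comp => //.
      exact: measurable_dotp.
    apply: (@le_trans _ _ ((`|n%:R^-1| ^+ 3)%:E * (K * enorm (X w) ^+ 3)%:E)%E).
      by rewrite lee_wpmul2l ?lee_fin ?exprn_ge0//; exact: third_moment.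
    rewrite -EFinM lee_fin normfV (gtr0_norm nR_gt0).
    have -> : c * (1 + pow32 (U w - 1)) =
        n%:R^-1 ^+ 3 * (K * (4 * r ^+ 3 * (1 + pow32 (U w - 1)))).
      by rewrite -r2 /c; field; rewrite gt_eqF.
    rewrite ler_wpM2l ?exprn_ge0 ?invr_ge0 ?(ltW nR_gt0)//.
    by rewrite ler_wpM2l.
rewrite -[leLHS]fineK ?(integrable_fin_num measurableT ic)// lee_fin.
rewrite -/(Rintegral P setT _) RintegralZl// RintegralD//; last 2 first.
- exact: finite_measure_integrable_cst.
- exact: dev.1.
rewrite Rintegral_prob_cst.
have -> : 4 * K * (1 + s) / r ^+ 3 = c * (1 + s) by rewrite /c; ring.
by rewrite ler_wpM2l// lerD2l; exact: dev.2.
Qed.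

Let B : set T := [set w | U w < 1 / 2].

Let mB : measurable B.
Proof.
rewrite (_ : B = U @^-1` `]-oo, (1 / 2)[%classic).
  by rewrite -[X in measurable X]setTI; exact: mU.
by apply/seteqP; split => w /=; rewrite in_itv.
Qed.

Let indic01 w : 0 <= (\1_B w : R) <= 1.
Proof. by rewrite indicE; case: (_ \in _); rewrite /= ?lexx ?ler01. Qed.

Let notB w : w \notin B -> 1 / 2 <= U w.
Proof. by rewrite notin_setE => /negP; rewrite -leNgt. Qed.

Let inB w : w \in B -> U w < 1 / 2.
Proof. by rewrite inE. Qed.

Let mind : measurable_fun setT (\1_B : T -> R).
Proof. exact: measurable_indic. Qed.

(** Markov's inequality: on [B], [|U - 1| > 1 / 2], so [|U - 1|^(3/2) > 1 / 4]. *)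
Let bad_mass : \int[P]_w (\1_B w) <= 4 * s.
Proof.
apply: (@le_trans _ _ (\int[P]_w (4 * pow32 (U w - 1)))).
  apply: le_Rintegral => //.
  - apply: (@bounded_integrable _ _ _ P _ 1) => // w.
    by have /andP[h0 h1] := indic01 w; rewrite ger0_norm.
  - exact: integrableZR dev.1.
  - move=> w _; rewrite indicE; case: (boolP (w \in B)) => h /=; last first.
      by rewrite mulr_ge0// pow32_ge0.
    move: h; rewrite inE /B /= => h.
    rewrite /pow32 ltr0_norm; last by lra.
    set x := Num.sqrt _.
    have x0 : 0 <= x by exact: sqrtr_ge0.
    have x2 : x ^+ 2 = - (U w - 1) by rewrite sqr_sqrtr//; lra.
    have : 1 / 2 < x by nra.
    nra.
by rewrite RintegralZl//; [rewrite ler_wpM2l//; exact: dev.2|exact: dev.1].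
Qed.

Section fixed_time.
Variable a : R.
Hypothesis a0 : 0 <= a.

Let q w := expR (- (a * U w)).
Let m := Num.min 1 a.

Let m0 : 0 <= m. Proof. by rewrite le_min ler01. Qed.

Let mq : measurable_fun setT q.
Proof.
by apply: measurable_expR_comp; apply: measurable_funN; exact: measurable_funM.
Qed.

Let q01 w : 0 <= q w <= 1.
Proof. by rewrite expR_ge0 expR_le1 oppr_le0 mulr_ge0. Qed.

(** The linear term of [expR_centered_le] can be added freely, because [U - 1] has mean zero. *)
Lemma mean_decay_le : `|\int[P]_w q w - expR (- a)| <= 16 * m * s.
Proof.
have iq : P.-integrable setT (EFin \o q).
  apply: (@bounded_integrable _ _ _ P _ 1) => // w.
  by have /andP[? ?] := q01 w; rewrite ger0_norm.
have ilin : P.-integrable setT (EFin \o (fun w => a * expR (- a) * (U w - 1))).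
  apply: integrableZR; apply: integrableBR => //.
  exact: finite_measure_integrable_cst.
have ie : P.-integrable setT (EFin \o (fun w => q w - expR (- a))).
  by apply: integrableBR => //; exact: finite_measure_integrable_cst.
have -> : \int[P]_w q w - expR (- a) =
    \int[P]_w (q w - expR (- a) + a * expR (- a) * (U w - 1)).
  rewrite RintegralD// RintegralB//; last exact: finite_measure_integrable_cst.
  rewrite RintegralZl//; last first.
    by apply: integrableBR => //; exact: finite_measure_integrable_cst.
  rewrite RintegralB//; last exact: finite_measure_integrable_cst.
  by rewrite !Rintegral_prob_cst mean_U subrr mulr0 addr0.
have iall := integrableDR ie ilin.
apply: (le_trans (le_normr_Rintegral _ _)) => //.
apply: (@le_trans _ _ (\int[P]_w (16 * m * pow32 (U w - 1)))).
  apply: le_Rintegral => //.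
  - by have := integrable_norm iall.
  - exact: integrableZR dev.1.
  - by move=> w _; exact: expR_centered_le.
rewrite RintegralZl//; last exact: dev.1.
by rewrite ler_wpM2l ?mulr_ge0//; exact: dev.2.
Qed.

(** Off [B] the factor [cq] is at most [exp(-a / 2)], while on [B] the factor [dq] has only the
    bound 1. In a product over two copies, [q q - dq dq = cq q + dq cq], so removing the event that
    both copies are bad leaves a factor [cq] in each term. *)
Let dq w := q w * \1_B w.
Let cq w := q w * (1 - \1_B w).

Let mdq : measurable_fun setT dq. Proof. exact: measurable_funM. Qed.
Let mcq : measurable_fun setT cq.
Proof. by apply: measurable_funM => //; exact: measurable_funB. Qed.

Let dq_le w : `|dq w| <= 1.
Proof.
rewrite /dq; have /andP[h1 h2] := q01 w; have /andP[h3 h4] := indic01 w.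
by rewrite ger0_norm ?mulr_ge0// mulr_ile1.
Qed.

Let q_le w : `|q w| <= 1.
Proof. by have /andP[h1 h2] := q01 w; rewrite ger0_norm. Qed.

Let cq_le w : `|cq w| <= expR (- (a / 2)).
Proof.
rewrite /cq indicE; case: (boolP (w \in B)) => h /=.
  by rewrite subrr mulr0 normr0 expR_ge0.
rewrite subr0 mulr1 /q ger0_norm ?expR_ge0// ler_expR lerN2.
by have := ler_wpM2l a0 (notB h); lra.
Qed.

(* Where [U z.1 + U z.2 >= 1 / 2] this is [expR_cross_le]; the exceptional
   event [z.1 \in B /\ z.2 \in B] has probability [O(s ^ 2)] by Markov.  The
   linear term is split so that each part has a factor [cq = O(exp(-a / 2))]. *)
Let kernel_le z : expR (- (a * (U z.1 + U z.2 - 2 * p z))) <=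
  q z.1 * q z.2 + 2 * a / n%:R * (cq z.1 * q z.2 * dotp (X z.1) (X z.2)
     + dq z.1 * cq z.2 * dotp (X z.1) (X z.2))
  + 4 * a ^+ 2 * expR (- (a / 4)) * p z ^+ 2 + 1024 * m * `|p z| ^+ 3
  + m * (\1_B z.1 * \1_B z.2).
Proof.
have qq : q z.1 * q z.2 = expR (- (a * (U z.1 + U z.2))).
  by rewrite -expRD; congr expR; ring.
have lin : 2 * a / n%:R * (cq z.1 * q z.2 * dotp (X z.1) (X z.2)
     + dq z.1 * cq z.2 * dotp (X z.1) (X z.2)) =
     2 * a * p z * (q z.1 * q z.2) * (1 - \1_B z.1 * \1_B z.2).
  by rewrite /cq /dq /p; ring.
rewrite lin qq.
have hp := p_le z.
have [bad|good] := boolP ((z.1 \in B) && (z.2 \in B)).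
  have /andP[/[dup] b1 /inB u1 /[dup] b2 /inB u2] := bad.
  rewrite !indicE b1 b2 /= !mulr1 subrr mulr0 addr0.
  have : 0 <= 4 * a ^+ 2 * expR (- (a / 4)) * p z ^+ 2.
    by rewrite mulr_ge0 ?sqr_ge0// mulr_ge0 ?expR_ge0// mulr_ge0 ?sqr_ge0.
  have mp0 : 0 <= m * `|p z| ^+ 3 by rewrite mulr_ge0.
  suff : expR (- (a * (U z.1 + U z.2 - 2 * p z))) <= expR (- (a * (U z.1 + U z.2))) + m.
    by lra.
  have pl : p z <= `|p z| by exact: ler_norm.
  have e1 : expR (- (a * (U z.1 + U z.2 - 2 * p z))) <= 1.
    by rewrite expR_le1 oppr_le0 mulr_ge0//; lra.
  have e2 := expR_ge1Dx (- (a * (U z.1 + U z.2))).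
  have e3 := expR_gt0 (- (a * (U z.1 + U z.2))).
  have hX : a * (U z.1 + U z.2) <= a by rewrite ler_piMr//; lra.
  (* For [a >= 1] one has [m = 1]; for [a < 1], [m = a] and the exponential is at least
     [1 - a (U + W) >= 1 - a], because [U + W < 1] when both copies are bad. *)
  suff hm : 1 <= expR (- (a * (U z.1 + U z.2))) + m by lra.
  by rewrite /m; case: (leP 1 a) => h; lra.
have -> : \1_B z.1 * \1_B z.2 = 0 :> R.
  by rewrite !indicE; move: good; case: (_ \in _); case: (_ \in _); rewrite //= ?mulr0 ?mul0r.
have UU : 1 / 2 <= U z.1 + U z.2.
  have u1 := U_ge0 z.1; have u2 := U_ge0 z.2.
  by move: good; rewrite negb_and => /orP[] /notB h; lra.
have := expR_cross_le a0 (U_ge0 z.1) (U_ge0 z.2) hp UU.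
rewrite -/m; lra.
Qed.

(** Integrating [kernel_le], the product [q q] contributes [Q^2] with [Q = E q], which completes the
    square [(Q - exp(-a))^2 <= 256 m s^2], as [m <= 1]. The squared mass of [B] adds [16 m s^2],
    whence 272; 4096 is 1024 times the 4 of [cross_cube_le]. *)
Lemma variance_le :
  \int[(P \x P)%E]_z expR (- (a * (U z.1 + U z.2 - 2 * p z)))
    - 2 * expR (- a) * \int[P]_w q w + expR (- a) ^+ 2 <=
  (4 * a * expR (- (a / 2)) + 4 * a ^+ 2 * expR (- (a / 4))) * ((1 + K) / n%:R)
  + 4096 * m * (K * (1 + s) / r ^+ 3) + 272 * m * s ^+ 2.
Proof.
have [i2 h2] := cross_square_le.
have [i3 h3] := cross_cube_le.
have e0 := expR_gt0 (- (a / 2)).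
have [il1 hl1] := bilinear_mean_le n_gt0 mX K_ge0 third_moment iU mean_U
  e0 ltr01 mcq mq cq_le q_le.
have [il2 hl2] := bilinear_mean_le n_gt0 mX K_ge0 third_moment iU mean_U
  ltr01 e0 mdq mcq dq_le cq_le.
have [iq hq] := Rintegral_prod_mul P P mq mq q_le q_le.
have ind_le w : `|\1_B w : R| <= 1.
  by have /andP[? ?] := indic01 w; rewrite ger0_norm.
have [iB hB] := Rintegral_prod_mul P P mind mind ind_le ind_le.
have mE : measurable_fun setT (fun z : T * T => expR (- (a * (U z.1 + U z.2 - 2 * p z)))).
  apply: measurable_expR_comp; apply: measurable_funN; apply: measurable_funM => //.
  apply: measurable_funB; last exact: measurable_funM.
  by apply: measurable_funD; [exact: m1|exact: m2].
have iE : (P \x P)%E.-integrable setT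
    (EFin \o (fun z => expR (- (a * (U z.1 + U z.2 - 2 * p z))))).
  apply: (@bounded_integrable _ _ _ (P \x P)%E _ 1) => // z.
  rewrite ger0_norm ?expR_ge0// expR_le1 oppr_le0 mulr_ge0//.
  by have := p_le z; have := ler_norm (p z); lra.
have il := integrableZR (2 * a / n%:R) (integrableDR il1 il2).
have i2' := integrableZR (4 * a ^+ 2 * expR (- (a / 4))) i2.
have i3' := integrableZR (1024 * m) i3.
have iB' := integrableZR m iB.
have j1 := integrableDR iq il.
have j2 := integrableDR j1 i2'.
have j3 := integrableDR j2 i3'.
have j4 := integrableDR j3 iB'.
have main := le_Rintegral measurableT iE j4 (fun z _ => kernel_le z).
move: main.
rewrite (RintegralD measurableT j3 iB') (RintegralD measurableT j2 i3').
rewrite (RintegralD measurableT j1 i2') (RintegralD measurableT iq il).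
rewrite (RintegralZl _ measurableT iB) (RintegralZl _ measurableT i3).
rewrite (RintegralZl _ measurableT i2).
rewrite (RintegralZl _ measurableT (integrableDR il1 il2)).
rewrite (RintegralD measurableT il1 il2) hq hB -!expr2.
set E := \int[_]_z expR _; set L1 := \int[_]_z _ in hl1 *.
set L2 := \int[_]_z _ in hl2 *.
set C2 := \int[_]_z _ in h2 *; set C3 := \int[_]_z _ in h3 *.
set Q := \int[P]_w q w; set b := \int[P]_w \1_B w.
move=> main.
have b4 : b <= 4 * s := bad_mass.
have b0 : 0 <= b by apply: Rintegral_ge0 => w _; have /andP[] := indic01 w.
have b2 : b ^+ 2 <= 16 * s ^+ 2 by nra.
have mb : m * b ^+ 2 <= 16 * m * s ^+ 2 by have := ler_wpM2l m0 b2; lra.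
have an0 : 0 <= 2 * a / n%:R by rewrite divr_ge0 ?(ltW nR_gt0)// mulr_ge0.
have hl := ler_wpM2l an0 (lerD hl1 hl2).
have c20 : 0 <= 4 * a ^+ 2 * expR (- (a / 4)).
  by rewrite mulr_ge0 ?expR_ge0// mulr_ge0 ?sqr_ge0.
have hh2 := ler_wpM2l c20 h2.
have hh3 := ler_wpM2l m0 h3.
have md := mean_decay_le; rewrite -/Q in md.
have sq : (Q - expR (- a)) ^+ 2 <= 256 * m * s ^+ 2.
  rewrite -real_normK ?num_real//.
  apply: (@le_trans _ _ ((16 * m * s) ^+ 2)).
    by rewrite lerXn2r// ?nnegrE ?mulr_ge0.
  have m1' : m <= 1 by rewrite ge_min lexx.
  have : m * (m * s ^+ 2) <= 1 * (m * s ^+ 2).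
    by apply: ler_wpM2r => //; rewrite mulr_ge0 ?sqr_ge0.
  nra.
nra.
Qed.
End fixed_time.
End variance.

(** * An integrable envelope in [t] for the mean square *)

Lemma cube_le_gauss (R : realType) (t : R) :
  (1 + t) ^+ 2 * (1 + t) <= 17 ^+ 3 * expR (t ^+ 2 / 16) \/ t < 0.
Proof.
have [t0|] := leP 0 t; last by right.
left.
(* The quadratic [17 y - 1 - t] has negative discriminant, and [exp(t^2 / 16)] is the fourth power
   of [exp(t^2 / 64) >= y]. *)
pose y := 1 + t ^+ 2 / 64.
have y1 : 1 <= y by rewrite /y; have := sqr_ge0 t; lra.
have h1 : 1 + t <= 17 * y by rewrite /y; nra.
have h2 : y <= expR (t ^+ 2 / 64) by exact: expR_ge1Dx.
have e : expR (t ^+ 2 / 16) = expR (t ^+ 2 / 64) ^+ 4.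
  by rewrite -expRM_natr; congr expR; lra.
have h3 : y ^+ 3 <= expR (t ^+ 2 / 16).
  rewrite e; apply: (@le_trans _ _ (y ^+ 4)).
    by rewrite [leRHS]exprS ler_peMl// exprn_ge0//; lra.
  by rewrite lerXn2r// nnegrE ?expR_ge0//; lra.
rewrite -exprSr; apply: (@le_trans _ _ ((17 * y) ^+ 3)).
  by rewrite lerXn2r// nnegrE; lra.
by rewrite exprMn ler_wpM2l// exprn_ge0.
Qed.

(** The inequality [t <= r exp(t^2 / r^2)] exchanges one power of [t] for the spare factor [r]. For
    [t > 1] the left side is at most [8 t^3]; for [t <= 1] it is at most [8 t^2], and
    [r exp(t^2 / r^2) >= 1]. *)
Lemma min1_growth (R : realType) (t r : R) : 0 <= t -> 1 <= r ->
  Num.min 1 (t ^+ 2 / 2) * ((1 + t) ^+ 2 * (1 + t)) <=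
  8 * r * (t ^+ 2 * expR (t ^+ 2 / r ^+ 2)).
Proof.
move=> t0 r1.
have t20 : 0 <= t ^+ 2 by exact: sqr_ge0.
have r0 : 0 < r by lra.
set e := expR _.
have e1 : 1 + t ^+ 2 / r ^+ 2 <= e by exact: expR_ge1Dx.
have tr : t / r <= e.
  have : (t / r) ^+ 2 = t ^+ 2 / r ^+ 2 by rewrite exprMn exprVn.
  set x := t / r => hx; rewrite -hx in e1.
  by have := sqr_ge0 (x - 1); nra.
have tre : t <= r * e by rewrite mulrC -ler_pdivrMr.
have re : 1 <= r * e by nra.
have m0 : 0 <= Num.min 1 (t ^+ 2 / 2) by rewrite le_min ler01; lra.
have [t1|t1] := leP t 1.
  have c8 : (1 + t) ^+ 2 * (1 + t) <= 8 by nra.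
  have mt : Num.min 1 (t ^+ 2 / 2) <= t ^+ 2 by apply: le_trans (min1_le _) _; lra.
  have c0 : 0 <= (1 + t) ^+ 2 * (1 + t) by rewrite mulr_ge0 ?sqr_ge0//; lra.
  apply: (@le_trans _ _ (t ^+ 2 * 8)); first exact: ler_pM.
  have := ler_wpM2l t20 re; lra.
have c8 : (1 + t) ^+ 2 * (1 + t) <= 8 * (t ^+ 2 * t).
  have h2 : (1 + t) ^+ 2 <= 4 * t ^+ 2 by nra.
  have : (1 + t) ^+ 2 * (1 + t) <= 4 * t ^+ 2 * (2 * t).
    by apply: ler_pM => //; rewrite ?sqr_ge0//; lra.
  lra.
have c0 : 0 <= (1 + t) ^+ 2 * (1 + t) by rewrite mulr_ge0 ?sqr_ge0//; lra.
have m1 : Num.min 1 (t ^+ 2 / 2) <= 1 by rewrite ge_min lexx.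
apply: (@le_trans _ _ (1 * (8 * (t ^+ 2 * t)))); first exact: ler_pM.
have := ler_wpM2l t20 tre; lra.
Qed.

(** One factor [exp(-t^2 / 16)] absorbs [(1 + t)^3]. The term in [a^2] has a second one, since
    [exp(-a / 4) = exp(-t^2 / 8)], which absorbs the additional [t^2]; the constant is 2 + 16 =
    18. *)
Lemma gauss_decay (R : realType) (t a : R) : 0 <= t -> a = t ^+ 2 / 2 ->
  (4 * a * expR (- (a / 2)) + 4 * a ^+ 2 * expR (- (a / 4))) *
    ((1 + t) ^+ 2 * (1 + t)) <= 18 * 17 ^+ 3 * t ^+ 2.
Proof.
move=> t0 aE.
have [h|] := cube_le_gauss t; last by rewrite ltNge t0.
set c := (1 + t) ^+ 2 * (1 + t) in h *.
have c0 : 0 <= c by rewrite mulr_ge0 ?sqr_ge0//; lra.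
have t20 : 0 <= t ^+ 2 by exact: sqr_ge0.
have D0 : 0 <= 17 ^+ 3 :> R by rewrite exprn_ge0.
set D : R := 17 ^+ 3 in h D0 *.
have e1 : expR (- (a / 2)) <= expR (- (t ^+ 2 / 16)) by rewrite ler_expR aE; lra.
have e2 : expR (- (a / 4)) = expR (- (t ^+ 2 / 16)) * expR (- (t ^+ 2 / 16)).
  by rewrite -expRD; congr expR; rewrite aE; lra.
have e3 := xexpRN_le1 (t ^+ 2 / 16).
have e4 := expRxMexpNx_1 (t ^+ 2 / 16).
have e5 := expR_ge0 (- (t ^+ 2 / 16)).
have ce : c * expR (- (t ^+ 2 / 16)) <= D.
  apply: (le_trans (ler_wpM2r e5 h)).
  by rewrite -mulrA e4 mulr1.
rewrite e2; set e := expR (- (t ^+ 2 / 16)) in e1 e3 e5 ce *.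
have p1 : 4 * a * expR (- (a / 2)) * c <= 2 * t ^+ 2 * D.
  have -> : 4 * a * expR (- (a / 2)) * c = 2 * t ^+ 2 * (c * expR (- (a / 2))).
    by rewrite aE; field.
  apply: ler_wpM2l; first by rewrite mulr_ge0.
  by apply: le_trans ce; rewrite ler_wpM2l.
have p2 : 4 * a ^+ 2 * (e * e) * c <= 16 * t ^+ 2 * D.
  have -> : 4 * a ^+ 2 * (e * e) * c = t ^+ 2 * ((t ^+ 2 * e) * (c * e)).
    by rewrite aE; field.
  have -> : 16 * t ^+ 2 * D = t ^+ 2 * (16 * D) by ring.
  apply: ler_wpM2l => //; apply: ler_pM => //; [by rewrite mulr_ge0..|lra].
lra.
Qed.

(** The bound is a perfect square, so that its root is linear in [K / r + s sqrt r]. From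
    [K >= 1 / 4] come [1 + K <= 20 K^2] and [K (1 + s) <= 5 K^2 + s^2], which make all terms
    quadratic; the factor [r] lost in [min1_growth] is paid by one power of [r^-3] in the cubic term
    and by the [r] in [(s sqrt r)^2]. *)
Lemma variance_envelope (R : realType) (t r K s a m : R) :
  0 <= t -> 1 <= r -> 1 / 4 <= K -> 0 <= s ->
  a = t ^+ 2 / 2 -> m = Num.min 1 a ->
  (4 * a * expR (- (a / 2)) + 4 * a ^+ 2 * expR (- (a / 4))) * ((1 + K) / r ^+ 2)
  + 4096 * m * (K * (1 + s) / r ^+ 3) + 272 * m * s ^+ 2 <=
  (40 * 17 ^+ 3 * (K / r + s * Num.sqrt r)) ^+ 2 *
     (t ^+ 2 * expR (t ^+ 2 / r ^+ 2)) / ((1 + t) ^+ 2 * (1 + t)).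
Proof.
move=> t0 r1 K4 s0 aE mE.
have r0 : 0 < r by lra.
have tc0 : 0 < (1 + t) ^+ 2 * (1 + t) by rewrite mulr_gt0 ?exprn_gt0//; lra.
have t20 : 0 <= t ^+ 2 by exact: sqr_ge0.
rewrite ler_pdivlMr//.
have hm := min1_growth t0 r1; rewrite -aE -mE in hm.
have hd := gauss_decay t0 aE.
set c := (1 + t) ^+ 2 * (1 + t) in tc0 hm hd *.
set F := 4 * a * _ + _ in hd *.
set e := expR (t ^+ 2 / r ^+ 2) in hm *.
have e1 : 1 <= e.
  have := expR_ge1Dx (t ^+ 2 / r ^+ 2); rewrite -/e.
  have : 0 <= t ^+ 2 / r ^+ 2 by rewrite divr_ge0 ?sqr_ge0.
  lra.
set Y := t ^+ 2 * e in hm *.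
have Y0 : 0 <= Y by rewrite mulr_ge0// ltW// expR_gt0.
have tY : t ^+ 2 <= Y by rewrite ler_peMr.
set D : R := 17 ^+ 3 in hd *.
(* As [4096 <= 17^3 = 4913], every numerical coefficient can be compared with multiples of [D] and
   [D^2]; the factor 40 leaves ample room. *)
have D1 : 64 * 64 <= D by rewrite /D; lra.
have F0 : 0 <= F.
  have a0 : 0 <= a by rewrite aE; lra.
  by rewrite addr_ge0// mulr_ge0 ?expR_ge0// mulr_ge0// sqr_ge0.
clearbody D F.
pose x := K / r.
have x0 : 0 <= x by rewrite divr_ge0//; lra.
set q := Num.sqrt r.
have q0 : 0 <= q by exact: sqrtr_ge0.
have q2 : q ^+ 2 = r by rewrite sqr_sqrtr// ltW.
pose y := s * q.
have y0 : 0 <= y by rewrite mulr_ge0.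
have y2 : y ^+ 2 = s ^+ 2 * r by rewrite exprMn q2.
have ri0 : 0 <= r^-1 by rewrite invr_ge0 ltW.
have KK : (1 + K) / r ^+ 2 <= 20 * x ^+ 2.
  have -> : 20 * x ^+ 2 = (20 * K ^+ 2) / r ^+ 2 by rewrite /x exprMn exprVn mulrA.
  rewrite ler_wpM2r ?invr_ge0 ?sqr_ge0//.
  have : 1 / 4 * K <= K * K by rewrite ler_wpM2r//; lra.
  rewrite expr2; lra.
have Ks : K * (1 + s) / r ^+ 2 <= 5 * x ^+ 2 + y ^+ 2.
  have -> : 5 * x ^+ 2 = (5 * K ^+ 2) / r ^+ 2 by rewrite /x exprMn exprVn mulrA.
  have h1 : K * (1 + s) <= 5 * K ^+ 2 + s ^+ 2.
    have : 1 / 4 * K <= K * K by rewrite ler_wpM2r//; lra.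
    have := sqr_ge0 (K - s); have := sqr_ge0 s; rewrite !expr2; lra.
  have h2 : s ^+ 2 / r ^+ 2 <= y ^+ 2.
    rewrite y2 ler_wpM2l ?sqr_ge0//.
    apply: (@le_trans _ _ 1); last by [].
    by rewrite invf_le1 ?exprn_ege1// exprn_gt0.
  have := ler_wpM2r (_ : 0 <= (r ^+ 2)^-1) h1.
  rewrite invr_ge0 sqr_ge0 => /(_ isT); rewrite mulrDl; lra.
have c00 := ltW tc0.
have P1 : F * ((1 + K) / r ^+ 2) * c <= 18 * D * Y * (20 * x ^+ 2).
  have -> : F * ((1 + K) / r ^+ 2) * c = F * c * ((1 + K) / r ^+ 2) by ring.
  apply: ler_pM => //.
  - by rewrite mulr_ge0.
  - by rewrite divr_ge0 ?sqr_ge0//; lra.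
  - by apply: (le_trans hd); rewrite ler_wpM2l//; lra.
have P2 : 4096 * m * (K * (1 + s) / r ^+ 3) * c <=
    64 * 64 * 8 * Y * (5 * x ^+ 2 + y ^+ 2).
  have -> : 4096 * m * (K * (1 + s) / r ^+ 3) * c =
      64 * 64 * ((m * c) * (K * (1 + s) / r ^+ 2) / r).
    by field; rewrite gt_eqF.
  have -> : 64 * 64 * 8 * Y * (5 * x ^+ 2 + y ^+ 2) =
      64 * 64 * ((8 * r * Y) * (5 * x ^+ 2 + y ^+ 2) / r).
    by field; rewrite gt_eqF.
  apply: ler_wpM2l; first by rewrite mulr_ge0.
  apply: ler_wpM2r => //; apply: ler_pM => //.
    by rewrite mulr_ge0// mE le_min ler01 aE; lra.
  by rewrite divr_ge0 ?sqr_ge0// mulr_ge0 ?addr_ge0//; apply: le_trans K4; rewrite divr_ge0.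
have P3 : 272 * m * s ^+ 2 * c <= 272 * 8 * Y * y ^+ 2.
  rewrite y2.
  have h : m * c * s ^+ 2 <= 8 * r * Y * s ^+ 2 by rewrite ler_wpM2r ?sqr_ge0.
  have -> : 272 * m * s ^+ 2 * c = 272 * (m * c * s ^+ 2) by ring.
  have -> : 272 * 8 * Y * (s ^+ 2 * r) = 272 * (8 * r * Y * s ^+ 2) by ring.
  by apply: ler_wpM2l h; exact: ler0n.
rewrite -/x -/y.
have S : (40 * D) ^+ 2 * (x ^+ 2 + y ^+ 2) <= (40 * D * (x + y)) ^+ 2.
  rewrite [leRHS]exprMn ler_wpM2l ?sqr_ge0//.
  by rewrite sqrrD; have := mulr_ge0 x0 y0; clear; move: (x ^+ 2) (y ^+ 2) => h1 h2; lra.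
have Yx : 0 <= Y * x ^+ 2 by rewrite mulr_ge0 ?sqr_ge0.
have Yy : 0 <= Y * y ^+ 2 by rewrite mulr_ge0 ?sqr_ge0.
have SY := ler_wpM2r Y0 S.
have D2 : 2 <= D.
  by apply: le_trans D1; rewrite -natrM ler_nat.
clearbody x y c Y.
have L : (F * ((1 + K) / r ^+ 2) + 4096 * m * (K * (1 + s) / r ^+ 3)
   + 272 * m * s ^+ 2) * c = F * ((1 + K) / r ^+ 2) * c +
   4096 * m * (K * (1 + s) / r ^+ 3) * c + 272 * m * s ^+ 2 * c by ring.
rewrite L; apply: le_trans SY; apply: (le_trans (lerD (lerD P1 P2) P3)).
have DA z : 0 <= z -> 64 * 64 * z <= D * z by move=> z0; exact: ler_wpM2r.
have D0 : 0 <= D by exact: le_trans D2.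
have DDA z : 0 <= z -> 2 * (D * z) <= D ^+ 2 * z.
  by move=> z0; rewrite expr2 -mulrA; apply: ler_wpM2r D2; exact: mulr_ge0.
have := DA _ Yx; have := DA _ Yy; have := DDA _ Yx; have := DDA _ Yy.
have -> : (40 * D) ^+ 2 * (x ^+ 2 + y ^+ 2) * Y =
   1600 * (D ^+ 2 * (Y * x ^+ 2)) + 1600 * (D ^+ 2 * (Y * y ^+ 2)) by ring.
have -> : 18 * D * Y * (20 * x ^+ 2) = 360 * (D * (Y * x ^+ 2)) by ring.
have -> : 64 * 64 * 8 * Y * (5 * x ^+ 2 + y ^+ 2) =
   40 * (64 * 64 * (Y * x ^+ 2)) + 8 * (64 * 64 * (Y * y ^+ 2)) by ring.
have -> : 272 * 8 * Y * y ^+ 2 = 272 * (8 * (Y * y ^+ 2)) by ring.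
have : 272 * (8 * (Y * y ^+ 2)) <= 64 * 64 * (Y * y ^+ 2).
  by rewrite mulrA; apply: ler_wpM2r => //; rewrite -!natrM ler_nat.
have := mulr_ge0 D0 Yx; have := mulr_ge0 D0 Yy.
move: (D ^+ 2 * (Y * x ^+ 2)) (D ^+ 2 * (Y * y ^+ 2)) (D * (Y * x ^+ 2))
  (D * (Y * y ^+ 2)) (64 * 64 * (Y * x ^+ 2)) (64 * 64 * (Y * y ^+ 2))
  (272 * (8 * (Y * y ^+ 2))) => h1 h2 h3 h4 h5 h6 h7.
clear -R; lra.
Qed.

(** * From the mean square to the mean of [cf_dist], for any [Z] with the Gaussian characteristic
    function *)

Section mean_cf.
Context d (T : measurableType d) (R : realType) (P : probability T R).
Context d' (W : measurableType d') (Q : probability W R).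
Context (n : nat) (X : T -> n.-tuple R) (Z : W -> n.-tuple R).
Hypothesis mX : measurable_fun setT X.
Hypothesis mZ : measurable_fun setT Z.
Hypothesis cfZ : forall x : n.-tuple R,
  \int[Q]_z cos (dotp x (Z z)) = expR (- (dotp x x / (2 * n%:R))).

Let proj z w : R := dotp (X w) (Z z).

Let mproj : measurable_fun setT (fun u : W * T => proj u.1 u.2).
Proof. by apply: measurable_dotp; exact: measurableT_comp. Qed.

Let mproj1 z : measurable_fun setT (proj z).
Proof. exact: (measurable_uncurry1 z mproj). Qed.

Variable t : R.

Let mtp : measurable_fun setT (fun u : W * T => t * proj u.1 u.2).
Proof. exact: measurable_funM. Qed.

Lemma measurable_mean_cf_re :
  measurable_fun setT (fun z => cf_re P (fun w => dotp (X w) (Z z)) t).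
Proof.
apply: (@measurable_Rintegral_param _ _ _ _ _ P
  (fun u => cos (t * proj u.1 u.2)) 1) => [|u]; last exact: normr_cos_le1.
exact: measurable_cos_comp.
Qed.

Lemma measurable_mean_cf_im :
  measurable_fun setT (fun z => cf_im P (fun w => dotp (X w) (Z z)) t).
Proof.
apply: (@measurable_Rintegral_param _ _ _ _ _ P
  (fun u => sin (t * proj u.1 u.2)) 1) => [|u]; last exact: normr_sin_le1.
exact: measurable_sin_comp.
Qed.

Let A z := cf_re P (proj z) t.
Let B z := cf_im P (proj z) t.

Let bounded_mean (f : T -> R) : measurable_fun setT f -> (forall w, `|f w| <= 1) ->
  `|\int[P]_w f w| <= 1.
Proof.
move=> mf fb.
have fi : P.-integrable setT (EFin \o f) by exact: (@bounded_integrable _ _ _ P _ 1).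
apply: (le_trans (le_normr_Rintegral measurableT fi)).
apply: (@le_trans _ _ (\int[P]_w 1)); last by rewrite Rintegral_prob_cst.
apply: le_Rintegral => //; last exact: finite_measure_integrable_cst.
by have := integrable_norm fi.
Qed.

Let A_le z : `|A z| <= 1.
Proof.
apply: bounded_mean => [|w]; last exact: normr_cos_le1.
by apply: measurable_cos_comp; exact: measurable_funM.
Qed.

Let B_le z : `|B z| <= 1.
Proof.
apply: bounded_mean => [|w]; last exact: normr_sin_le1.
by apply: measurable_sin_comp; exact: measurable_funM.
Qed.

Let mean_A : \int[Q]_z A z = \int[P]_w expR (- (t ^+ 2 * dotp (X w) (X w) / (2 * n%:R))).
Proof.
have mf : measurable_fun setT (fun u : W * T => cos (t * proj u.1 u.2)).
  exact: measurable_cos_comp.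
rewrite /A /cf_re.
rewrite (@Rintegral_Fubini _ _ _ _ _ Q P (fun u => cos (t * proj u.1 u.2))).
- apply: eq_Rintegral => w _; rewrite /proj /=.
  under eq_Rintegral do rewrite -dotp_scalel.
  by rewrite cfZ dotp_scalel dotp_scaler mulrA -expr2.
- move=> z; apply: (@bounded_integrable _ _ _ P _ 1) => [|w]; last exact: normr_cos_le1.
  exact: (measurable_uncurry1 z mf).
- move=> w; apply: (@bounded_integrable _ _ _ Q _ 1) => [|z]; last exact: normr_cos_le1.
  exact: (measurable_uncurry2 w mf).
- by apply: (@bounded_integrable _ _ _ (Q \x P)%E _ 1) => // u; exact: normr_cos_le1.
Qed.

Let subv (x y : n.-tuple R) : n.-tuple R := [tuple tnth x i - tnth y i | i < n].

Let dotp_subl x y v : dotp (subv x y) v = dotp x v - dotp y v.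
Proof.
by rewrite /dotp -sumrB; apply: eq_bigr => i _; rewrite tnth_mktuple mulrBl.
Qed.

Let subv_sqr x y : dotp (subv x y) (subv x y) = dotp x x + dotp y y - 2 * dotp x y.
Proof.
rewrite dotp_subl (dotpC x) (dotpC y) !dotp_subl (dotpC y x).
ring.
Qed.

(** Symmetrisation: [A^2 + B^2] is the mean of [cos(t <X - Y, z>)] over two independent copies, by
    the cosine subtraction formula; averaging over [Z] then gives an exponential of [|X - Y|^2]. *)
Let mean_sqr : \int[Q]_z (A z ^+ 2 + B z ^+ 2) =
  \int[(P \x P)%E]_u expR (- (t ^+ 2 * (dotp (X u.1) (X u.1) + dotp (X u.2) (X u.2)
      - 2 * dotp (X u.1) (X u.2)) / (2 * n%:R))).
Proof.
pose f (v : W * (T * T)) := cos (t * proj v.1 v.2.1 - t * proj v.1 v.2.2).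
have mf : measurable_fun setT f.
  apply: measurable_cos_comp; apply: measurable_funB; apply: measurable_funM => //.
    apply: measurable_dotp; last exact: measurableT_comp.
    by apply: (measurableT_comp mX); exact: measurableT_comp.
  apply: measurable_dotp; last exact: measurableT_comp.
  by apply: (measurableT_comp mX); exact: measurableT_comp.
transitivity (\int[Q]_z \int[(P \x P)%E]_u f (z, u)).
  apply: eq_Rintegral => z _.
  have mtz : measurable_fun setT (fun w => t * proj z w) by exact: measurable_funM.
  have [i1 e1] := Rintegral_prod_mul P P (measurable_cos_comp mtz)
    (measurable_cos_comp mtz) (fun w => normr_cos_le1 _) (fun w => normr_cos_le1 _).
  have [i2 e2] := Rintegral_prod_mul P P (measurable_sin_comp mtz)
    (measurable_sin_comp mtz) (fun w => normr_sin_le1 _) (fun w => normr_sin_le1 _).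
  rewrite !expr2 /A /B /cf_re /cf_im -e1 -e2 -RintegralD//.
  by apply: eq_Rintegral => u _; rewrite /f cosB.
rewrite (@Rintegral_Fubini _ _ _ _ _ Q (P \x P)%E f).
- apply: eq_Rintegral => u _; rewrite /f /proj /=.
  under eq_Rintegral do rewrite -mulrBr -dotp_subl -dotp_scalel.
  by rewrite cfZ dotp_scalel dotp_scaler mulrA -expr2 subv_sqr.
- move=> z; apply: (@bounded_integrable _ _ _ (P \x P)%E _ 1) => [|w]; last exact: normr_cos_le1.
  exact: (measurable_uncurry1 z mf).
- move=> w; apply: (@bounded_integrable _ _ _ Q _ 1) => [|z]; last exact: normr_cos_le1.
  exact: (measurable_uncurry2 w mf).
- by apply: (@bounded_integrable _ _ _ (Q \x (P \x P))%E _ 1) => // u; exact: normr_cos_le1.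
Qed.

(* AM-GM, |x| <= x^2 / (2 l) + l / 2, replaces the Cauchy-Schwarz inequality
   in passing from the mean square to the mean of [cf_dist]. *)
Lemma mean_cf_dist_le (l : R) : 0 < l -> (0 < n)%N ->
  let a := t ^+ 2 / 2 in
  \int[(P \x P)%E]_u expR (- (a * (dotp (X u.1) (X u.1) / n%:R
       + dotp (X u.2) (X u.2) / n%:R - 2 * (dotp (X u.1) (X u.2) / n%:R))))
   - 2 * expR (- a) * \int[P]_w expR (- (a * (dotp (X w) (X w) / n%:R)))
   + expR (- a) ^+ 2 <= l ^+ 2 ->
  (\int[Q]_z (cf_dist P (fun w => dotp (X w) (Z z)) t)%:E <= (3 / 2 * l)%:E)%E.
Proof.
move=> l0 n0 a.
have n0' : 0 < n%:R :> R by rewrite ltr0n.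
set e := expR (- a).
have mA : measurable_fun setT A := measurable_mean_cf_re.
have mB : measurable_fun setT B := measurable_mean_cf_im.
have iA : Q.-integrable setT (EFin \o A) by exact: (@bounded_integrable _ _ _ Q _ 1).
have iAB : Q.-integrable setT (EFin \o (fun z => A z ^+ 2 + B z ^+ 2)).
  apply: integrableDR.
    apply: (@bounded_integrable _ _ _ Q _ 1) => [|z]; first exact: measurable_funX.
    by rewrite normrX exprn_ile1.
  apply: (@bounded_integrable _ _ _ Q _ 1) => [|z]; first exact: measurable_funX.
  by rewrite normrX exprn_ile1.
have -> : \int[P]_w expR (- (a * (dotp (X w) (X w) / n%:R))) = \int[Q]_z A z.
  rewrite mean_A; apply: eq_Rintegral => w _; congr (expR (- _)).
  by rewrite /a; field; rewrite gt_eqF.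
have -> : \int[(P \x P)%E]_u expR (- (a * (dotp (X u.1) (X u.1) / n%:R
       + dotp (X u.2) (X u.2) / n%:R - 2 * (dotp (X u.1) (X u.2) / n%:R)))) =
   \int[Q]_z (A z ^+ 2 + B z ^+ 2).
  rewrite mean_sqr; apply: eq_Rintegral => u _; congr (expR (- _)).
  by rewrite /a; field; rewrite gt_eqF.
move=> hV.
(* This is [((A - e)^2 + B^2 + 2 l^2) / (2 l)], expanded so that its mean involves only the means of
   [A] and of [A^2 + B^2]. It dominates [|A - e| + |B|] and has mean at most [l / 2 + l]. *)
pose g z := (2 * l)^-1 * ((A z ^+ 2 + B z ^+ 2) - 2 * e * A z) + ((2 * l)^-1 * e ^+ 2 + l).
have i1 := integrableZR (2 * e) iA.
have i2 := integrableZR (2 * l)^-1 (integrableBR iAB i1).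
have icst : Q.-integrable setT (EFin \o (fun z : W => (2 * l)^-1 * e ^+ 2 + l)).
  exact: finite_measure_integrable_cst.
have ig : Q.-integrable setT (EFin \o g) by exact: integrableDR.
apply: (@le_trans _ _ (\int[Q]_z (g z)%:E)%E).
  apply: ge0_le_integral => //.
  - by move=> z _; rewrite lee_fin cf_dist_ge0.
  - apply/measurable_EFinP; apply: measurable_funD; apply: measurableT_comp => //.
    exact: measurable_funB.
  - by case/integrableP : ig.
  - move=> z _; rewrite lee_fin /cf_dist -/(A z) -/(B z) -/a -/e /g.
    have -> : (2 * l)^-1 * (A z ^+ 2 + B z ^+ 2 - 2 * e * A z) + ((2 * l)^-1 * e ^+ 2 + l)
       = (2 * l)^-1 * (`|A z - e| ^+ 2 + `|B z| ^+ 2 + 2 * l ^+ 2).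
      rewrite !real_normK ?num_real//; field; rewrite gt_eqF//.
    rewrite mulrC ler_pdivlMr ?mulr_gt0//.
    have := sqr_ge0 (`|A z - e| - l); have := sqr_ge0 (`|B z| - l).
    rewrite !sqrrB; lra.
rewrite -[leLHS]fineK ?(integrable_fin_num measurableT ig)// lee_fin.
rewrite -/(Rintegral Q setT _) /g RintegralD// RintegralZl//; last exact: integrableBR.
rewrite RintegralB// RintegralZl// Rintegral_prob_cst.
set V1 := \int[Q]_z _ in hV *; set V2 := \int[Q]_z _ in hV *.
have -> : (2 * l)^-1 * (V1 - 2 * e * V2) + ((2 * l)^-1 * e ^+ 2 + l) =
   (2 * l)^-1 * (V1 - 2 * e * V2 + e ^+ 2) + l by ring.
have h : (2 * l)^-1 * (V1 - 2 * e * V2 + e ^+ 2) <= (2 * l)^-1 * l ^+ 2.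
  by rewrite ler_wpM2l// invr_ge0 mulr_ge0// ltW.
apply: (le_trans (lerD h (lexx l))).
have -> : (2 * l)^-1 * l ^+ 2 = l / 2 by field; rewrite gt_eqF.
lra.
Qed.
End mean_cf.

(** The square root of the factor [(1 + |t|)^(-3)] of the envelope; the exponent [3 / 2] exceeds 1,
    so it remains integrable. *)
Definition decay {R : realType} (t : R) : R := (1 + `|t|) `^ (- (3 / 2)).

Lemma decay_sqr (R : realType) (t : R) :
  decay t ^+ 2 = ((1 + `|t|) ^+ 2 * (1 + `|t|))^-1.
Proof.
have p : 0 <= 1 + `|t| by rewrite addr_ge0.
rewrite -exprSr -powR_mulrn ?powR_ge0// -powRrM.
by rewrite (_ : - (3 / 2) * 2%:R = - 3%:R); [exact: powR_invn|lra].
Qed.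

Lemma decay_gt0 (R : realType) (t : R) : 0 < decay t.
Proof. by rewrite powR_gt0// ltr_pwDl. Qed.

Lemma continuous_decay (R : realType) : continuous (@decay R).
Proof.
move=> t; rewrite /decay.
have p : 0 < 1 + `|t| by rewrite ltr_pwDl.
have c1 : {for t, continuous (fun x : R => 1 + `|x|)}.
  by apply: (@cvgD _ R^o); [exact: cvg_cst|apply: cvg_norm; exact: cvg_id].
have c2 : {for 1 + `|t|, continuous (fun y : R => y `^ (- (3 / 2)))}.
  exact: is_derive_continuous (is_derive1_powR _ p).
exact: (continuous_comp c1 c2).
Qed.

Lemma integral_decay (R : realType) :
  (\int[lebesgue_measure]_t (decay (t : R))%:E = 4%:E)%E.
Proof.
rewrite ge0_symfun_integralT; last 3 first.
- by move=> x; rewrite ltW// decay_gt0.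
- exact: continuous_decay.
- by move=> x; rewrite /= /decay normrN.
rewrite -set_itvcy.
pose F (t : R) := -2 * (1 + t) `^ (- (1 / 2)).
have dF (x : R) : 0 <= x -> is_derive x (1 : R) F (decay x).
  move=> x0; have p : 0 < 1 + x by lra.
  have h0 : is_derive x (1 : R) (fun y : R => 1 + y) 1.
    by apply: is_derive_eq; rewrite add0r mulr1.
  have h := @is_derive1_comp _ (fun y : R => y `^ (- (1 / 2))) _ _ _ _
    (is_derive1_powR _ p) h0.
  have -> : F = -2 \*: ((fun y : R => y `^ (- (1 / 2))) \o (fun y => 1 + y)) by [].
  apply: (is_derive_eq (is_deriveZ (-2) h)).
  rewrite /decay ger0_norm// /GRing.scale/=.
  have -> : - (3 / 2) = - (1 / 2) - 1 :> R by lra.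
  by field.
have cF (x : R) : 0 <= x -> {for x, continuous F}.
  by move=> x0; exact: is_derive_continuous (dF x x0).
rewrite (@ge0_continuous_FTC2y _ _ F 0 0).
- rewrite /F addr0 powR1 mulr1 -EFinB -EFinM; congr _%:E; lra.
- by move=> x _; rewrite ltW// decay_gt0.
- apply: continuous_subspaceT; exact: continuous_decay.
- have F_le (x : R) : 0 < x -> `|F x| <= 2 / Num.sqrt x.
    move=> x0; have p : 0 <= 1 + x by lra.
    rewrite /F normrM normrN (ger0_norm (powR_ge0 _ _)) ger0_norm// ler_wpM2l//.
    rewrite powRN mul1r powR12_sqrt// lef_pV2 ?posrE ?sqrtr_gt0//; last lra.
    by rewrite ler_wsqrtr//; lra.
  apply/cvgrPdist_le => e e0; near=> x.
  have x0 : 0 < x by near: x; exact: nbhs_pinfty_gt.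
  have x1 : (2 / e) ^+ 2 <= x by near: x; apply: nbhs_pinfty_ge; exact: num_real.
  rewrite sub0r normrN (le_trans (F_le _ x0))//.
  rewrite ler_pdivrMr ?sqrtr_gt0// mulrC -ler_pdivrMr//.
  have h0 : 0 <= 2 / e by rewrite divr_ge0// ltW.
  by rewrite -(ler_pXn2r (n:=2)) ?nnegrE ?sqrtr_ge0// sqr_sqrtr ?(ltW x0).
- by move=> x x0; case: (dF x (ltW x0)).
- exact: cvg_at_right_filter (cF _ (lexx 0)).
- move=> x; rewrite in_itv/= andbT => x0.
  by rewrite derive1E; apply: derive_val; exact: dF (ltW x0).
Unshelve. all: by end_near. Qed.

(** * Integration of the mean [cf_dist] over the frequency *)

Section mean_smoothing.
Context d (T : measurableType d) (R : realType) (P : probability T R).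
Context d' (W : measurableType d') (Q : probability W R).
Context (n : nat) (X : T -> n.-tuple R) (Z : W -> n.-tuple R) (K s : R).
Hypothesis n_gt0 : (0 < n)%N.
Hypothesis mX : measurable_fun setT X.
Hypothesis mZ : measurable_fun setT Z.
Hypothesis cfZ : forall x : n.-tuple R,
  \int[Q]_z cos (dotp x (Z z)) = expR (- (dotp x x / (2 * n%:R))).
Hypothesis K_ge : 1 / 4 <= K.
Hypothesis third_moment : forall v : n.-tuple R,
  (\int[P]_w (`|dotp (X w) v| ^+ 3)%:E <= (K * enorm v ^+ 3)%:E)%E.
Hypothesis dev_moment :
  (\int[P]_w (pow32 (dotp (X w) (X w) / n%:R - 1))%:E <= s%:E)%E.
Hypothesis iU : P.-integrable setT (EFin \o (fun w => dotp (X w) (X w) / n%:R)).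
Hypothesis mean_U : \int[P]_w (dotp (X w) (X w) / n%:R) = 1.

Let r : R := Num.sqrt n%:R.
Let C : R := 40 * 17 ^+ 3 * (K / r + s * Num.sqrt r).

Let r1 : 1 <= r.
Proof. by rewrite -[leLHS]sqrtr1 ler_wsqrtr// ler1n. Qed.
Let r0 : 0 < r. Proof. exact: lt_le_trans r1. Qed.
Let r2 : r ^+ 2 = n%:R. Proof. by rewrite sqr_sqrtr. Qed.

Let K0 : 0 <= K. Proof. by apply: le_trans K_ge; rewrite divr_ge0. Qed.

Let s0 : 0 <= s.
Proof.
rewrite -lee_fin; apply: le_trans dev_moment; apply: integral_ge0 => w _.
by rewrite lee_fin pow32_ge0.
Qed.

Let C0 : 0 < C.
Proof.
apply: mulr_gt0; first by apply: mulr_gt0; [exact: ltr0n|rewrite exprn_gt0].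
apply: ltr_pwDl; last by rewrite mulr_ge0// sqrtr_ge0.
by rewrite divr_gt0//; apply: lt_le_trans K_ge; rewrite divr_gt0.
Qed.

(** Here [l] in [mean_cf_dist_le] is the square root of the envelope; it is positive because
    [t != 0] and [K >= 1 / 4]. *)
Lemma mean_cf_dist_decay (t : R) : t != 0 ->
  (\int[Q]_z (cf_dist P (fun w => dotp (X w) (Z z)) t)%:E <=
   (3 / 2 * (C * (`|t| * expR (t ^+ 2 / (2 * r ^+ 2)) * decay t)))%:E)%E.
Proof.
move=> t0; have nt0 : 0 < `|t| by rewrite normr_gt0.
apply: (mean_cf_dist_le mX mZ cfZ) => //.
  apply: mulr_gt0 => //; apply: mulr_gt0; last exact: decay_gt0.
  by apply: mulr_gt0 => //; exact: expR_gt0.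
have a0 : 0 <= t ^+ 2 / 2 by rewrite divr_ge0// sqr_ge0.
apply: (le_trans (variance_le n_gt0 mX K0 third_moment dev_moment iU mean_U a0)).
have aE : t ^+ 2 / 2 = `|t| ^+ 2 / 2 by rewrite real_normK ?num_real.
rewrite -/r -r2.
have h := variance_envelope (ltW nt0) r1 K_ge s0 aE erefl.
apply: (le_trans h); rewrite -/C real_normK ?num_real//.
rewrite [leRHS]exprMn -mulrA ler_wpM2l ?sqr_ge0//.
rewrite 2!exprMn real_normK ?num_real// decay_sqr ler_wpM2r//.
rewrite ler_wpM2l ?sqr_ge0// -expRM_natr.
have -> // : t ^+ 2 / (2 * r ^+ 2) * 2%:R = t ^+ 2 / r ^+ 2.
by field; rewrite gt_eqF.
Qed.

Lemma measurable_cf_ratio :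
  measurable_fun setT (fun u : W * R =>
    cf_dist P (fun w => dotp (X w) (Z u.1)) u.2 / `|u.2|).
Proof.
have mu3 : measurable_fun setT (fun u : (W * R) * T => u.1.2 * dotp (X u.2) (Z u.1.1)).
  apply: measurable_funM.
    by apply: measurableT_comp => //.
  apply: measurable_dotp; first exact: measurableT_comp.
  by apply: (measurableT_comp mZ); exact: measurableT_comp.
have mre : measurable_fun setT (fun u : W * R =>
    cf_re P (fun w => dotp (X w) (Z u.1)) u.2).
  apply: (@measurable_Rintegral_param _ _ _ _ _ P (fun u : (W * R) * T =>
     cos (u.1.2 * dotp (X u.2) (Z u.1.1))) 1) => [|u]; last exact: normr_cos_le1.
  exact: measurable_cos_comp.
have mim : measurable_fun setT (fun u : W * R =>
    cf_im P (fun w => dotp (X w) (Z u.1)) u.2).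
  apply: (@measurable_Rintegral_param _ _ _ _ _ P (fun u : (W * R) * T =>
     sin (u.1.2 * dotp (X u.2) (Z u.1.1))) 1) => [|u]; last exact: normr_sin_le1.
  exact: measurable_sin_comp.
apply: measurable_funM; last first.
  apply: (measurableT_comp (@measurable_invr R)); apply: measurableT_comp => //.
apply: measurable_funD; apply: measurableT_comp => //.
apply: measurable_funB => //; apply: measurable_expR_comp.
apply: measurable_funN; apply: measurable_funM => //.
by apply: measurable_funX.
Qed.

Lemma mean_smoothing_le :
  (\int[Q]_z \int[normal_prob 0 r]_t
      (cf_dist P (fun w => dotp (X w) (Z z)) t / `|t|)%:E <= (6 * C / r)%:E)%E.
Proof.
pose f (u : W * R) := cf_dist P (fun w => dotp (X w) (Z u.1)) u.2 / `|u.2|.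
have mf : measurable_fun setT f by exact: measurable_cf_ratio.
have mfE : measurable_fun setT (EFin \o f) by exact/measurable_EFinP.
have f0 u : (0 <= (EFin \o f) u)%E by rewrite lee_fin divr_ge0// cf_dist_ge0.
rewrite (@fubini_tonelli _ _ _ _ _ Q (normal_prob 0 r) (EFin \o f) mfE f0).
pose g (t : R) := 3 / 2 * C * (expR (t ^+ 2 / (2 * r ^+ 2)) * decay t).
have g0 t : 0 <= g t.
  rewrite /g mulr_ge0//; first by rewrite mulr_ge0 ?(ltW C0)// divr_ge0.
  by rewrite mulr_ge0 ?expR_ge0 ?(ltW (decay_gt0 t)).
have mg : measurable_fun setT g.
  apply: measurable_funM => //; apply: measurable_funM.
    apply: measurable_expR_comp; apply: measurable_funM => //.
  by apply: continuous_measurable_fun; exact: continuous_decay.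
apply: (@le_trans _ _ (\int[normal_prob 0 r]_t (g t)%:E)%E).
  apply: ge0_le_integral => //.
  - by move=> t _; apply: integral_ge0.
  - exact: (@measurable_fun_fubini_tonelli_G _ _ _ _ _ Q (EFin \o f) mfE f0).
  - exact/measurable_EFinP.
  - move=> t _.
    (* At [t = 0] the ratio is 0 by the convention for the inverse of zero. *)
    have [->|t0] := eqVneq t 0.
      rewrite (@eq_integral _ _ _ Q setT (cst 0%E)).
        by rewrite integral0 lee_fin.
      by move=> z _; rewrite /f /= normr0 invr0 mulr0.
    have nt0 : 0 < `|t| by rewrite normr_gt0.
    rewrite (@eq_integral _ _ _ Q setT (fun z =>
      (`|t|^-1)%:E * (cf_dist P (fun w => dotp (X w) (Z z)) t)%:E)%E); last first.
      by move=> z _; rewrite /f /= -EFinM mulrC.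
    have mcd : measurable_fun setT (fun z =>
        (cf_dist P (fun w => dotp (X w) (Z z)) t)%:E).
      apply/measurable_EFinP; apply: measurable_funD; apply: measurableT_comp => //.
        by apply: measurable_funB => //; exact: measurable_mean_cf_re.
      exact: measurable_mean_cf_im.
    have cd0 z : [set: W] z -> (0 <= (cf_dist P (fun w => dotp (X w) (Z z)) t)%:E)%E.
      by move=> _; rewrite lee_fin cf_dist_ge0.
    have ti0 : (0 <= (`|t|^-1)%:E)%E by rewrite lee_fin invr_ge0.
    rewrite ge0_integralZl//.
    apply: (le_trans (lee_wpmul2l _ (mean_cf_dist_decay t0))).
      by rewrite lee_fin invr_ge0.
    rewrite -EFinM lee_fin /g le_eqVlt; apply/orP; left; apply/eqP.
    by field; rewrite ?gt_eqF.
rewrite ge0_integral_normal_prob ?gt_eqF//; last exact/measurable_EFinP.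
pose c := 3 / 2 * C * normal_peak r.
have E t : ((g t)%:E * (normal_pdf 0 r t)%:E = c%:E * (decay t)%:E)%E.
  rewrite -!EFinM normal_pdfE ?gt_eqF// /g /c /normal_fun subr0; congr EFin.
  (* The density of N(0, r^2) cancels the growth of the envelope exactly. What remains is [decay],
     of integral 4, and [3 / 2 * 4 = 6]. *)
  have h : expR (t ^+ 2 / (2 * r ^+ 2)) * expR (- t ^+ 2 / (r ^+ 2 *+ 2)) = 1.
    rewrite -expRD -[RHS](expR0 R); congr expR; field; rewrite gt_eqF//.
  move: h; set e1 := expR _; set e2 := expR (- _ / _) => h.
  transitivity (3 / 2 * C * normal_peak r * decay t * (e1 * e2)); first ring.
  by rewrite h mulr1.
under eq_integral do rewrite E.
have md : measurable_fun setT (fun t : R => (decay t)%:E).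
  by apply/measurable_EFinP; apply: continuous_measurable_fun; exact: continuous_decay.
have d0 (t : R) : setT t -> (0 <= (decay t)%:E)%E.
  by move=> _; rewrite lee_fin ltW// decay_gt0.
have c0 : (0 <= c%:E)%E.
  by rewrite lee_fin /c mulr_ge0 ?normal_peak_ge0// mulr_ge0 ?(ltW C0)// divr_ge0.
rewrite ge0_integralZl//.
rewrite integral_decay -EFinM lee_fin /c normal_peakE//.
have -> : 3 / 2 * C * (normal_peak 1 / r) * 4 = 6 * C / r * normal_peak 1 by field; rewrite gt_eqF.
rewrite ler_piMr ?normal_peak1_le//.
by rewrite divr_ge0 ?(ltW r0)// mulr_ge0 ?(ltW C0).
Qed.
End mean_smoothing.

(** * Kolmogorov distance averaged over the sphere *)

(** Comparison that asks no measurability of [f]: the integral of a nonnegative function is the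
    supremum over the simple functions below it, and these also lie below [g]. It is meant for the
    Kolmogorov distance, a supremum over uncountably many points, as a function of the direction. *)
Lemma le_integral_upper d (T : measurableType d) (R : realType)
    (mu : {measure set T -> \bar R}) (D : set T) (f g : T -> \bar R) :
  (forall x, D x -> 0 <= f x)%E -> (forall x, 0 <= g x)%E ->
  (forall x, D x -> f x <= g x)%E ->
  (\int[mu]_(x in D) f x <= \int[mu]_x g x)%E.
Proof.
move=> f0 g0 fg; rewrite ge0_integralE// ge0_integralTE//.
apply: le_ereal_sup => _ [h hf <-]; exists h => // x.
apply: (le_trans (hf x)); rewrite /patch; case: ifPn => // xD.
by apply: fg; exact: set_mem.
Qed.

Lemma kolmogorov_ge0 (R : realType) (U V : R -> \bar R) : (0 <= kolmogorov U V)%E.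
Proof.
apply: (@le_trans _ _ (`|U 0%R - V 0%R|)%E) => //.
by apply: ereal_sup_ubound; exists 0.
Qed.

(** For [r > 0] the events [S <= x] and [r S <= r x] coincide, so only the normal distribution
    function changes, from [x] to [r x]. For [r = 0], which occurs at [g = 0], the added term is 3
    and the distance is at most 1. *)
Lemma kolmogorov_scale d (T : measurableType d) (R : realType)
    (P : probability T R) (S : T -> R) (r : R) :
  measurable_fun setT S -> 0 <= r ->
  (kolmogorov (fun x => P [set w | (S w <= x)%R]) (@Phi R) <=
   kolmogorov (fun x => P [set w | (r * S w <= x)%R]) (@Phi R) +
   (3 * `|r ^+ 2 - 1|)%:E)%E.
Proof.
move=> mS; rewrite le_eqVlt => /predU1P[<-|r0].
  rewrite expr0n sub0r normrN1 mulr1.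
  apply: (@le_trans _ _ 3%:E); last by rewrite leeDr ?kolmogorov_ge0.
  apply: ge_ereal_sup => _ [x _ <-].
  have mx := measurable_le_set x mS.
  rewrite -[P _]fineK ?fin_num_measure// -[Phi x]fineK ?fin_num_measure//.
  rewrite -EFinB lee_fin.
  have := normal_cdf_le1 1 x; rewrite /normal_cdf -/(Phi x).
  have : 0 <= fine (P [set w | (S w <= x)%R]) <= 1.
    rewrite fine_ge0//= -lee_fin fineK ?fin_num_measure//.
    exact: probability_le1.
  by rewrite ler_norml; lra.
apply: ge_ereal_sup => _ [x _ <-].
have mx := measurable_le_set x mS.
have PE : P [set w | (r * S w <= r * x)%R] = P [set w | (S w <= x)%R].
  by congr (P _); apply/seteqP; split => w /=; rewrite ler_pM2l.
apply: (@le_trans _ _ (`|P [set w | (r * S w <= r * x)%R] - Phi (r * x)| +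
    (3 * `|r ^+ 2 - 1|)%:E)%E); last first.
  by rewrite leeD2r//; apply: ereal_sup_ubound; exists (r * x).
rewrite PE -[P _]fineK ?fin_num_measure//.
rewrite -[Phi x]fineK ?fin_num_measure// -[Phi (r * x)]fineK ?fin_num_measure//.
rewrite -!EFinB -EFinD lee_fin.
have h := normal_cdf_scale x (ltW r0); rewrite /normal_cdf -!/(Phi _) in h.
rewrite (le_trans (ler_distD (fine (Phi (r * x))) _ _))// lerD2l//.
Qed.

Section mean_kolmogorov.
Context d (T : measurableType d) (R : realType) (P : probability T R).
Context (n : nat) (X : T -> n.-tuple R) (mu : probability (n.-tuple R) R) (K s : R).
Hypothesis n_gt0 : (0 < n)%N.
Hypothesis uniform_mu : uniform_on_sphere mu.
Hypothesis mX : measurable_fun setT X.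
Hypothesis K_ge : 1 / 4 <= K.
Hypothesis third_moment : forall v : n.-tuple R,
  (\int[P]_w (`|dotp (X w) v| ^+ 3)%:E <= (K * enorm v ^+ 3)%:E)%E.
Hypothesis dev_moment :
  (\int[P]_w (pow32 (dotp (X w) (X w) / n%:R - 1))%:E <= s%:E)%E.
Hypothesis iU : P.-integrable setT (EFin \o (fun w => dotp (X w) (X w) / n%:R)).
Hypothesis mean_U : \int[P]_w (dotp (X w) (X w) / n%:R) = 1.

Let r : R := Num.sqrt n%:R.
Let C : R := 40 * 17 ^+ 3 * (K / r + s * Num.sqrt r).

Let r0 : 0 < r. Proof. by rewrite sqrtr_gt0 ltr0n. Qed.

Let radial (z : n.-tuple R * n.-tuple R) := scalev (enorm z.2 / r) z.1.

Let measurable_radial : measurable_fun setT radial.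
Proof.
apply/measurable_fun_tnthP => i.
rewrite (_ : _ \o _ = fun z => enorm z.2 / r * tnth z.1 i).
  apply: measurable_funM.
    by apply: measurable_funM => //; exact: measurable_enorm.
  by apply: (measurableT_comp (measurable_tnth i)).
by apply/funext => z /=; rewrite tnth_mktuple.
Qed.

Let integrable_proj v : P.-integrable setT (EFin \o (fun w => dotp (X w) v)).
Proof.
have mdv : measurable_fun setT (fun w => dotp (X w) v) by exact: measurable_dotp.
have m3 : measurable_fun setT (fun w => `|dotp (X w) v| ^+ 3).
  by apply: measurable_funX; exact: measurableT_comp.
have p3 w : 0 <= `|dotp (X w) v| ^+ 3 by rewrite exprn_ge0.
have [i3 _] := ge0_integrable_bound m3 p3 (third_moment v).
apply: (@le_integrableR _ _ _ P _ (fun w => 1 + `|dotp (X w) v| ^+ 3)) => //.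
  move=> w; move: (normr_ge0 (dotp (X w) v)); move: `|_| => y y0.
  have : 0 <= (y - 1) ^+ 2 * (y + 2) by rewrite mulr_ge0 ?sqr_ge0//; lra.
  have : 0 <= y ^+ 3 by rewrite exprn_ge0.
  nra.
by apply: integrableDR => //; exact: finite_measure_integrable_cst.
Qed.

(** The bound [B (theta, g)] holds for every [g] while its left side depends on [theta] alone, so it
    may be averaged over [g]. The constants are [63 = 15 + 3 * 16] and [12 C = 2 r * (6 C / r)]. *)
Lemma mean_kolmogorov_le :
  (\int[mu]_(theta in sphere)
     kolmogorov (fun x => P [set w | (dotp (X w) theta <= x)%R]) (@Phi R)
   <= (63 / r + 12 * C)%:E)%E.
Proof.
have [G [cfG expG]] := gaussian_vector R n.
pose I z := (\int[normal_prob 0 r]_t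
  (cf_dist P (fun w => dotp (X w) (radial z)) t / `|t|)%:E)%E.
have I0 z : (0 <= I z)%E.
  by apply: integral_ge0 => t _; rewrite lee_fin divr_ge0// cf_dist_ge0.
have mI : measurable_fun setT I.
  pose f (u : (n.-tuple R * n.-tuple R) * R) :=
    (cf_dist P (fun w => dotp (X w) (radial u.1)) u.2 / `|u.2|)%:E.
  apply: (@measurable_fun_fubini_tonelli_F _ _ _ _ _ (normal_prob 0 r) f).
    by apply/measurable_EFinP; exact: (measurable_cf_ratio _ mX measurable_radial).
  by move=> u; rewrite lee_fin divr_ge0// cf_dist_ge0.
have II : (\int[(mu \x G)%E]_z I z <= (6 * C / r)%:E)%E.
  apply: mean_smoothing_le => // x.
  rewrite -(radial_cf x uniform_mu cfG); apply: eq_Rintegral => z _.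
  by rewrite /radial dotp_scaler.
pose D (z : n.-tuple R * n.-tuple R) := (`|dotp z.2 z.2 / n%:R - 1|)%:E.
have mD : measurable_fun setT D.
  apply/measurable_EFinP; apply: measurableT_comp => //.
  by apply: measurable_funB => //; apply: measurable_funM => //; exact: measurable_dotp.
have D0 z : (0 <= D z)%E by rewrite lee_fin.
have ID : (\int[(mu \x G)%E]_z D z <= (16 / r)%:E)%E.
  rewrite (@fubini_tonelli1 _ _ _ _ _ mu G D mD D0).
  apply: (@le_trans _ _ (\int[mu]_theta (16 / r)%:E)%E); last first.
    by rewrite integral_cst//; have /= -> := probability_setT mu; rewrite mule1.
  apply: ge0_le_integral => //.
  - by move=> x _; exact: integral_ge0.
  - exact: measurable_fun_fubini_tonelli_F.
  - by move=> theta _; exact: gaussian_norm_dev.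
pose B z := ((15 / r)%:E + (2 * r)%:E * I z + 3%:E * D z)%E.
have c0 : (0 <= (15 / r)%:E)%E by rewrite lee_fin divr_ge0// ltW.
have c1 : (0 <= (2 * r)%:E)%E by rewrite lee_fin mulr_ge0// ltW.
have mB1 : measurable_fun setT (fun z => (2 * r)%:E * I z)%E by exact: emeasurable_funM.
have mB2 : measurable_fun setT (fun z => 3%:E * D z)%E by exact: emeasurable_funM.
have B1 z : (0 <= (2 * r)%:E * I z)%E by exact: mule_ge0.
have B2 z : (0 <= 3%:E * D z)%E by exact: mule_ge0.
have mB : measurable_fun setT B.
  by apply: emeasurable_funD => //; exact: emeasurable_funD.
have B0 z : (0 <= B z)%E by rewrite !adde_ge0.
have kB theta g :
    (kolmogorov (fun x => P [set w | (dotp (X w) theta <= x)%R]) (@Phi R) <=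
     B (theta, g))%E.
  have rg : 0 <= enorm g / r by rewrite divr_ge0 ?sqrtr_ge0.
  have mS : measurable_fun setT (fun w => dotp (X w) theta) by exact: measurable_dotp.
  apply: (le_trans (@kolmogorov_scale _ _ _ P _ _ mS rg)); rewrite /B.
  have -> : (enorm g / r) ^+ 2 = dotp g g / n%:R.
    by rewrite expr_div_n enorm_sqr sqr_sqrtr.
  rewrite -EFinM leeD2r//.
  have E w : enorm g / r * dotp (X w) theta = dotp (X w) (radial (theta, g)).
    by rewrite dotp_scaler.
  under [X in kolmogorov X]eq_fun do under eq_set do rewrite E.
  by apply: kolmogorov_smoothing_le => //; exact: measurable_dotp.
apply: (@le_trans _ _ (\int[mu]_theta \int[G]_g B (theta, g))%E).
  apply: le_integral_upper => [theta _|theta|theta _]; first exact: kolmogorov_ge0.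
    by apply: integral_ge0 => g _.
  set k := kolmogorov _ _.
  have -> : k = (\int[G]_g cst k g)%E.
    by rewrite integral_cst//; have /= -> := probability_setT G; rewrite mule1.
  apply: ge0_le_integral => //.
  - by move=> g _; exact: kolmogorov_ge0.
  - exact: (measurableT_comp mB).
  - by move=> g _; exact: kB.
rewrite -(@fubini_tonelli1 _ _ _ _ _ mu G B mB B0) /B.
rewrite ge0_integralD//; last 2 first.
- by move=> z _; rewrite adde_ge0.
- exact: emeasurable_funD.
rewrite ge0_integralD// !ge0_integralZl// integral_cst//.
have /= -> := probability_setT (mu \x G)%E; rewrite mule1.
apply: (@le_trans _ _ ((15 / r)%:E + (2 * r)%:E * (6 * C / r)%:E + 3%:E * (16 / r)%:E)%E).
  by rewrite leeD// ?leeD2l// lee_wpmul2l.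
rewrite -!EFinM -!EFinD lee_fin le_eqVlt; apply/orP; left; apply/eqP.
by field; rewrite gt_eqF.
Qed.

End mean_kolmogorov.

Lemma powR32 (R : realType) (x : R) : `|x| `^ (3 / 2) = pow32 x.
Proof.
rewrite /pow32; have [->|x0] := eqVneq `|x| 0.
  by rewrite powR0 ?mul0r// gt_eqF.
have -> : 3 / 2 = 1 + 2^-1 :> R by field.
rewrite powRD; last by apply/implyP.
by rewrite powRr1// powR12_sqrt.
Qed.

(** * Relating [M_3] and [sigma_3] to the moments [K] and [s] *)

Section moments.
Context d (T : measurableType d) (R : realType) (P : probability T R).
Context (n : nat) (X : {RV P >-> n.-tuple R}).
Hypothesis n_gt0 : (0 < n)%N.

Let mX : measurable_fun setT X. Proof. exact: measurable_funPT. Qed.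

Let nR_gt0 : 0 < n%:R :> R. Proof. by rewrite ltr0n. Qed.

Let basis (i : 'I_n) : n.-tuple R := [tuple (j == i)%:R | j < n].

Let dotp_basis x i : dotp x (basis i) = tnth x i.
Proof.
rewrite /dotp (bigD1 i)//= tnth_mktuple eqxx mulr1 big1 ?addr0// => j ji.
by rewrite tnth_mktuple (negbTE ji) mulr0.
Qed.

Let enorm_basis i : enorm (basis i) = 1.
Proof. by rewrite /enorm dotp_basis tnth_mktuple eqxx sqrtr1. Qed.

Lemma moment_sup_ge0 : (0 <= moment_sup X 3)%E.
Proof.
apply: (@le_trans _ _ ('N[P]_(3%:E)[EFin \o weighted_sum X (basis (Ordinal n_gt0))])%E).
  exact: Lnorm_ge0.
by apply: ereal_sup_ubound; exists (basis (Ordinal n_gt0)) => //; exact: enorm_basis.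
Qed.

(** Homogeneity: a nonzero [v] is [enorm v] times a unit vector, to which the supremum applies. *)
Lemma third_moment_le v : (moment_sup X 3 < +oo)%E ->
  (\int[P]_w (`|dotp (X w) v| ^+ 3)%:E <=
   (fine (moment_sup X 3) ^+ 3 * enorm v ^+ 3)%:E)%E.
Proof.
move=> Moo; have M0 := moment_sup_ge0.
have Mfin : moment_sup X 3 \is a fin_num by rewrite ge0_fin_numE.
have unit_le theta : enorm theta = 1 ->
    (\int[P]_w (`|dotp (X w) theta| ^+ 3)%:E <= (fine (moment_sup X 3) ^+ 3)%:E)%E.
  move=> t1; set f := EFin \o weighted_sum X theta.
  have -> : (\int[P]_w (`|dotp (X w) theta| ^+ 3)%:E = 'N[P]_(3%:E)[f] `^ 3)%E.
    rewrite poweR_Lnorm//; apply: eq_integral => w _.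
    by rewrite -powR_mulrn.
  rewrite -powR_mulrn ?fine_ge0// -poweR_EFin fineK//.
  have itv (x : \bar R) : (0 <= x)%E -> x \in `[0%E, +oo%E]%R.
    by move=> x0; rewrite in_itv/= x0 leey.
  apply: gt0_ler_poweR; [by []|exact/itv/Lnorm_ge0|exact/itv|].
  by apply: ereal_sup_ubound; exists theta.
have [v0|v0] := eqVneq (enorm v) 0.
  rewrite v0 expr0n mulr0 (@eq_integral _ _ _ P setT (cst 0%E)) ?integral0//.
  by move=> w _; rewrite (dotp_enorm0 _ v0) normr0 expr0n.
pose theta := scalev (enorm v)^-1 v.
have t1 : enorm theta = 1.
  rewrite /enorm dotp_scalel dotp_scaler -enorm_sqr.
  by rewrite [X in Num.sqrt X](_ : _ = 1) ?sqrtr1//; field.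
rewrite (@eq_integral _ _ _ P setT (fun w =>
  (enorm v ^+ 3)%:E * (`|dotp (X w) theta| ^+ 3)%:E)%E); last first.
  move=> w _; rewrite -EFinM -exprMn; congr (_ ^+ 3)%:E.
  rewrite dotp_scaler normrM normfV (ger0_norm (sqrtr_ge0 _)).
  by rewrite mulrA divff ?mul1r.
have e0 : (0 <= (enorm v ^+ 3)%:E)%E by rewrite lee_fin exprn_ge0// sqrtr_ge0.
have m3 : measurable_fun setT (fun w => (`|dotp (X w) theta| ^+ 3)%:E).
  apply/measurable_EFinP; apply: measurable_funX; apply: measurableT_comp => //.
  exact: measurable_dotp.
rewrite ge0_integralZl//.
rewrite mulrC [leRHS]EFinM; apply: lee_wpmul2l => //; exact: unit_le.
Qed.

(** Summing [y^2 <= 1 / 2 + 2 y^3] over the coordinates [y = |X_i|] and taking means gives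
    [n <= n / 2 + 2 n K]. *)
Lemma third_moment_ge (K : R) :
  (forall v : n.-tuple R,
    (\int[P]_w (`|dotp (X w) v| ^+ 3)%:E <= (K * enorm v ^+ 3)%:E)%E) ->
  (\int[P]_w (dotp (X w) (X w))%:E = n%:R%:E)%E -> 1 / 4 <= K.
Proof.
move=> third EX.
have m3 i : measurable_fun setT (fun w => (`|dotp (X w) (basis i)| ^+ 3)%:E).
  apply/measurable_EFinP; apply: measurable_funX; apply: measurableT_comp => //.
  exact: measurable_dotp.
have p3 i w : [set: T] w -> (0 <= (`|dotp (X w) (basis i)| ^+ 3)%:E)%E.
  by move=> _; rewrite lee_fin exprn_ge0.
have nK : n%:R <= n%:R / 2 + 2 * (n%:R * K).
  rewrite -lee_fin -EX.
  apply: (@le_trans _ _ (\int[P]_w ((n%:R / 2)%:E +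
      2%:E * \sum_(i < n) (`|dotp (X w) (basis i)| ^+ 3)%:E))%E).
    have mS : measurable_fun setT (fun w => \sum_(i < n) (`|dotp (X w) (basis i)| ^+ 3)%:E)%E.
      exact: emeasurable_sum.
    apply: ge0_le_integral => //.
    - by move=> w _; rewrite lee_fin dotp_ge0.
    - by apply/measurable_EFinP; exact: measurable_dotp.
    - by apply: emeasurable_funD => //; exact: emeasurable_funM.
    - move=> w _; rewrite sumEFin -EFinM -EFinD lee_fin mulr_sumr.
      have -> : n%:R / 2 = \sum_(i < n) (1 / 2) :> R.
        by rewrite sumr_const card_ord -[RHS]mulr_natl mulrA mulr1.
      rewrite -big_split; apply: ler_sum => i _ /=; rewrite dotp_basis.
      rewrite -expr2 -real_normK ?num_real//.
      move: (normr_ge0 (tnth (X w) i)); move: `|_| => y y0.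
      have [y2|y2] := leP y (1 / 2).
        have : 0 <= y ^+ 3 by rewrite exprn_ge0.
        nra.
      have : 0 <= y ^+ 2 * (2 * y - 1) by rewrite mulr_ge0 ?sqr_ge0//; lra.
      nra.
  have mS : measurable_fun setT (fun w => \sum_(i < n) (`|dotp (X w) (basis i)| ^+ 3)%:E)%E.
    exact: emeasurable_sum.
  have S0 w : [set: T] w -> (0 <= \sum_(i < n) (`|dotp (X w) (basis i)| ^+ 3)%:E)%E.
    by move=> _; apply: sume_ge0 => i _; exact: p3.
  have S2 w : [set: T] w ->
      (0 <= 2%:E * \sum_(i < n) (`|dotp (X w) (basis i)| ^+ 3)%:E)%E.
    by move=> wT; rewrite mule_ge0// S0.
  have mS2 : measurable_fun setT (fun w =>
      2%:E * \sum_(i < n) (`|dotp (X w) (basis i)| ^+ 3)%:E)%E.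
    exact: emeasurable_funM.
  rewrite ge0_integralD//.
  rewrite integral_cst// ge0_integralZl// ge0_integral_sum//.
  have /= -> := probability_setT P; rewrite mule1 [leRHS]EFinD leeD2l// [leRHS]EFinM lee_wpmul2l//.
  have -> : (n%:R * K)%:E = (\sum_(i < n) K%:E)%E.
    by rewrite sumEFin sumr_const card_ord mulr_natl.
  by apply: lee_sum => i _; rewrite (le_trans (third _))// enorm_basis expr1n mulr1.
have : n%:R * (1 / 4) <= n%:R * K by lra.
by rewrite ler_pM2l.
Qed.

Lemma sigma_momentE :
  (sigma_moment X 3 `^ (3 / 2) = (pow32 (Num.sqrt n%:R))%:E *
   \int[P]_w (pow32 (dotp (X w) (X w) / n%:R - 1))%:E)%E.
Proof.
rewrite /sigma_moment poweRM ?lee_fin ?sqrtr_ge0 ?Lnorm_ge0//.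
congr (_ * _)%E.
  by rewrite poweR_EFin -powR32 ger0_norm ?sqrtr_ge0.
rewrite poweR_Lnorm//; apply: eq_integral => w _.
by rewrite -powR32 -enorm_sqr.
Qed.

End moments.

Theorem theorem1p1 (R : realType) :
  exists2 c : R, 0 < c &
  forall (n : nat) (d : measure_display) (T : measurableType d)
    (P : probability T R) (X : {RV P >-> n.-tuple R})
    (mu : probability (n.-tuple R) R),
  (2 <= n)%N ->
  uniform_on_sphere mu ->
  ('E_P[(fun w => enorm (X w) ^+ 2)%R] = n%:R%:E)%E ->
  (\int[mu]_(theta in sphere) kolmogorov (Fdist X theta) (@Phi R)
    <= c%:E * (moment_sup X 3 `^ 3 + sigma_moment X 3 `^ (3 / 2))
       * ((Num.sqrt n%:R)^-1)%:E)%E.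
Proof.
(* [D] is the constant of [12 C] in [mean_kolmogorov_le]; the remaining 252 is [4 * 63], from
   [63 <= 252 K]. *)
pose D : R := 12 * (40 * 17 ^+ 3).
have D0 : 0 < D by rewrite /D mulr_gt0// mulr_gt0// exprn_gt0.
have c0 : 0 < 252 + D by apply: addr_gt0; [rewrite ltr0n|exact: D0].
exists (252 + D) => // n d T P X mu n2 unif EX.
have n0 : (0 < n)%N by exact: ltnW.
have nR0 : 0 < n%:R :> R by rewrite ltr0n.
have mX : measurable_fun setT X by exact: measurable_funPT.
have mXX : measurable_fun setT (fun w => dotp (X w) (X w)) by exact: measurable_dotp.
have {}EX : (\int[P]_w (dotp (X w) (X w))%:E = n%:R%:E)%E.
  by rewrite -EX expectation.unlock; apply: eq_integral => w _; rewrite -enorm_sqr.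
pose r : R := Num.sqrt n%:R.
have r0 : 0 < r by rewrite sqrtr_gt0.
have ri0 : (0 < r^-1%:E)%E by rewrite lte_fin invr_gt0.
have M0 := moment_sup_ge0 X n0.
(* An infinite moment makes the right side infinite, the other summand being nonnegative and both
   outer factors positive; finite [M_3] and [sigma_3] remain. *)
have infty_case a b : (0 <= a)%E -> (0 <= b)%E -> a = +oo%E \/ b = +oo%E ->
    ((252 + D)%:E * (a + b) * r^-1%:E = +oo)%E.
  move=> a0 b0 [->|->].
    by rewrite addye ?gt0_muley ?gt0_mulye// -ltNye (lt_le_trans _ b0)// ltNy0.
  by rewrite addey ?gt0_muley ?gt0_mulye// -ltNye (lt_le_trans _ a0)// ltNy0.
have [Moo|Moo] := eqVneq (moment_sup X 3) +oo%E.
  rewrite infty_case ?leey ?poweR_ge0//; left.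
  by rewrite Moo poweRyr.
set S := (\int[P]_w (pow32 (dotp (X w) (X w) / n%:R - 1))%:E)%E.
have S0 : (0 <= S)%E.
  by apply: integral_ge0 => w _; rewrite lee_fin pow32_ge0.
have pr0 : (0 < (pow32 r)%:E)%E.
  by rewrite lte_fin /pow32 gtr0_norm// mulr_gt0// sqrtr_gt0.
have [Soo|Soo] := eqVneq S +oo%E.
  rewrite infty_case ?leey ?poweR_ge0//; right.
  by rewrite sigma_momentE -/S Soo gt0_muley.
pose K := fine (moment_sup X 3) ^+ 3; pose s := fine S.
have Mfin : moment_sup X 3 \is a fin_num by rewrite ge0_fin_numE// ltey.
have SE : S = s%:E by rewrite fineK// ge0_fin_numE// ltey.
have third v := third_moment_le n0 v (etrans (ltey _) Moo).
have K4 := third_moment_ge n0 third EX.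
have EU : (\int[P]_w (dotp (X w) (X w) / n%:R)%:E = 1)%E.
  transitivity (n%:R^-1%:E * \int[P]_w (dotp (X w) (X w))%:E)%E.
    have mE : measurable_fun setT (fun w => (dotp (X w) (X w))%:E) by exact/measurable_EFinP.
    have E0 w : [set: T] w -> (0 <= (dotp (X w) (X w))%:E)%E.
      by move=> _; rewrite lee_fin dotp_ge0.
    rewrite -ge0_integralZl//.
    by apply: eq_integral => w _; rewrite mulrC EFinM.
  by rewrite EX -EFinM mulVf// gt_eqF.
have mU : measurable_fun setT (fun w => dotp (X w) (X w) / n%:R).
  exact: measurable_funM.
have U0 w : 0 <= dotp (X w) (X w) / n%:R by rewrite divr_ge0// dotp_ge0.
have EU1 : (\int[P]_w (dotp (X w) (X w) / n%:R)%:E <= 1%:E)%E by rewrite EU.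
have [iU _] := ge0_integrable_bound mU U0 EU1.
have mean_U : \int[P]_w (dotp (X w) (X w) / n%:R) = 1 by rewrite /Rintegral EU.
have dev : (S <= s%:E)%E by rewrite SE.
apply: (le_trans (mean_kolmogorov_le n0 unif mX K4 third dev iU mean_U)).
rewrite sigma_momentE -/S SE.
have -> : (moment_sup X 3 `^ 3 = K%:E)%E.
  by rewrite -[moment_sup X 3]fineK// poweR_EFin powR_mulrn// fine_ge0.
rewrite -[leRHS]/(((252 + D) * (K + pow32 r * s) / r)%:E) lee_fin -/r -/K.
have -> : 12 * (40 * 17 ^+ 3 * (K / r + s * Num.sqrt r)) = D * (K / r + s * Num.sqrt r).
  by rewrite mulrA.
have -> : (252 + D) * (K + pow32 r * s) / r = (252 + D) * (K / r + s * Num.sqrt r).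
  by rewrite /pow32 gtr0_norm//; field; rewrite gt_eqF.
set b := s * Num.sqrt r; have b0 : 0 <= b by rewrite mulr_ge0 ?sqrtr_ge0 ?fine_ge0.
rewrite [leRHS]mulrDl lerD2r.
(* The moment-free term [63 / r] is absorbed into [K / r] through [K >= 1 / 4]. *)
have -> : 63 / r = 252 * (1 / 4 / r) by field; rewrite gt_eqF.
rewrite ler_pM2l ?ltr0n//; apply: (@le_trans _ _ (K / r)); last by rewrite lerDl.
by rewrite ler_pM2r ?invr_gt0.
Qed.
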